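(* Let $\mathcal{A}\subset[-\pi,\pi[$ be an open, non-empty interval modulo $2\pi$ with $\mathcal{A}\neq[-\pi,\pi[$, let $\mathcal{R}^{\mathcal{A}}:L^2(\Omega)\to L^2(\Omega'_{\mathcal{A}})$ be the limited-angle Radon transform, and consider families of discretizations as described in the context. Then: (1) If $\delta_s\to0$, $\frac{\delta_\varphi}{\delta_s}\to0$ and $\frac{\delta_x}{\delta_s}\to0$, then $\mathcal{R}_{\delta_s,\delta_\varphi}^{\delta_x}\to\mathcal{R}^{\mathcal{A}}$ in the operator norm for linear continuous mappings $L^2(\Omega)\to L^2(\Omega'_{\mathcal{A}})$ and $(\mathcal{R}_{\delta_s,\delta_\varphi}^{\delta_x})^*\to(\mathcal{R}^{\mathcal{A}})^*$ in the operator norm for linear continuous mappings $L^2(\Omega'_{\mathcal{A}})\to L^2(\Omega)$. If additionally $\delta_\varphi=\mathcal{O}(\delta_s^{1+\epsilon})$ and $\delta_x=\mathcal{O}(\delta_s^{1+\epsilon})$ for some $0<\epsilon\le\frac12$, then $\|\mathcal{R}_{\delta_s,\delta_\varphi}^{\delta_x}-\mathcal{R}^{\mathcal{A}}\|=\mathcal{O}(\delta_s^\epsilon)$ and $\|(\mathcal{R}_{\delta_s,\delta_\varphi}^{\delta_x})^*-(\mathcal{R}^{\mathcal{A}})^*\|=\mathcal{O}(\delta_s^\epsilon)$ as $\delta_s\to0$. (2) Let $f\in L^2(\Omega)$ be such that $\omega_{\mathcal{R}^{\mathcal{A}}f}(h,0)=\mathcal{O}(|h|^\epsilon)$ for some $\epsilon>0$.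 If $\delta_\varphi=\mathcal{O}(\delta_s^{1+\epsilon})$ and $\delta_x=\mathcal{O}(\delta_s^{1+\epsilon})$, then $\|\mathcal{R}_{\delta_s,\delta_\varphi}^{\delta_x}f-\mathcal{R}^{\mathcal{A}}f\|=\mathcal{O}(\delta_s^\epsilon)$ as $\delta_s\to0$. Moreover, under the same conditions on $\delta_\varphi,\delta_x$, for $g\in L^2(\Omega'_{\mathcal{A}})$ with $\omega_g(h,0)=\mathcal{O}(|h|^\epsilon)$ we have $\|(\mathcal{R}_{\delta_s,\delta_\varphi}^{\delta_x})^*g-(\mathcal{R}^{\mathcal{A}})^*g\|=\mathcal{O}(\delta_s^\epsilon)$ as $\delta_s\to0$.
   Context: Let $\Omega=B(0,1)\subset\mathbb{R}^2$ be the unit ball, $\vartheta(\varphi)=(\cos\varphi,\sin\varphi)$, $\vartheta(\varphi)^\perp=(-\sin\varphi,\cos\varphi)$; angles are taken modulo $2\pi$. Put $\Omega'_{\mathcal{A}}={]{-1,1}[}\times\mathcal{A}$. Functions on $\Omega$ are extended by zero to $\mathbb{R}^2$, functions on $\Omega'_{\mathcal{A}}$ by zero to $\mathbb{R}\times\mathcal{A}$. The limited-angle Radon transform is the Radon transform restricted to $\Omega'_{\mathcal{A}}$: $[\mathcal{R}^{\mathcal{A}}f](s,\varphi)=\int_{\mathbb{R}}f\bigl(s\vartheta(\varphi)+t\vartheta(\varphi)^\perp\bigr)\,dt$ for $(s,\varphi)\in\Omega'_{\mathcal{A}}$, a linear continuous operator $L^2(\Omega)\to L^2(\Omega'_{\mathcal{A}})$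 (by continuous extension); $(\cdot)^*$ denotes Hilbert space adjoints. Modulus of continuity in the offset for $g\in L^2(\Omega'_{\mathcal{A}})$: $\omega_g(h,0)=\bigl(\int_{\mathcal{A}}\int_{\mathbb{R}}|g(s+h,\varphi)-g(s,\varphi)|^2\,ds\,d\varphi\bigr)^{1/2}$; statements $\omega_g(h,0)=\mathcal{O}(|h|^\epsilon)$ are for $h\to0$. Discretization. Offsets: $P\in\mathbb{N}$, $\delta_s>0$, $s_p=\delta_s\bigl(p-\frac{P+1}{2}\bigr)$, $S_p=[s_p-\frac{\delta_s}{2},s_p+\frac{\delta_s}{2}[$, $p=1,\dots,P$, with ${]{-1,1}[}\subset\bigcup_pS_p$. Angles: $\varphi_1<\varphi_2<\dots<\varphi_Q$ in $\mathbb{R}$ with ${]{\varphi_1,\varphi_Q}[}=\mathcal{A}$ modulo $2\pi$, $\varphi_0=\varphi_1$, $\varphi_{Q+1}=\varphi_Q$, $\Phi_q=[\frac{\varphi_{q-1}+\varphi_q}{2},\frac{\varphi_q+\varphi_{q+1}}{2}[$ modulo $2\pi$ (these form an a.e. partition of $\mathcal{A}$), $\delta_\varphi=\max_{q=1,\dots,Q}(\varphi_{q+1}-\varphi_q)$. Image grid: $N,M\in\mathbb{N}$, $\delta_x>0$, $x_{ij}=\delta_x\bigl(i-\frac{N+1}{2},j-\frac{M+1}{2}\bigr)$, $X_{ij}=x_{ij}+[-\frac{\delta_x}{2},\frac{\delta_x}{2}[^2$, $i=1,\dots,N$, $j=1,\dots,M$, with $\Omega\subset\bigcup_{i,j}X_{ij}$.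 Let $w_{\delta_s}(t)=\max(0,\delta_s-|t|)$. Fully discrete (limited-angle) Radon transform: for $f\in L^2(\Omega)$ and $(s,\varphi)\in\Omega'_{\mathcal{A}}$, $$[\mathcal{R}_{\delta_s,\delta_\varphi}^{\delta_x}f](s,\varphi)=\frac{1}{\delta_s^2}\sum_{q=1}^Q\sum_{p=1}^P\chi_{S_p}(s)\chi_{\Phi_q}(\varphi)\sum_{i=1}^{N}\sum_{j=1}^{M}w_{\delta_s}\bigl(x_{ij}\cdot\vartheta(\varphi_q)-s_p\bigr)\int_{X_{ij}}f(x)\,dx,$$ an operator $L^2(\Omega)\to L^2(\Omega'_{\mathcal{A}})$. *)

(* Defs.v *)
From HB Require Import structures.
From mathcomp Require Import all_boot all_order all_algebra.
From mathcomp Require Import all_classical all_reals all_analysis.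

Set Implicit Arguments.
Unset Strict Implicit.
Unset Printing Implicit Defensive.

Import Order.TTheory GRing.Theory Num.Theory.
Import numFieldNormedType.Exports.

Local Open Scope classical_set_scope.
Local Open Scope ring_scope.

(* L^2 spaces are modelled by real-valued representatives: for D a subset of
   the plane, L2 D consists of the square integrable functions on R * R that
   vanish outside D (the extension by zero of the functions on D).  All the
   quantities below (norms, inner products, operators) only depend on classes
   modulo a.e. equality, up to a.e. equality of the results. *)

Section L2.
Context {R : realType}.
Implicit Types (D E : set (R * R)) (f g : R * R -> R).
Implicit Types (T : (R * R -> R) -> (R * R -> R)).

Definition mu2 : {measure set (measurableTypeR R * measurableTypeR R) -> \bar R} :=
  (@lebesgue_measure R \x @lebesgue_measure R)%E.

Definition L2 D : set (R * R -> R) :=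
  [set f | f \in Lfun mu2 2%:E /\ forall x, ~ D x -> f x = 0].

Definition normL2 f : \bar R := 'N[mu2]_2%:E [EFin \o f].

Definition inner f g : R := \int[mu2]_x (f x * g x).

Definition opnorm D T : \bar R :=
  ereal_sup [set normL2 (T f) | f in [set f | L2 D f /\ (normL2 f <= 1)%E]].

(* The Hilbert space adjoint of T : L2 D -> L2 E, selected by choice: for
   g in L2 E, adjoint D T g is the element h of L2 D, unique a.e., such that
   <T f, g> = <f, h> for all f in L2 D; it exists (Riesz) when T is bounded.
   It is only meant to be applied to elements of L2 E. *)
Definition adjoint D T g : R * R -> R :=
  xget (cst 0) [set h | L2 D h /\ forall f, L2 D f -> inner (T f) g = inner f h].

End L2.

(* u = O(v) along F for extended real valued u: u is eventually finite and
   its real value is O(v). *)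
Definition ebigO {R : realType} {I : Type} (F : filter_on I) (u : I -> \bar R)
    (v : I -> R) : Prop :=
  (\forall i \near F, u i \is a fin_num) /\ (fine \o u : I -> R) =O_F v.

Section Radon.
Context {R : realType}.
Implicit Types (A : set R) (f g : R * R -> R).

(* Angles are identified with their representatives in [-pi, pi[. *)
Definition mod2pi (S : set R) : set R :=
  [set phi | -pi <= phi < pi /\ exists k : int, S (phi + 2 * pi * k%:~R)].

Definition open_interval_mod2pi A : Prop :=
  exists a b : R, A = mod2pi `]a, b[.

Definition Omega : set (R * R) := [set x | x.1 ^+ 2 + x.2 ^+ 2 < 1].

Definition OmegaA A : set (R * R) := `]-1, 1[ `*` A.

(* For f in L2 Omega, f is integrable on almost every line, hence the line
   integrals define the continuous extension of the Radon transform to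
   L2 Omega up to a.e. equality. *)
Definition radon A f : R * R -> R :=
  (fun y => \int[@lebesgue_measure R]_t
     f (y.1 * cos y.2 - t * sin y.2, y.1 * sin y.2 + t * cos y.2))
  \_ (OmegaA A).

Definition offset_modulus A g (h : R) : \bar R :=
  ((\int[@lebesgue_measure R]_(phi in A) \int[@lebesgue_measure R]_s
     (`|g (s + h, phi) - g (s, phi)| ^+ 2)%:E) `^ 2^-1)%E.

Definition offset (P : nat) (ds : R) (p : nat) : R :=
  ds * (p%:R - P.+1%:R / 2).

Definition offset_cell (P : nat) (ds : R) (p : nat) : set R :=
  `[offset P ds p - ds / 2, offset P ds p + ds / 2[.

Definition pixel_center (N M : nat) (dx : R) (i j : nat) : R * R :=
  (dx * (i%:R - N.+1%:R / 2), dx * (j%:R - M.+1%:R / 2)).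

Definition pixel (N M : nat) (dx : R) (i j : nat) : set (R * R) :=
  let x := pixel_center N M dx i j in
  `[x.1 - dx / 2, x.1 + dx / 2[ `*` `[x.2 - dx / 2, x.2 + dx / 2[.

(* Only the values angle 0, ..., angle nQ.+1 are relevant. *)
Record discretization A := Discretization {
  nP : nat;
  ds : R;
  ds_gt0 : 0 < ds;
  offset_cover : `]-1, 1[ `<=` \bigcup_(p in `[1%N, nP]) offset_cell nP ds p;
  nQ : nat;
  angle : nat -> R;
  angle_lt : forall q, (1 <= q < nQ)%N -> angle q < angle q.+1;
  angle_range : mod2pi `]angle 1, angle nQ[ = A;
  angle_first : angle 0 = angle 1;
  angle_last : angle nQ.+1 = angle nQ;
  nN : nat;
  nM : nat;
  dx : R;
  dx_gt0 : 0 < dx;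
  pixel_cover : Omega `<=` \bigcup_(i in `[1%N, nN]) \bigcup_(j in `[1%N, nM])
    pixel nN nM dx i j }.

Definition angle_cell A (d : discretization A) (q : nat) : set R :=
  mod2pi `[(angle d q.-1 + angle d q) / 2, (angle d q + angle d q.+1) / 2[.

Definition dphi A (d : discretization A) : R :=
  \big[Num.max/0]_(1 <= q < (nQ d).+1) (angle d q.+1 - angle d q).

Definition weight (del t : R) : R := Num.max 0 (del - `|t|).

Definition discrete_radon A (d : discretization A) f : R * R -> R :=
  (fun y => (ds d ^+ 2)^-1 *
    \sum_(1 <= q < (nQ d).+1) \sum_(1 <= p < (nP d).+1)
      \1_(offset_cell (nP d) (ds d) p) y.1 * \1_(angle_cell d q) y.2 *
      \sum_(1 <= i < (nN d).+1) \sum_(1 <= j < (nM d).+1)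
        let x := pixel_center (nN d) (nM d) (dx d) i j in
        weight (ds d) (x.1 * cos (angle d q) + x.2 * sin (angle d q)
                       - offset (nP d) (ds d) p) *
        \int[mu2]_(z in pixel (nN d) (nM d) (dx d) i j) f z)
  \_ (OmegaA A).

End Radon.

(* Main.v *)
(* Write u for the Radon transform of f and E u for its average in the offset
   against the kernel kappa (s, sg) = weight (sg - s_p) / ds^2, for s in S_p.
   Since the weight is 1-Lipschitz and supported in a strip of width O(ds),
   replacing x . theta by its value at the centres of the pixel and of the
   angular cell costs, by Cauchy-Schwarz on the strip, O(e) |f| between the
   discrete transform and E u, where e = (dx + dphi) / ds is small.  By Jensen,
   |E u - u|^2 is at most the double integral of kappa |u(sg) - u(s)|^2 (the
   dispersion of u), hence is controlled by the offset modulus of u at shifts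
   |h| <= 3/2 ds.
   For f >= 0 the squared offset modulus of u is twice the difference of the
   integrals over r of m (|r|) and m (sqrt (r^2 + h^2)), where m is the circular
   autocorrelation of f.  As r |-> sqrt (r^2 + h^2) is a contraction of ]0, +oo[
   onto ]|h|, +oo[, only the radii |r| <= |h| contribute, so the difference is
   O(|h|) |f|^2; a general f is split into positive and negative parts.
   For the adjoints, let v be the difference of the adjoints at g.  Then |v|^2
   is the pairing of g with the error at v, and as kappa has integral 1 in each
   variable, the pairing of E u - u with g is the integral of
   kappa u(sg) (g(s) - g(sg)), at most |u| times the square root of the
   dispersion of g: the regularity of g replaces that of u. *)

Require Import Defs.
From HB Require Import structures.
From mathcomp Require Import all_boot all_order all_algebra.
From mathcomp Require Import all_classical all_reals all_analysis.
From mathcomp Require Import measurable_realfun.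
From mathcomp Require Import ring lra.

Set Implicit Arguments.
Unset Strict Implicit.
Unset Printing Implicit Defensive.

Import Order.TTheory GRing.Theory Num.Theory.
Import numFieldNormedType.Exports.

Local Open Scope classical_set_scope.
Local Open Scope ring_scope.

(** The identity for the modulus needs all directions: only after integration over a full period of
    angles does the pairing of [u] with its shift depend on the displacement of two points through
    its length alone. The indicator of [A] is therefore bounded by that of a full period before
    estimating. That [A] is not the whole circle serves the angular cells: the interval of angles is
    then no longer than one period, so cells do not overlap modulo [2 * pi]. A squared modulus of
    order [|h|], valid for every [f], is smoothing of order one half; it produces the term in
    [sqrt ds] and the restriction to exponents at most one half for operator norms. In the pointwise
    statements the assumed modulus takes its place. Line integrals may fail to be finite on a
    negligible set of lines. Identities are thus first proved for nonnegative functions with values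
    in the extended reals, without subtraction, and hold for real values only almost everywhere.
    Since [adjoint] is a choice, an element representing the pairing must be exhibited: the
    backprojection for the Radon transform, the transposed kernel for the discrete one. *)

Section Measurability.
Context {R : realType} {d} {T : measurableType d}.

Lemma measurable_fun_nat_of_bool (b : T -> bool) :
  measurable_fun setT b -> measurable_fun setT (fun x => (b x)%:R : R).
Proof.
move=> mb; rewrite [X in measurable_fun _ X](_ : _ =
    (fun x => if b x then 1 else 0)).
  exact: measurable_fun_ifT.
by apply/funext => x; case: (b x).
Qed.

Lemma measurable_fun_cos (f : T -> R) :
  measurable_fun setT f -> measurable_fun setT (fun x => cos (f x)).
Proof.
move=> mf; apply: (measurableT_comp _ mf).
exact: (continuous_measurable_fun (@continuous_cos R)).
Qed.

Lemma measurable_fun_sin (f : T -> R) :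
  measurable_fun setT f -> measurable_fun setT (fun x => sin (f x)).
Proof.
move=> mf; apply: (measurableT_comp _ mf).
exact: (continuous_measurable_fun (@continuous_sin R)).
Qed.

Lemma measurable_fun_sqrt (f : T -> R) :
  measurable_fun setT f -> measurable_fun setT (fun x => Num.sqrt (f x)).
Proof.
move=> mf; apply: (measurableT_comp _ mf).
exact: (continuous_measurable_fun (@sqrt_continuous R)).
Qed.

Lemma measurable_fun_norm (f : T -> R) :
  measurable_fun setT f -> measurable_fun setT (fun x => `|f x|).
Proof. by move=> mf; exact: (measurableT_comp _ mf). Qed.

Lemma measurable_fun_opp (f : T -> R) :
  measurable_fun setT f -> measurable_fun setT (fun x => - f x).
Proof. by move=> mf; exact: (measurableT_comp _ mf). Qed.

Lemma measurable_fun_fine (f : T -> \bar R) :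
  measurable_fun setT f -> measurable_fun setT (fun x => fine (f x)).
Proof. by move=> mf; apply: (measurableT_comp _ mf) => //; exact: fine_measurable. Qed.

Lemma measurable_fun_EFin (f : T -> R) :
  measurable_fun setT f -> measurable_fun setT (fun x => (f x)%:E).
Proof. by move=> mf; exact: (measurableT_comp _ mf). Qed.

Lemma measurable_fun_fst2 {d1 d2} {T1 : measurableType d1}
    {T2 : measurableType d2} (f : T -> T1 * T2) :
  measurable_fun setT f -> measurable_fun setT (fun x => (f x).1).
Proof. by move=> mf; apply: (measurableT_comp _ mf). Qed.

Lemma measurable_fun_snd2 {d1 d2} {T1 : measurableType d1}
    {T2 : measurableType d2} (f : T -> T1 * T2) :
  measurable_fun setT f -> measurable_fun setT (fun x => (f x).2).
Proof. by move=> mf; apply: (measurableT_comp _ mf). Qed.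

End Measurability.

(** For a signed [F] the integral is the difference of the integrals of the positive and negative
    parts, to each of which Tonelli applies. *)
Lemma measurable_fun_integral {R : realType} {d1 d2}
    {T1 : measurableType d1} {T2 : measurableType d2}
    (m : {sigma_finite_measure set T2 -> \bar R}) (F : T1 -> T2 -> \bar R) :
  measurable_fun setT (fun z : T1 * T2 => F z.1 z.2) ->
  measurable_fun setT (fun x => \int[m]_y F x y)%E.
Proof.
move=> mF; pose f := (fun z : T1 * T2 => F z.1 z.2).
have -> : (fun x => \int[m]_y F x y)%E
    = (fubini_F m f^\+ \- fubini_F m f^\-)%E.
  by apply/funext => x; rewrite integralE /fubini_F; congr (_ - _)%E; apply: eq_integral => y _; rewrite unlock.
apply: emeasurable_funB; apply: measurable_fun_fubini_tonelli_F => //.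
  exact: measurable_funepos.
exact: measurable_funeneg.
Qed.

Section Mu2SigmaFinite.
Context {R : realType}.
Lemma sigma_finite_mu2 : sigma_finite setT (@mu2 R).
Proof.
exists (fun n => `[- n%:R, n%:R] `*` `[- n%:R, n%:R])%classic.
  rewrite predeqE => -[x y]; split=> // _.
  pose m := (Num.bound `|x| + Num.bound `|y|)%N.
  exists m => //=; rewrite !in_itv/= -!ler_norml; split.
  - by apply: (le_trans (ltW (archi_boundP (normr_ge0 x)))); rewrite ler_nat leq_addr.
  - by apply: (le_trans (ltW (archi_boundP (normr_ge0 y)))); rewrite ler_nat leq_addl.
move=> n; split; first exact: measurableX.
rewrite /mu2 /= product_measure1E//= lebesgue_measure_itv/=.
by case: ifP => _; rewrite -?EFinB -?EFinM ?mule0 ?ltry.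
Qed.

(** [mu2] is declared as a bare measure; this is the same measure bundled with its sigma-finiteness,
    which iterated integrals over the plane and a further space require. *)
Definition mu2_sf : {sigma_finite_measure set (measurableTypeR R * measurableTypeR R)%type -> \bar R} :=
  HB.pack (Measure.sort (@mu2 R)) (Measure_isSigmaFinite.Build _ _ _ (@mu2 R) sigma_finite_mu2).

End Mu2SigmaFinite.

Lemma measurable_fun_integral_mu2 {R : realType} {d1}
    {T1 : measurableType d1} (F : T1 -> R * R -> \bar R) :
  measurable_fun setT (fun z : T1 * (R * R) => F z.1 z.2) ->
  measurable_fun setT (fun x => \int[mu2]_y F x y)%E.
Proof.
move=> mF.
exact: (measurable_fun_integral mu2_sf mF).
Qed.

(** Decomposes a measurability goal along the syntax of the function. The [change] branches
    eta-expand partial applications so that the structural branches recognise them; the last branch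
    closes constants. *)
Ltac meas_step :=
  lazymatch goal with
  | H : measurable_fun _ ?f |- measurable_fun _ ?f => exact: H
  | H : measurable_fun _ ?f |- measurable_fun _ (fun z => ?f _) =>
      apply: (measurableT_comp H)
  | |- measurable_fun _ (fun x => x) => apply: measurable_id
  | |- measurable_fun _ (@fst _ _) => exact: measurable_fst
  | |- measurable_fun _ (@snd _ _) => exact: measurable_snd
  | |- measurable_fun _ (fun x => fst x) => exact: measurable_fst
  | |- measurable_fun _ (fun x => snd x) => exact: measurable_snd
  | |- measurable_fun _ (fun x => fst _) => apply: measurable_fun_fst2
  | |- measurable_fun _ (fun x => snd _) => apply: measurable_fun_snd2
  | |- measurable_fun _ (fun x => (_, _)) => apply: measurable_fun_pair
  | |- measurable_fun _ (fun x => EFin _) => apply: measurable_fun_EFin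
  | |- measurable_fun _ (fun x => fine _) => apply: measurable_fun_fine
  | |- measurable_fun _ (fun x => cos _) => apply: measurable_fun_cos
  | |- measurable_fun _ (fun x => sin _) => apply: measurable_fun_sin
  | |- measurable_fun _ (fun x => Num.sqrt _) => apply: measurable_fun_sqrt
  | |- measurable_fun _ (fun x => @Num.norm _ _ _) => apply: measurable_fun_norm
  | |- measurable_fun _ (fun x => @GRing.exp _ _ _) => apply: measurable_funX
  | |- measurable_fun _ (fun x => andb _ _) => apply: measurable_and
  | |- measurable_fun _ (fun x => @Order.lt _ _ _ _) => apply: measurable_fun_ltr
  | |- measurable_fun _ (fun x => @Order.le _ _ _ _) => apply: measurable_fun_ler
  | |- measurable_fun _ (fun x => @GRing.natmul _ (GRing.one _) _) =>
       apply: measurable_fun_nat_of_bool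
  | |- measurable_fun ?D (@cos ?a) =>
       change (measurable_fun D (fun x => @cos a x))
  | |- measurable_fun ?D (@sin ?a) =>
       change (measurable_fun D (fun x => @sin a x))
  | |- measurable_fun ?D (@GRing.opp ?a) =>
       change (measurable_fun D (fun x => @GRing.opp a x))
  | |- measurable_fun ?D (@EFin ?a) =>
       change (measurable_fun D (fun x => @EFin a x))
  | |- measurable_fun ?D (@Num.norm ?a ?b) =>
       change (measurable_fun D (fun x => @Num.norm a b x))
  | |- measurable_fun ?D (@fine ?a) =>
       change (measurable_fun D (fun x => @fine a x))
  | |- measurable_fun ?D (@Order.lt ?a ?b ?c) =>
       change (measurable_fun D (fun x => @Order.lt a b c x))
  | |- measurable_fun ?D (@Order.le ?a ?b ?c) =>
       change (measurable_fun D (fun x => @Order.le a b c x))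
  | |- measurable_fun ?D (@GRing.add ?a ?c) =>
       change (measurable_fun D (fun x => @GRing.add a c x))
  | |- measurable_fun ?D (@GRing.mul ?a ?c) =>
       change (measurable_fun D (fun x => @GRing.mul a c x))
  | |- measurable_fun ?D (@pair ?a ?b ?c) =>
       change (measurable_fun D (fun x => @pair a b c x))
  | |- measurable_fun _ (fun x => @integral _ _ _ ?m _ _) =>
       lazymatch m with
       | context [mu2] => apply: measurable_fun_integral_mu2; cbv beta
       | _ => apply: measurable_fun_integral; cbv beta
       end
  | |- measurable_fun _ (fun x => Rintegral _ _ _) =>
       rewrite /Rintegral; apply: measurable_fun_fine
  | |- measurable_fun _ (fun x => @GRing.opp _ _) => apply: measurable_fun_opp
  | |- measurable_fun _ (fun x => @GRing.add _ _ _) =>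
       first [apply: measurable_funD | apply: emeasurable_funD]
  | |- measurable_fun _ (fun x => @GRing.mul _ _ _) =>
       apply: measurable_funM
  | |- measurable_fun _ (fun x => @mule _ _ _) =>
       apply: emeasurable_funM
  | |- measurable_fun _ (fun x => ?c) => apply: measurable_cst
  end.
Ltac meas := repeat meas_step.

(** * Integrals on the line and in the plane *)

Section Integral.
Local Open Scope ereal_scope.
Context {R : realType} {d} {T : measurableType d}.
Variable m : {measure set T -> \bar R}.

(** The integral of a nonnegative function is the supremum over the simple functions below it, and a
    simple function below [f] is also below [g]. *)
Lemma le_ge0_integral (f g : T -> \bar R) :
  (forall x, 0 <= f x) -> (forall x, f x <= g x) ->
  \int[m]_x f x <= \int[m]_x g x.
Proof.
move=> f0 fg; have g0 x : 0 <= g x by exact: le_trans (f0 x) (fg x).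
rewrite !ge0_integralTE//; apply: ereal_sup_le => _ [h hf <-].
by exists h => // x; exact: le_trans (hf x) (fg x).
Qed.

Lemma sqr_Lnorm2 (f : T -> R) :
  'N[m]_2%:E[EFin \o f] * 'N[m]_2%:E[EFin \o f] = \int[m]_x (f x ^+ 2)%:E.
Proof.
have sqE (x : \bar R) : 0 <= x -> x * x = x `^ 2.
  case: x => [r|_|//]; last by rewrite poweRyr // mulyy.
  by rewrite lee_fin => r0; rewrite poweR_EFin powR_mulrn// -EFinM expr2.
rewrite sqE ?Lnorm_ge0// poweR_Lnorm//; apply: eq_integral => x _ /=.
by rewrite powR_mulrn// real_normK// num_real.
Qed.

(** Hölder with exponents 2 and 2, squared: this form involves no root of an extended real and stays
    true for infinite norms. *)
Lemma cauchy_schwarz_integral (a b : T -> R) :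
  measurable_fun setT a -> measurable_fun setT b ->
  (\int[m]_x `|a x * b x|%:E) * (\int[m]_x `|a x * b x|%:E) <=
  (\int[m]_x (a x ^+ 2)%:E) * (\int[m]_x (b x ^+ 2)%:E).
Proof.
move=> ma mb; rewrite -!sqr_Lnorm2 muleACA.
have := @hoelder _ _ _ m a b 2 2 ma mb.
have -> : (2^-1 + 2^-1 = 1 :> R)%R by lra.
rewrite Lnorm1 => /(_ (ltr0Sn _ _) (ltr0Sn _ _) erefl) H.
by apply: lee_pmul => //; apply: integral_ge0 => x _; rewrite lee_fin.
Qed.

(** Cauchy-Schwarz for the factors [sqrt k] and [sqrt k * a]; the first one contributes the mass of
    [k], at most 1. *)
Lemma jensen_sqr_integral (k a : T -> R) :
  measurable_fun setT k -> measurable_fun setT a -> (forall x, 0 <= k x)%R ->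
  \int[m]_x (k x)%:E <= 1 ->
  (\int[m]_x (k x * `|a x|)%:E) * (\int[m]_x (k x * `|a x|)%:E) <=
  \int[m]_x (k x * a x ^+ 2)%:E.
Proof.
move=> mk ma k0 k1; have msk := measurable_fun_sqrt mk.
have := @cauchy_schwarz_integral (fun x => Num.sqrt (k x))
  (fun x => Num.sqrt (k x) * a x)%R msk (measurable_funM msk ma).
have -> : \int[m]_x `|Num.sqrt (k x) * (Num.sqrt (k x) * a x)|%:E
    = \int[m]_x (k x * `|a x|)%:E.
  apply: eq_integral => x _; congr (_%:E).
  by rewrite mulrA -expr2 sqr_sqrtr// normrM ger0_norm.
have -> : \int[m]_x (Num.sqrt (k x) ^+ 2)%:E = \int[m]_x (k x)%:E.
  by apply: eq_integral => x _; rewrite sqr_sqrtr.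
have -> : \int[m]_x ((Num.sqrt (k x) * a x) ^+ 2)%:E
    = \int[m]_x (k x * a x ^+ 2)%:E.
  by apply: eq_integral => x _; rewrite exprMn sqr_sqrtr.
move=> /le_trans; apply; rewrite -[leRHS]mul1e lee_wpmul2r//.
by apply: integral_ge0 => x _; rewrite lee_fin mulr_ge0// sqr_ge0.
Qed.

End Integral.

Section Lebesgue.
Local Open Scope ereal_scope.
Context {R : realType}.
Local Notation mu := (@lebesgue_measure R).

Lemma lebesgue_measureD (a : R) (A : set (measurableTypeR R)) : measurable A ->
  mu ((fun x => x + a)%R @^-1` A) = mu A.
Proof.
have mD : measurable_fun setT ((fun x => x + a)%R : measurableTypeR R -> measurableTypeR R).
  exact: measurable_funD.
move=> mA; apply/esym.
pose p := pushforward mu ((fun x => x + a)%R : measurableTypeR R -> measurableTypeR R).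
apply: (lebesgue_measure_unique (mu := p)) => // _ [[b c]] _ <-.
rewrite /p /pushforward.
transitivity (mu `](b - a)%R, (c - a)%R]%classic); last first.
  congr (mu _); apply/seteqP; split => x /=; rewrite !in_itv/= ltrBlDr lerBrDr//.
rewrite !lebesgue_measure_itv/= !lte_fin ltrD2r; case: ifP => // _.
by rewrite -!EFinB; congr (_%:E); ring.
Qed.

Lemma ge0_integral_translation (f : R -> \bar R) (a : R) :
  measurable_fun setT f -> (forall x, 0 <= f x) ->
  \int[mu]_x f (x + a)%R = \int[mu]_x f x.
Proof.
move=> mf f0.
have mD : measurable_fun setT ((fun x => x + a)%R : measurableTypeR R -> measurableTypeR R).
  exact: measurable_funD.
have := ge0_integral_pushforward mD mu measurableT mf.
rewrite preimage_setT => <- //.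
by apply: eq_measure_integral => A mA _; exact: lebesgue_measureD.
Qed.

Lemma ge0_integral_opp (f : R -> \bar R) :
  measurable_fun setT f -> (forall x, 0 <= f x) ->
  \int[mu]_x f (- x)%R = \int[mu]_x f x.
Proof.
move=> mf f0.
have mN : measurable_fun setT (-%R : measurableTypeR R -> measurableTypeR R) by [].
have := ge0_integral_pushforward mN mu measurableT mf.
rewrite preimage_setT => <- //.
by apply: eq_measure_integral => A mA _; exact: lebesgue_measureN.
Qed.

Lemma tonelli_mu2 (f : R * R -> \bar R) :
  measurable_fun setT f -> (forall x, 0 <= f x) ->
  \int[mu2]_z f z = \int[mu]_x \int[mu]_y f (x, y).
Proof. by move=> mf f0; rewrite fubini_tonelli1. Qed.

Lemma tonelli_mu2_swap (f : R * R -> \bar R) :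
  measurable_fun setT f -> (forall x, 0 <= f x) ->
  \int[mu2]_z f z = \int[mu]_y \int[mu]_x f (x, y).
Proof. by move=> mf f0; rewrite fubini_tonelli2. Qed.

Lemma tonelli_swap (f : R -> R -> \bar R) :
  measurable_fun setT (fun z : R * R => f z.1 z.2) -> (forall x y, 0 <= f x y) ->
  \int[mu]_x \int[mu]_y f x y = \int[mu]_y \int[mu]_x f x y.
Proof.
by move=> mf f0; exact: (@fubini_tonelli _ _ (measurableTypeR R) (measurableTypeR R) R mu mu (fun z => f z.1 z.2)).
Qed.

Lemma tonelli_swap_mu2 (f : R * R -> R -> \bar R) :
  measurable_fun setT (fun z : R * R * R => f z.1 z.2) ->
  (forall x y, 0 <= f x y) ->
  \int[mu2]_x \int[mu]_y f x y = \int[mu]_y \int[mu2]_x f x y.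
Proof.
move=> mf f0.
exact: (@fubini_tonelli _ _ _ (measurableTypeR R) R mu2_sf mu (fun z => f z.1 z.2)).
Qed.

Lemma ge0_integral_shear1 (f : R * R -> \bar R) (a : R) :
  measurable_fun setT f -> (forall x, 0 <= f x) ->
  \int[mu2]_z f (z.1 + a * z.2, z.2)%R = \int[mu2]_z f z.
Proof.
move=> mf f0; rewrite !tonelli_mu2_swap; [|first [by meas|by move=> ?; exact: f0]..].
apply: eq_integral => y _ /=.
apply: (ge0_integral_translation (f := fun x => f (x, y))) => //.
by meas.
Qed.

Lemma ge0_integral_shear2 (f : R * R -> \bar R) (a : R) :
  measurable_fun setT f -> (forall x, 0 <= f x) ->
  \int[mu2]_z f (z.1, z.2 + a * z.1)%R = \int[mu2]_z f z.
Proof.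
move=> mf f0; rewrite !tonelli_mu2; [|first [by meas|by move=> ?; exact: f0]..].
apply: eq_integral => y _ /=.
apply: (ge0_integral_translation (f := fun x => f (y, x))) => //.
by meas.
Qed.

(* A rotation other than the half turn is a product of three shears. *)
Lemma ge0_integral_rotation (f : R * R -> \bar R) (c s : R) :
  (c ^+ 2 + s ^+ 2 = 1)%R ->
  measurable_fun setT f -> (forall x, 0 <= f x) ->
  \int[mu2]_z f (z.1 * c - z.2 * s, z.1 * s + z.2 * c)%R = \int[mu2]_z f z.
Proof.
wlog cN1 : f c s / (c != -1)%R.
  move=> H cs mf f0.
  have [cE|?] := eqVneq c (-1)%R; last exact: H.
  have s0 : s = 0%R.
    by apply/eqP; rewrite -sqrf_eq0; apply/eqP; move: cs; rewrite cE; lra.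
  have N0 : (0 != -1 :> R)%R by rewrite eq_sym oppr_eq0 oner_eq0.
  have cs' : (0 ^+ 2 + 1 ^+ 2 = 1 :> R)%R by ring.
  (* The half turn, excluded by the denominator [1 + c] below, is the square of the quarter turn. *)
  rewrite -(H f 0 1)%R//.
  rewrite -(H (fun z => f (z.1 * 0 - z.2 * 1, z.1 * 1 + z.2 * 0)%R) 0 1)%R//; last by meas.
  apply: eq_integral => z _ /=; congr f.
  by rewrite cE s0; congr (_, _); ring.
move=> cs mf f0.
have c1 : (1 + c != 0)%R by rewrite addrC -[1%R]opprK subr_eq0.
(* For the rotation by an angle t this is minus the tangent of t / 2. *)
pose a := (- s / (1 + c))%R.
have ab : (1 + a * s = c)%R.
  rewrite /a; have -> : (- s / (1 + c) * s = - (s ^+ 2) / (1 + c))%R by field.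
  have -> : (s ^+ 2 = 1 - c ^+ 2)%R by rewrite -cs; ring.
  by field.
have a1c : (a * (1 + c) = - s)%R by rewrite /a; field.
rewrite -[RHS](ge0_integral_shear1 a mf)//.
rewrite -[RHS](ge0_integral_shear2 s)//; last by meas.
rewrite -[RHS](ge0_integral_shear1 a)//; last by meas.
apply: eq_integral => z _ /=; congr f; congr (_, _).
  transitivity (z.1 * (1 + a * s) + z.2 * (a + a * (1 + a * s)))%R; last by ring.
  by rewrite ab; have -> : (a + a * c = - s)%R by [rewrite -a1c mulrDr mulr1]; rewrite mulrN.
transitivity (z.1 * s + z.2 * (1 + a * s))%R; last by ring.
by rewrite ab.
Qed.

End Lebesgue.

(** * Contractions of the line *)

Section Contraction.
Local Open Scope ereal_scope.
Context {R : realType}.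
Local Notation mu := (@lebesgue_measure R).
Variable tau : R -> R.
Hypothesis tau_contraction :
  (forall x y, x <= y -> 0 <= tau y - tau x <= y - x)%R.
Hypothesis tau_surj : forall y, exists x, tau x = y.

Lemma measurable_contraction : measurable_fun setT tau.
Proof.
apply: nondecreasing_measurable => // x y xy.
by have := tau_contraction xy; rewrite subr_ge0 => /andP[].
Qed.

(** Take any cover of the preimage by half-open intervals. A nondecreasing contraction sends each
    into a closed interval that is no longer, and by surjectivity these closed intervals cover
    [S]. *)
Lemma lebesgue_measure_contraction (S : set (measurableTypeR R)) :
  measurable S -> mu S <= mu (tau @^-1` S).
Proof.
move=> mS; apply/ereal_infP => _ [M' [covM tauSM] <-].
pose N n : set (measurableTypeR R) := 
  `[tau (inf (M' n)), tau (sup (M' n))]%classic.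
have SN : S `<=` \bigcup_n N n.
  move=> y Sy; have [x xy] := tau_surj y.
  have [n _ M'x] : (\bigcup_n M' n) x by apply: tauSM; rewrite /preimage/= xy.
  exists n => //; rewrite /N.
  have /ocitvP[M0|[[a b] /= ab Mab]] := covM n; first by rewrite M0 in M'x.
  move: M'x; rewrite Mab /= inf_itv// sup_itv// !in_itv/= => /andP[/ltW ax xb].
  have /andP[+ _] := tau_contraction ax; have /andP[+ _] := tau_contraction xb.
  by rewrite !subr_ge0 xy => -> ->.
have mN n : measurable (N n) by exact: measurable_itv.
apply: (le_trans (@measure_sigma_subadditive _ _ _ mu S N mN mS SN)).
apply: lee_nneseries => // n _.
rewrite [leLHS](_ : _ = if (tau (inf (M' n)) < tau (sup (M' n)))%R
    then (tau (sup (M' n)) - tau (inf (M' n)))%:E else 0); last first.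
  by rewrite /N [LHS]lebesgue_measure_itv/= lte_fin -EFinB.
have /ocitvP[->|[[a b] /= ab ->]] := covM n.
  by rewrite inf0 sup0 ltxx; apply: wlength_ge0.
rewrite inf_itv// sup_itv// wlength_itv/= lte_fin ab.
have /andP[t0 t1] := tau_contraction (ltW ab).
by case: ifP => _; rewrite -?EFinB lee_fin// subr_ge0 ltW.
Qed.

Lemma ge0_integral_contraction (f : R -> \bar R) :
  measurable_fun setT f -> (forall x, 0 <= f x) ->
  \int[mu]_x f x <= \int[mu]_x f (tau x).
Proof.
move=> mf f0.
have mt : measurable_fun setT (tau : measurableTypeR R -> measurableTypeR R).
  exact: measurable_contraction.
have := ge0_integral_pushforward mt mu measurableT mf.
rewrite preimage_setT => <- //.
by apply: ge0_le_measure_integral => // S mS; exact: lebesgue_measure_contraction.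
Qed.

End Contraction.

Section Hyperbola.
Context {R : realType}.
Local Notation mu := (@lebesgue_measure R).

(* The contraction r |-> sqrt (r^2 + c^2) of the half-line r > 0 onto x > c
   extends to the line by the translation r |-> r + c. *)
Lemma ge0_integral_hypot (f : R -> \bar R) (c : R) : 0 <= c ->
  measurable_fun setT f -> (forall x, (0 <= f x)%E) ->
  (\int[mu]_x ((c < x)%R%:R%:E * f x) <=
  \int[mu]_r ((0 < r)%R%:R%:E * f (Num.sqrt (r ^+ 2 + c ^+ 2))%R))%E.
Proof.
move=> c0 mf f0.
pose tau (r : R) := (if 0 < r then Num.sqrt (r ^+ 2 + c ^+ 2) else r + c)%R.
have sqrtc (r : R) : (0 <= r -> Num.max c r <= Num.sqrt (r ^+ 2 + c ^+ 2))%R.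
  move=> r0; rewrite ge_max; apply/andP; split.
    by rewrite -[leLHS]ger0_norm// -sqrtr_sqr ler_wsqrtr// lerDr sqr_ge0.
  by rewrite -[leLHS]ger0_norm// -sqrtr_sqr ler_wsqrtr// lerDl sqr_ge0.
have sqrtL (x y : R) : (0 <= x -> x <= y ->
    0 <= Num.sqrt (y ^+ 2 + c ^+ 2) - Num.sqrt (x ^+ 2 + c ^+ 2) <= y - x)%R.
  move=> x0 xy; apply/andP; split.
    by rewrite subr_ge0 ler_wsqrtr// lerD2r lerXn2r// nnegrE// (le_trans x0).
  rewrite lerBlDr -[leRHS]ger0_norm; last first.
    by rewrite addr_ge0 ?sqrtr_ge0// subr_ge0.
  rewrite -sqrtr_sqr ler_wsqrtr// sqrrD sqr_sqrtr ?addr_ge0 ?sqr_ge0//.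
  have : (x <= Num.sqrt (x ^+ 2 + c ^+ 2))%R.
    by apply: le_trans (sqrtc _ x0); rewrite le_max lexx orbT.
  move: (Num.sqrt _) => q xq; rewrite -mulr_natr.
  (* The difference of the two squares to be compared is twice this product. *)
  have : (0 <= (y - x) * (q - x))%R by rewrite mulr_ge0 ?subr_ge0.
  nra.
have s0 : Num.sqrt (0 ^+ 2 + c ^+ 2) = c.
  by rewrite expr0n add0r sqrtr_sqr ger0_norm.
have tauL (x y : R) : (x <= y -> 0 <= tau y - tau x <= y - x)%R.
  move=> xy; rewrite /tau; case: (ltP 0 x) => x0; case: (ltP 0 y) => y0.
  - exact: sqrtL (ltW x0) xy.
  - by have := lt_le_trans x0 (le_trans xy y0); rewrite ltxx.
  - have := sqrtL 0%R y (lexx _) (ltW y0); rewrite s0 subr0.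
    by move: (Num.sqrt _) => q; lra.
  - by apply/andP; split; lra.
have taus y : exists x, tau x = y.
  have [cy|yc] := ltP c y; last first.
    exists (y - c)%R; rewrite /tau ltNge subr_le0 yc/=; ring.
  have yc0 : (0 < y ^+ 2 - c ^+ 2)%R.
    by rewrite subr_gt0 ltrXn2r// nnegrE// (le_trans c0)// ltW.
  exists (Num.sqrt (y ^+ 2 - c ^+ 2)); rewrite /tau sqrtr_gt0 yc0.
  rewrite sqr_sqrtr ?ltW// subrK sqrtr_sqr ger0_norm//.
  by rewrite (le_trans c0)// ltW.
have mcf : measurable_fun setT (fun x : R => (c < x)%R%:R%:E * f x)%E by meas.
have cf0 (x : R) : (0 <= (c < x)%R%:R%:E * f x)%E.
  by rewrite mule_ge0// lee_fin ler0n.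
apply: le_trans (ge0_integral_contraction tauL taus mcf cf0) _.
apply: le_ge0_integral => [r|r]; first exact: cf0.
rewrite /tau; case: (ltP 0%R r) => r0.
  by rewrite mul1e -[leRHS]mul1e lee_wpmul2r// lee_fin lern1 leq_b1.
(* On the translated branch [r <= 0] the value [r + c] is at most [c], where the indicator
   vanishes. *)
by rewrite mul0e ltNge gerDr r0/= mul0e.
Qed.

End Hyperbola.

(** * Integrals over a period and polar angles *)

Section Circle.
Context {R : realType}.
Local Notation mu := (@lebesgue_measure R).

(** The part of the shifted interval beyond [pi] is, one period later, the initial part that the
    shift has removed. *)
Lemma ge0_integral_periodic (G : R -> \bar R) (a : R) :
  measurable_fun setT G -> (forall x, (0 <= G x)%E) ->
  (forall x, G (x + 2 * pi) = G x) -> 0 <= a <= 2 * pi ->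
  (\int[mu]_x ((- pi <= x < pi)%R%:R%:E * G (x + a)%R) =
   \int[mu]_x ((- pi <= x < pi)%R%:R%:E * G x))%E.
Proof.
move=> mG G0 Gper /andP[a0 a2].
pose I1 (x : R) := ((- pi + a <= x < pi)%R%:R%:E * G x)%E.
pose I2 (x : R) := ((pi <= x < pi + a)%R%:R%:E * G x)%E.
pose I3 (x : R) := ((- pi <= x < - pi + a)%R%:R%:E * G x)%E.
have ind0 (b : bool) (x : \bar R) : (0 <= x -> 0 <= b%:R%:E * x)%E.
  by move=> x0; apply: mule_ge0 => //; rewrite lee_fin ler0n.
have mI1 : measurable_fun setT I1 by rewrite /I1; meas.
have mI2 : measurable_fun setT I2 by rewrite /I2; meas.
have mI3 : measurable_fun setT I3 by rewrite /I3; meas.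
have -> : (\int[mu]_x ((- pi <= x < pi)%R%:R%:E * G (x + a)%R) =
   \int[mu]_x (I1 x + I2 x))%E.
  rewrite -(@ge0_integral_translation _ (fun x => I1 x + I2 x)%E a); last 2 first.
  - by meas.
  - by move=> x; rewrite adde_ge0// ind0.
  apply: eq_integral => x _; rewrite /I1 /I2.
  rewrite -ge0_muleDl ?lee_fin ?ler0n// -EFinD -natrD.
  congr ((_%:R)%:E * _)%E.
  by case: (lerP (- pi) x); case: (ltrP x pi); case: (lerP (- pi + a) (x + a)); case: (ltrP (x + a) pi); case: (lerP pi (x + a)); case: (ltrP (x + a) (pi + a)) => //= *; exfalso; lra.
have -> : (\int[mu]_x ((- pi <= x < pi)%R%:R%:E * G x) =
   \int[mu]_x (I1 x + I3 x))%E.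
  apply: eq_integral => x _; rewrite /I1 /I3.
  rewrite -ge0_muleDl ?lee_fin ?ler0n// -EFinD -natrD.
  congr ((_%:R)%:E * _)%E.
  by case: (lerP (- pi) x); case: (ltrP x pi); case: (lerP (- pi + a) x); case: (ltrP x (- pi + a)) => //= *; exfalso; lra.
rewrite !ge0_integralD//; try by move=> x _; exact: ind0.
congr (_ + _)%E.
rewrite -(@ge0_integral_translation _ I2 (2 * pi))//; last first.
  by move=> x; exact: ind0.
apply: eq_integral => x _; rewrite /I2 /I3 Gper.
congr ((nat_of_bool (_ && _))%:R%:E * _)%E; lra.
Qed.

(** The angle is taken in [[0, 2 * pi]], the range of shifts allowed in [ge0_integral_periodic]: the
    arccosine for [r >= 0], its complement to [2 * pi] otherwise. *)
Lemma polar_angle (h r : R) : exists2 a : R, 0 <= a <= 2 * pi &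
  h = Num.sqrt (r ^+ 2 + h ^+ 2) * cos a /\
  r = Num.sqrt (r ^+ 2 + h ^+ 2) * sin a.
Proof.
set p := Num.sqrt _.
have pi0 : 0 <= pi :> R by exact: pi_ge0.
have p2 : p ^+ 2 = r ^+ 2 + h ^+ 2 by rewrite sqr_sqrtr// addr_ge0 ?sqr_ge0.
have p0 : 0 <= p by exact: sqrtr_ge0.
have [pE|pN] := eqVneq p 0.
  exists 0; first by rewrite lexx/=; lra.
  by rewrite pE; split; rewrite mul0r; nra.
have pp : 0 < p by rewrite lt_neqAle eq_sym pN.
have hp : -1 <= h / p <= 1 by rewrite ler_pdivlMr// ler_pdivrMr//; apply/andP; split; nra.
have sp : Num.sqrt (1 - (h / p) ^+ 2) = `|r| / p.
  rewrite -[RHS]ger0_norm ?divr_ge0// -sqrtr_sqr; congr Num.sqrt.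
  rewrite !exprMn exprVn real_normK ?num_real// p2.
  by field; rewrite -p2 expf_neq0.
have [r0|r0] := lerP 0 r.
  exists (acos (h / p)).
    by rewrite acos_ge0//=; apply: (le_trans (acos_lepi hp)); lra.
  rewrite acosK ?in_itv//= sin_acos// sp ger0_norm//.
  by split; field.
exists (2 * pi - acos (h / p)).
  have := acos_ge0 hp; have := acos_lepi hp; lra.
have -> : 2 * pi - acos (h / p) = - acos (h / p) + pi *+ 2 by ring.
rewrite cosD2pi sinD2pi cosN sinN acosK ?in_itv//= sin_acos// sp ltr0_norm//.
by split; field.
Qed.

End Circle.

Local Notation line_point s phi t :=
  (s * cos phi - t * sin phi, s * sin phi + t * cos phi).

(** * Circular autocorrelation *)

Section Correlation.
Context {R : realType}.
Local Notation mu := (@lebesgue_measure R).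
Implicit Types f : R * R -> R.

(** A weight rather than a domain of integration: all integrals then run over the whole line and can
    be exchanged directly. *)
Definition circle (phi : R) : \bar R := (- pi <= phi < pi)%R%:R%:E.

Lemma circle_ge0 phi : (0 <= circle phi)%E.
Proof. by rewrite lee_fin ler0n. Qed.

Lemma measurable_circle : measurable_fun setT circle.
Proof. by rewrite /circle; meas. Qed.

Lemma integral_circle : (\int[mu]_phi circle phi = (2 * pi)%:E)%E.
Proof.
transitivity (\int[mu]_phi (\1_(`[- pi, pi[ : set R) phi)%:E)%E.
  by apply: eq_integral => phi _; rewrite indicE mem_setE in_itv.
rewrite integral_indic//= setIT lebesgue_measure_itv/= lte_fin.
have -> : (- pi < pi :> R) by rewrite gtrN// pi_gt0.
by rewrite -EFinB; congr (_%:E); ring.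
Qed.

Definition line_integral f (s phi : R) : \bar R :=
  (\int[mu]_t (f (line_point s phi t))%:E)%E.

Definition circular_corr f (rho : R) : \bar R :=
  (\int[mu2]_x ((f x)%:E * \int[mu]_phi (circle phi *
     (f (x.1 + rho * cos phi, x.2 + rho * sin phi)%R)%:E)))%E.

Definition norm_sq f : \bar R := (\int[mu2]_x (f x ^+ 2)%:E)%E.

Lemma norm_sq_ge0 f : (0 <= norm_sq f)%E.
Proof. by apply: integral_ge0 => x _; rewrite lee_fin sqr_ge0. Qed.

Lemma ge0_integral_translation2 (f : R * R -> \bar R) (v : R * R) :
  measurable_fun setT f -> (forall x, (0 <= f x)%E) ->
  (\int[mu2]_x f (x.1 + v.1, x.2 + v.2)%R = \int[mu2]_x f x)%E.
Proof.
move=> mf f0; rewrite !tonelli_mu2; [|first [by meas|by move=> ?; exact: f0]..].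
rewrite -[RHS](ge0_integral_translation v.1); last 2 first.
- by meas.
- by move=> x; apply: integral_ge0.
apply: eq_integral => x _ /=.
by rewrite (ge0_integral_translation (f := fun y => f (x + v.1, y))%R v.2)//; meas.
Qed.

Section Nonneg.
Variable f : R * R -> R.
Hypothesis mf : measurable_fun setT f.
Hypothesis f0 : forall x, 0 <= f x.

Let fE0 x : (0 <= (f x)%:E)%E. Proof. by rewrite lee_fin. Qed.

Lemma line_integral_ge0 s phi : (0 <= line_integral f s phi)%E.
Proof. by apply: integral_ge0 => t _; rewrite lee_fin. Qed.

(** A pair of points on two parallel lines at distance [h] is given by the first point and by the
    displacement [r] along the direction of the lines. As [s] varies, the first point runs through
    the plane. *)
Lemma corr_fixed_angle (h phi : R) :
  (\int[mu]_s (line_integral f s phi * line_integral f (s + h)%R phi) =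
   \int[mu2]_x ((f x)%:E * \int[mu]_r
     (f (x.1 + (h * cos phi - r * sin phi),
         x.2 + (h * sin phi + r * cos phi))%R)%:E))%E.
Proof.
rewrite -[RHS](ge0_integral_rotation (cos2Dsin2 phi)); last 2 first.
- by meas.
- by move=> x; rewrite mule_ge0// integral_ge0.
rewrite [RHS]tonelli_mu2; last 2 first.
- by meas.
- by move=> x; rewrite mule_ge0// integral_ge0.
apply: eq_integral => s _.
rewrite /line_integral -ge0_integralZr; last 4 first.
- exact: measurableT.
- by meas.
- by move=> t _; rewrite lee_fin.
- by apply: integral_ge0.
apply: eq_integral => t _; congr (_ * _)%E => /=.
rewrite -[LHS](ge0_integral_translation t)//; last by meas.
by apply: eq_integral => r _; congr ((f _)%:E); congr (_, _); ring.
Qed.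

(* The vector of coordinates (h, r) in the frame rotated by [phi] is the point of
   angle [phi + a] on the circle of radius [sqrt (r^2 + h^2)], [a] as in
   [polar_angle]. *)
Lemma corr_radial (h : R) :
  (\int[mu]_phi (circle phi *
     \int[mu]_s (line_integral f s phi * line_integral f (s + h)%R phi)) =
   \int[mu]_r circular_corr f (Num.sqrt (r ^+ 2 + h ^+ 2))%R)%E.
Proof.
have mc := measurable_circle.
pose K (x : R * R) (phi r : R) := (circle phi * ((f x)%:E *
  (f (x.1 + (h * cos phi - r * sin phi),
         x.2 + (h * sin phi + r * cos phi))%R)%:E))%E.
have K0 x phi r : (0 <= K x phi r)%E by rewrite !mule_ge0// circle_ge0.
transitivity (\int[mu]_phi \int[mu2]_x \int[mu]_r K x phi r)%E.
  apply: eq_integral => phi _; rewrite corr_fixed_angle.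
  rewrite -ge0_integralZl//; last 3 first.
  - by meas.
  - by move=> x _; rewrite mule_ge0// integral_ge0.
  - exact: circle_ge0.
  apply: eq_integral => x _.
  rewrite -ge0_integralZl//; last by meas.
  rewrite -ge0_integralZl//; last 3 first.
  - by meas.
  - by move=> r _; rewrite mule_ge0.
  - exact: circle_ge0.
rewrite -tonelli_swap_mu2; last 2 first.
- by rewrite /K; meas.
- by move=> x phi; apply: integral_ge0.
transitivity (\int[mu2]_x \int[mu]_r \int[mu]_phi K x phi r)%E.
  by apply: eq_integral => x _; rewrite tonelli_swap//; rewrite /K; meas.
rewrite tonelli_swap_mu2; last 2 first.
- by rewrite /K; meas.
- by move=> x r; apply: integral_ge0.
apply: eq_integral => r _; apply: eq_integral => x _.
pose q := Num.sqrt (r ^+ 2 + h ^+ 2).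
pose G (phi : R) := (f (x.1 + q * cos phi, x.2 + q * sin phi))%:E.
have mG : measurable_fun setT G by rewrite /G; meas.
have Gper phi : G (phi + 2 * pi) = G phi.
  by rewrite /G mulr_natl cosD2pi sinD2pi.
have G0 phi : (0 <= G phi)%E by rewrite /G lee_fin.
have [a a2pi [hE rE]] := polar_angle h r.
rewrite -[X in (_ * X)%E](ge0_integral_periodic mG G0 Gper a2pi)//.
rewrite -ge0_integralZl//; last 2 first.
- by meas.
- by move=> phi _; rewrite mule_ge0 ?circle_ge0 // /G.
apply: eq_integral => phi _; rewrite /K muleCA /G cosD sinD -/q.
by congr (_ * (_ * (f _)%:E))%E; congr (_ + _, _ + _);
  rewrite {1}rE {1}hE -/q; ring.
Qed.

(** From [a * b <= a ^ 2 + b ^ 2] and translation invariance: each of the two squares is integrated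
    over a circle of angles of length [2 * pi]. *)
Lemma circular_corr_le (rho : R) :
  (circular_corr f rho <= (4 * pi)%:E * norm_sq f)%E.
Proof.
have mc := measurable_circle.
pose F (phi : R) (x : R * R) := (circle phi * ((f x ^+ 2)%:E +
   (f (x.1 + rho * cos phi, x.2 + rho * sin phi) ^+ 2)%:E))%E.
have F0 phi x : (0 <= F phi x)%E.
  by rewrite mule_ge0 ?circle_ge0// adde_ge0// lee_fin sqr_ge0.
apply: (@le_trans _ _ (\int[mu2]_x \int[mu]_phi F phi x)%E).
  apply: le_ge0_integral => [x|x].
    by rewrite mule_ge0// integral_ge0// => phi _; rewrite mule_ge0// circle_ge0.
  rewrite -ge0_integralZl//; last 2 first.
  - by meas.
  - by move=> phi _; rewrite mule_ge0// circle_ge0.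
  apply: le_ge0_integral => phi.
    by rewrite !mule_ge0// circle_ge0.
  rewrite /F muleCA lee_wpmul2l// ?circle_ge0// -EFinM -EFinD lee_fin.
  set y := f (_, _); have := sqr_ge0 (f x - y); have := sqr_ge0 (f x + y); lra.
rewrite tonelli_swap_mu2//; last by rewrite /F; meas.
have -> : (\int[mu]_phi \int[mu2]_x F phi x
    = \int[mu]_phi (circle phi * (2%:E * norm_sq f)))%E.
  apply: eq_integral => phi _; rewrite /F ge0_integralZl//; last 3 first.
  - by meas.
  - by move=> x _; rewrite adde_ge0// lee_fin sqr_ge0.
  - exact: circle_ge0.
  congr (_ * _)%E; rewrite ge0_integralD//; last 4 first.
  - by move=> x _; rewrite lee_fin sqr_ge0.
  - by meas.
  - by move=> x _; rewrite lee_fin sqr_ge0.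
  - by meas.
  rewrite (ge0_integral_translation2 (f := fun x => (f x ^+ 2)%:E)
    (rho * cos phi, rho * sin phi))//; last 2 first.
  - by meas.
  - by move=> x; rewrite lee_fin sqr_ge0.
  by rewrite mule_natl mule2n.
rewrite ge0_integralZr//; last 2 first.
- by move=> phi _; exact: circle_ge0.
- by rewrite mule_ge0// norm_sq_ge0.
rewrite integral_circle muleA -EFinM.
by have -> : 2 * pi * 2 = 4 * pi :> R by ring.
Qed.

End Nonneg.

(** Each half-line loses at most the mass [M * c] of the segment [[0, c]], which the map to the
    hypotenuse does not reach. Both integrals may be infinite, hence a sum on the right instead of a
    difference. *)
Lemma even_integral_hypot_le (g : R -> \bar R) (M c : R) :
  0 <= c -> measurable_fun setT g -> (forall x, (0 <= g x)%E) ->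
  (forall x, (g x <= M%:E)%E) ->
  (\int[mu]_r g `|r|%R <=
   \int[mu]_r g (Num.sqrt (r ^+ 2 + c ^+ 2))%R + (2 * M * c)%:E)%E.
Proof.
move=> c0 mg g0 gM.
have M0 : 0 <= M by rewrite -lee_fin (le_trans (g0 0)).
have ind0 (b : bool) (x : \bar R) : (0 <= x -> 0 <= b%:R%:E * x)%E.
  by move=> x0; apply: mule_ge0 => //; rewrite lee_fin ler0n.
have split (k : R -> \bar R) : measurable_fun setT k ->
    (forall x, (0 <= k x)%E) ->
    (\int[mu]_r k r = \int[mu]_r ((0 < r)%R%:R%:E * k r) +
                      \int[mu]_r ((0 <= r)%R%:R%:E * k (- r)%R))%E.
  move=> mk k0.
  rewrite -[X in (_ + X)%E](ge0_integral_opp (f := fun r =>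
    (0 <= r)%R%:R%:E * k (- r)%R)%E)//; last 2 first.
  - by meas.
  - by move=> x; exact: ind0.
  rewrite -ge0_integralD//; last 4 first.
  - by move=> x _; exact: ind0.
  - by meas.
  - by move=> x _; exact: ind0.
  - by meas.
  apply: eq_integral => r _; rewrite opprK oppr_ge0.
  by case: ltP => _; rewrite ?mul0e ?mul1e ?adde0 ?add0e.
(* The closed half-line serves an upper bound and the open one, in [J], a lower bound, so the origin
   needs no separate treatment. *)
pose I := (\int[mu]_r ((0 <= r)%R%:R%:E * g `|r|%R))%E.
pose J := (\int[mu]_r ((0 < r)%R%:R%:E * g (Num.sqrt (r ^+ 2 + c ^+ 2))%R))%E.
have H1 : (\int[mu]_r g `|r|%R <= I + I)%E.
  rewrite split//; last by meas.
  apply: leeD.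
    apply: le_ge0_integral => r; first exact: ind0.
    by rewrite lee_wpmul2r// lee_fin ler_nat; case: ltP => // /ltW ->.
  apply: le_ge0_integral => r; first exact: ind0.
  by rewrite normrN.
have H2 : (J + J <= \int[mu]_r g (Num.sqrt (r ^+ 2 + c ^+ 2))%R)%E.
  rewrite [leRHS]split//; last by meas.
  apply: leeD => //.
  apply: le_ge0_integral => r; first exact: ind0.
  by rewrite sqrrN lee_wpmul2r// lee_fin ler_nat; case: ltP => // /ltW ->.
have H3 : (I <= J + (M * c)%:E)%E.
  apply: (@le_trans _ _ (\int[mu]_r ((c < r)%R%:R%:E * g r) +
      \int[mu]_r (M%:E * (0 <= r <= c)%R%:R%:E))%E).
    rewrite -ge0_integralD//; last 4 first.
    - by move=> x _; exact: ind0.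
    - by meas.
    - by move=> x _; rewrite muleC ind0// lee_fin.
    - by meas.
    apply: le_ge0_integral => r; first exact: ind0.
    have [r0|r0] := leP 0 r; last first.
      by rewrite mul0e adde_ge0 ?ind0//= mule0.
    rewrite mul1e ger0_norm//; have [cr|rc] /= := ltP c r.
      by rewrite mul1e mule0 adde0.
    by rewrite mul0e add0e mule1.
  apply: leeD; first exact: ge0_integral_hypot.
  rewrite ge0_integralZl//; last by meas.
  have -> : (\int[mu]_x (0 <= x <= c)%R%:R%:E =
      \int[mu]_x (\1_(`[0, c] : set R) x)%:E)%E.
    by apply: eq_integral => x _; rewrite indicE mem_setE in_itv.
  rewrite integral_indic//= setIT lebesgue_measure_itv/= lte_fin.
  case: ltP => [_|c0']; first by rewrite -EFinB subr0 -EFinM.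
  by rewrite mule0 lee_fin mulr_ge0.
apply: (le_trans H1); apply: (le_trans (leeD H3 H3)).
rewrite addeACA -EFinD; apply: leeD => //.
by rewrite lee_fin; lra.
Qed.

End Correlation.

Local Opaque integral.

(** * Line integrals and their offset modulus *)

Section Modulus.
Context {R : realType}.
Local Notation mu := (@lebesgue_measure R).
Implicit Types f : R * R -> R.

Lemma Omega_line_point (s phi t : R) :
  Omega (line_point s phi t) <-> s ^+ 2 + t ^+ 2 < 1.
Proof.
rewrite /Omega/=.
have -> : (s * cos phi - t * sin phi) ^+ 2 + (s * sin phi + t * cos phi) ^+ 2
    = (s ^+ 2 + t ^+ 2) * (cos phi ^+ 2 + sin phi ^+ 2) by ring.
by rewrite cos2Dsin2 mulr1.
Qed.

Lemma integral_itv_ind (a b : R) : a <= b ->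
  (\int[mu]_t (a <= t <= b)%R%:R%:E = (b - a)%:E)%E.
Proof.
move=> ab; transitivity (\int[mu]_t (\1_(`[a, b] : set R) t)%:E)%E.
  by apply: eq_integral => t _; rewrite indicE mem_setE in_itv.
rewrite integral_indic//= setIT lebesgue_measure_itv/= lte_fin.
by case: ltP => ab'; rewrite -?EFinB//; congr EFin; lra.
Qed.

Section Support.
Variable f : R * R -> R.
Hypothesis mf : measurable_fun setT f.
Hypothesis fO : forall x, ~ Omega x -> f x = 0.

Lemma line_point_eq0 (s phi t : R) : 1 <= s ^+ 2 + t ^+ 2 ->
  f (line_point s phi t) = 0.
Proof. by move=> st; rewrite fO// Omega_line_point ltNge st. Qed.

Definition abs_line_integral (s phi : R) : \bar R :=
  (\int[mu]_t `|f (line_point s phi t)|%:E)%E.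

Lemma abs_line_integral_ge0 s phi : (0 <= abs_line_integral s phi)%E.
Proof. by apply: integral_ge0 => t _; rewrite lee_fin. Qed.

(** Cauchy-Schwarz on the chord cut out by the disc, whose parameters lie in [[-1, 1]], of length
    2. *)
Lemma abs_line_integral_sqr (s phi : R) :
  (abs_line_integral s phi * abs_line_integral s phi <=
   2%:E * \int[mu]_t (f (line_point s phi t) ^+ 2)%:E)%E.
Proof.
pose a (t : R) : R := (-1 <= t <= 1)%R%:R.
pose b (t : R) := f (line_point s phi t).
have ma : measurable_fun setT a by rewrite /a; meas.
have mb : measurable_fun setT b by rewrite /b; meas.
have -> : (2%:E = \int[mu]_t (a t ^+ 2)%:E)%E.
  have -> : (2 = 1 - (-1) :> R) by ring.
  rewrite -integral_itv_ind; last by lra.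
  by apply: eq_integral => t _; rewrite /a -natrX; case: (_ && _).
have -> : abs_line_integral s phi = (\int[mu]_t `|a t * b t|%:E)%E.
  apply: eq_integral => t _; rewrite /a /b; congr (_%:E).
  case: (boolP (_ <= t <= _)) => [_|t1]; first by rewrite mul1r.
  rewrite mul0r normr0 line_point_eq0 ?normr0//.
  have := sqr_ge0 s; move: t1; rewrite negb_and -!ltNge => /orP[] ?; nra.
exact: cauchy_schwarz_integral.
Qed.

Lemma ge0_line_integral_rotation (g : R -> \bar R) (phi : R) :
  measurable_fun setT g -> (forall x, (0 <= g x)%E) ->
  (\int[mu]_s \int[mu]_t g (f (line_point s phi t)) =
   \int[mu2]_x g (f x))%E.
Proof.
move=> mg g0.
rewrite -(ge0_integral_rotation (f := fun x => g (f x)) (cos2Dsin2 phi))//; last by meas.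
by rewrite tonelli_mu2//; meas.
Qed.

Lemma integral_abs_line_integral_sqr (phi : R) :
  (\int[mu]_s (abs_line_integral s phi * abs_line_integral s phi) <=
   2%:E * norm_sq f)%E.
Proof.
apply: (@le_trans _ _ (\int[mu]_s
    (2%:E * \int[mu]_t (f (line_point s phi t) ^+ 2)%:E))%E).
  apply: le_ge0_integral => s; last exact: abs_line_integral_sqr.
  by rewrite mule_ge0// abs_line_integral_ge0.
rewrite ge0_integralZl//; last 2 first.
- by meas.
- by move=> s _; apply: integral_ge0 => t _; rewrite lee_fin sqr_ge0.
rewrite (@ge0_line_integral_rotation (fun x => (x ^+ 2)%:E))//; first by meas.
by move=> x; rewrite lee_fin sqr_ge0.
Qed.

(** From [|f| <= 1 + f ^ 2] on the square [[-1, 1]^2] of area 4, which contains the disc. *)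
Lemma integral_abs_le : (\int[mu2]_x `|f x|%:E <= 4%:E + norm_sq f)%E.
Proof.
pose a (x : R) : \bar R := (-1 <= x <= 1)%R%:R%:E.
have a0 x : (0 <= a x)%E by rewrite lee_fin ler0n.
apply: (@le_trans _ _ (\int[mu2]_x (a x.1 * a x.2 + (f x ^+ 2)%:E))%E).
  apply: le_ge0_integral => [x|x]; first by rewrite lee_fin.
  rewrite /a -EFinM -EFinD lee_fin.
  have [xO|xO] := pselect (Omega x); last first.
    by rewrite fO// normr0 addr_ge0 ?sqr_ge0// mulr_ge0 ?ler0n.
  have -> : (-1 <= x.1 <= 1) by move: xO; rewrite /Omega/= => ?; nra.
  have -> : (-1 <= x.2 <= 1) by move: xO; rewrite /Omega/= => ?; nra.
  rewrite -(real_normK (num_real (f x))) /= mulr1.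
  by have := sqr_ge0 (`|f x| - 1); have := normr_ge0 (f x); nra.
rewrite ge0_integralD//; last 4 first.
- by move=> x _; rewrite mule_ge0.
- by rewrite /a; meas.
- by move=> x _; rewrite lee_fin sqr_ge0.
- by meas.
rewrite leeD2r// tonelli_mu2; last 2 first.
- by rewrite /a; meas.
- by move=> x; rewrite mule_ge0.
apply: (@le_trans _ _ (\int[mu]_x (a x * 2%:E))%E).
  apply: le_ge0_integral => x.
    by apply: integral_ge0 => y _; rewrite mule_ge0.
  rewrite /= ge0_integralZl//; last by rewrite /a; meas.
  rewrite integral_itv_ind; last by lra.
  by rewrite lee_wpmul2l// lee_fin; lra.
rewrite ge0_integralZr//; last by rewrite /a; meas.
rewrite integral_itv_ind; last by lra.
by rewrite -EFinM lee_fin; lra.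
Qed.

Hypothesis f_fin : (norm_sq f < +oo)%E.

Lemma integral_abs_lty : (\int[mu2]_x `|f x|%:E < +oo)%E.
Proof. by apply: (le_lt_trans integral_abs_le); rewrite lte_add_pinfty// ltry. Qed.

Lemma integral_abs_line_integral_lty (phi : R) :
  (\int[mu]_s abs_line_integral s phi < +oo)%E.
Proof.
rewrite (@ge0_line_integral_rotation (fun x => `|x|%:E))//; last by meas.
exact: integral_abs_lty.
Qed.

Lemma measurable_abs_line_integral :
  measurable_fun setT (fun z : R * R => abs_line_integral z.1 z.2).
Proof. by rewrite /abs_line_integral; meas. Qed.

Lemma ae_abs_line_integral_lty (phi h : R) :
  {ae mu, forall s, abs_line_integral (s + h) phi \is a fin_num}.
Proof.
have mL := measurable_abs_line_integral.
have : mu.-integrable setT (fun s => abs_line_integral (s + h) phi).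
  apply/integrableP; split.
    by rewrite /abs_line_integral; meas.
  under eq_integral do rewrite gee0_abs ?abs_line_integral_ge0//.
  rewrite (ge0_integral_translation (f := abs_line_integral ^~ phi))//.
  - exact: integral_abs_line_integral_lty.
  - by rewrite /abs_line_integral; meas.
  - by move=> s; exact: abs_line_integral_ge0.
by move/(integrable_ae measurableT); apply: filterS => s /(_ I).
Qed.

End Support.

(** Same default as the real-valued integral in [radon]: a line on which the integral is not finite
    gets the value 0. *)
Definition xray f (s phi : R) : R := fine (line_integral f s phi).

Lemma measurable_xray f : measurable_fun setT f ->
  measurable_fun setT (fun z : R * R => xray f z.1 z.2).
Proof. by move=> mf; rewrite /xray /line_integral; meas. Qed.

Lemma xray_abs_le f (s phi : R) : measurable_fun setT f ->
  (`|xray f s phi|%:E <= abs_line_integral f s phi)%E.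
Proof.
move=> mf; rewrite /xray.
have : (`|line_integral f s phi| <= abs_line_integral f s phi)%E.
  by apply: le_abse_integral => //; meas.
case: (line_integral f s phi) => [r//| |] _; rewrite normr0; exact: abs_line_integral_ge0.
Qed.

Lemma integral_xray_sqr f (phi : R) : measurable_fun setT f ->
  (forall x, ~ Omega x -> f x = 0) ->
  (\int[mu]_s (xray f s phi ^+ 2)%:E <= 2%:E * norm_sq f)%E.
Proof.
move=> mf fO; apply: le_trans (integral_abs_line_integral_sqr mf fO phi).
apply: le_ge0_integral => s; first by rewrite lee_fin sqr_ge0.
rewrite -real_normK ?num_real// expr2 EFinM.
by rewrite lee_pmul ?xray_abs_le// lee_fin.
Qed.

Section NonnegModulus.
Variable f : R * R -> R.
Hypothesis mf : measurable_fun setT f.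
Hypothesis f0 : forall x, 0 <= f x.
Hypothesis fO : forall x, ~ Omega x -> f x = 0.
Hypothesis f_fin : (norm_sq f < +oo)%E.

Let LE s phi : line_integral f s phi = abs_line_integral f s phi.
Proof. by apply: eq_integral => t _; rewrite ger0_norm. Qed.

(** This is [(a - b) ^ 2 + 2 a b = a ^ 2 + b ^ 2] together with translation invariance in [s]. The
    integrands agree where the line integrals at [s] and [s + h] are both finite, hence almost
    everywhere. *)
Lemma xray_modulus_polarization (phi h : R) :
  (\int[mu]_s ((xray f (s + h) phi - xray f s phi) ^+ 2)%:E +
   2%:E * \int[mu]_s (line_integral f s phi * line_integral f (s + h)%R phi) =
   2%:E * \int[mu]_s (line_integral f s phi * line_integral f s phi))%E.
Proof.
have mx := measurable_xray mf.
have mL : measurable_fun setT (fun z : R * R => line_integral f z.1 z.2).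
  by rewrite /line_integral; meas.
have L0 s : (0 <= line_integral f s phi)%E by exact: line_integral_ge0.
have mL' : measurable_fun setT (fun s : R => line_integral f s phi).
  by rewrite /line_integral; meas.
have mLh : measurable_fun setT (fun s : R => line_integral f (s + h) phi).
  by rewrite /line_integral; meas.
have mxh : measurable_fun setT (fun s : R => xray f (s + h) phi).
  by rewrite /xray /line_integral; meas.
have mx' : measurable_fun setT (fun s : R => xray f s phi).
  by rewrite /xray /line_integral; meas.
rewrite -[in LHS]ge0_integralZl//; last 2 first.
- by meas.
- by move=> s _; rewrite mule_ge0.
rewrite -ge0_integralD//; last 4 first.
- by move=> s _; rewrite lee_fin sqr_ge0.
- by meas.
- by move=> s _; rewrite !mule_ge0.
- by meas.
have -> : (2%:E * \int[mu]_s (line_integral f s phi * line_integral f s phi) =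
   \int[mu]_s (line_integral f (s + h)%R phi * line_integral f (s + h)%R phi +
               line_integral f s phi * line_integral f s phi))%E.
  rewrite ge0_integralD//; last 4 first.
  - by move=> s _; rewrite mule_ge0.
  - by meas.
  - by move=> s _; rewrite mule_ge0.
  - by meas.
  rewrite (ge0_integral_translation
    (f := fun s => line_integral f s phi * line_integral f s phi)%E)//.
  - by rewrite mule_natl mule2n.
  - by meas.
  - by move=> s; rewrite mule_ge0.
apply: ge0_ae_eq_integral => //.
- by meas.
- by meas.
- by move=> s _; rewrite adde_ge0 ?lee_fin ?sqr_ge0// !mule_ge0.
- by move=> s _; rewrite adde_ge0// mule_ge0.
have A1 := ae_abs_line_integral_lty mf fO f_fin phi h.
have A2 := ae_abs_line_integral_lty mf fO f_fin phi 0.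
have FF : Filter (nbhs (almost_everywhere mu)) := ae_filter_ringOfSetsType mu.
rewrite /ae_eq; apply: filterS2 A1 A2 => s + + _; rewrite addr0 -!LE /xray.
move=> /fineK <- /fineK <-; rewrite -!EFinM -!EFinD; congr EFin => /=.
by rewrite !expr2; ring.
Qed.

Lemma integral_weighted_polarization (c P Q Q0 : R -> \bar R) :
  measurable_fun setT c -> measurable_fun setT P ->
  measurable_fun setT Q -> measurable_fun setT Q0 ->
  (forall x, (0 <= c x)%E) -> (forall x, (0 <= P x)%E) ->
  (forall x, (0 <= Q x)%E) -> (forall x, (0 <= Q0 x)%E) ->
  (forall x, (P x + 2%:E * Q x = 2%:E * Q0 x)%E) ->
  (\int[mu]_x (c x * P x) + 2%:E * \int[mu]_x (c x * Q x) =
   2%:E * \int[mu]_x (c x * Q0 x))%E.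
Proof.
move=> mc mP mQ mQ0 c0 P0 Q_0 Q00 PQ.
rewrite -ge0_integralZl//; last 2 first.
- by meas.
- by move=> x _; rewrite mule_ge0.
rewrite -ge0_integralZl//; last 2 first.
- by meas.
- by move=> x _; rewrite mule_ge0.
rewrite -ge0_integralD//; last 4 first.
- by move=> x _; rewrite mule_ge0.
- by meas.
- by move=> x _; rewrite !mule_ge0.
- by meas.
apply: eq_integral => x _.
rewrite !(muleCA 2%:E) -PQ ge0_muleDr//.
by rewrite mule_ge0.
Qed.

(** With [B k] the pairing at shift [k], the left side is twice [B 0 - B h], and this difference is
    at most [2 * M * |h|] for the bound [M = 4 * pi * norm_sq f] on the autocorrelation: hence
    [16 * pi]. *)
Lemma xray_modulus_ge0 (h : R) :
  (\int[mu]_phi (circle phi *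
     \int[mu]_s ((xray f (s + h) phi - xray f s phi) ^+ 2)%:E) <=
   (16 * pi * `|h|)%:E * norm_sq f)%E.
Proof.
have mx := measurable_xray mf.
have mL : measurable_fun setT (fun z : R * R => line_integral f z.1 z.2).
  by rewrite /line_integral; meas.
have L0 s phi : (0 <= line_integral f s phi)%E by exact: line_integral_ge0.
have c0 := @circle_ge0 R; have mc := @measurable_circle R.
set W := (\int[mu]_phi _)%E.
pose B (k : R) := (\int[mu]_phi (circle phi *
     \int[mu]_s (line_integral f s phi * line_integral f (s + k)%R phi)))%E.
have B_ge0 k : (0 <= B k)%E.
  by apply: integral_ge0 => phi _; apply: mule_ge0; [exact: c0|]; apply: integral_ge0 => s _; apply: mule_ge0; exact: L0.
have W0 : (0 <= W)%E.
  by apply: integral_ge0 => phi _; apply: mule_ge0; [exact: c0|]; apply: integral_ge0 => s _; rewrite lee_fin sqr_ge0.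
have I0 k phi : (0 <= \int[mu]_s (line_integral f s phi * line_integral f (s + k)%R phi))%E.
  by apply: integral_ge0 => s _; apply: mule_ge0; exact: L0.
have J0 phi : (0 <= \int[mu]_s ((xray f (s + h) phi - xray f s phi) ^+ 2)%:E)%E.
  by apply: integral_ge0 => s _; rewrite lee_fin sqr_ge0.
have mP : measurable_fun setT (fun phi =>
    \int[mu]_s ((xray f (s + h) phi - xray f s phi) ^+ 2)%:E)%E.
  by rewrite /xray /line_integral; meas.
have mQ k : measurable_fun setT (fun phi =>
    \int[mu]_s (line_integral f s phi * line_integral f (s + k)%R phi))%E.
  by rewrite /line_integral; meas.
have WB : (W + 2%:E * B h = 2%:E * B 0%R)%E.
  apply: (integral_weighted_polarization mc mP (mQ h) (mQ 0) c0 J0 (I0 h) (I0 0)).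
  have L00 s phi : line_integral f (s + 0) phi = line_integral f s phi.
    by rewrite addr0.
  move=> phi; rewrite xray_modulus_polarization.
  have -> : (\int[mu]_s (line_integral f s phi * line_integral f (s + 0)%R phi) =
     \int[mu]_s (line_integral f s phi * line_integral f s phi))%E.
    by apply: eq_integral => s _; rewrite L00.
  reflexivity.

have [N NE] : exists N : R, norm_sq f = N%:E.
  by exists (fine (norm_sq f)); rewrite fineK// ge0_fin_numE// norm_sq_ge0.
have mg : measurable_fun setT (circular_corr f) by rewrite /circular_corr; meas.
have g0 r : (0 <= circular_corr f r)%E.
  apply: integral_ge0 => x _; rewrite mule_ge0 ?lee_fin//.
  by apply: integral_ge0 => phi _; rewrite mule_ge0 ?lee_fin.
have gM r : (circular_corr f r <= (4 * pi * N)%:E)%E.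
  by rewrite (le_trans (circular_corr_le mf f0 r))// NE.
have B0h : (B 0%R <= B h + (2 * (4 * pi * N) * `|h|)%:E)%E.
  have E0 : B 0 = (\int[mu]_r circular_corr f `|r|%R)%E.
    apply: etrans; first exact: (corr_radial mf f0 0).
    apply: eq_integral => r _; congr (circular_corr f _).
    by rewrite expr0n addr0 sqrtr_sqr.
  have Eh : B h = (\int[mu]_r circular_corr f (Num.sqrt (r ^+ 2 + `|h| ^+ 2)%R))%E.
    apply: etrans; first exact: (corr_radial mf f0 h).
    apply: eq_integral => r _; congr (circular_corr f _).
    by rewrite real_normK ?num_real.
  rewrite E0 Eh.
  exact: (even_integral_hypot_le (normr_ge0 h) mg g0 gM).

have B0fin : (B 0%R < +oo)%E.
  apply: (@le_lt_trans _ _ (\int[mu]_phi (circle phi * (2%:E * norm_sq f)))%E).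
    apply: le_ge0_integral => phi.
      by apply: mule_ge0; [exact: c0|exact: I0].
    apply: lee_wpmul2l; first exact: c0.
    apply: le_trans (integral_abs_line_integral_sqr mf fO phi).
    by under eq_integral do rewrite addr0 !LE.
  rewrite NE ge0_integralZr//; last first.
    by rewrite -NE mule_ge0// norm_sq_ge0.
  by rewrite integral_circle -!EFinM ltry.
clear I0 J0 mP mQ mg g0 gM; clearbody B W.
(* Finiteness allows this term to be cancelled on both sides in the extended reals. *)
have Bhfin : (2%:E * B h < +oo)%E.
  apply: (@le_lt_trans _ _ (2%:E * B 0%R)%E); first by rewrite -WB leeDr.
  by rewrite lte_mul_pinfty.
have N0 : 0 <= N by rewrite -lee_fin -NE norm_sq_ge0.
have : (W + 2%:E * B h <= (16 * pi * `|h|)%:E * norm_sq f + 2%:E * B h)%E.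
  rewrite WB NE -EFinM (le_trans (lee_wpmul2l _ B0h))//.
  rewrite ge0_muleDr//; last by rewrite lee_fin !mulr_ge0// pi_ge0.
  by rewrite addeC leeD2r// -EFinM lee_fin; lra.
by rewrite leeD2rE// ge0_fin_numE// mule_ge0.
Qed.

End NonnegModulus.

End Modulus.

Section FineFubini.
Context {R : realType} {d1 d2} {T1 : measurableType d1} {T2 : measurableType d2}.
Variables (m1 : {sigma_finite_measure set T1 -> \bar R})
          (m2 : {sigma_finite_measure set T2 -> \bar R}).
Variables (a : T1 -> T2 -> R) (b : T1 -> R).
Hypothesis ma : measurable_fun setT (fun z : T1 * T2 => a z.1 z.2).
Hypothesis mb : measurable_fun setT b.
Hypothesis ab_fin : (\int[m1]_x \int[m2]_y `|a x y * b x|%:E < +oo)%E.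

(* [fine] replaces the value of the inner integral by [0] on the negligible set
   where it is infinite or undefined. *)
Lemma integral_fine_mul :
  (\int[m1]_x (fine (\int[m2]_y (a x y)%:E) * b x)%:E =
   \int[m1]_x \int[m2]_y (a x y * b x)%:E)%E.
Proof.
have mab : measurable_fun setT (fun z : T1 * T2 => (a z.1 z.2 * b z.1)%:E).
  by meas.
have iF : (m1 \x m2)%E.-integrable setT (fun z => (a z.1 z.2 * b z.1)%:E).
  by apply/integrable12ltyP => //=.
apply: ae_eq_integral => //.
- have := @measurable_fun_integral R _ _ T1 T2 m2 (fun x y => (a x y)%:E).
  by move=> H; meas; apply: H; meas.
- by apply: measurable_fun_integral; meas.
have := ae_integrable1 iF; rewrite /ae_eq; apply: filterS => x /= ix _.
have [bx0|bx0] := eqVneq (b x) 0.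
  rewrite bx0 mulr0; symmetry; apply: integral0_eq => y _.
  by rewrite mulr0.
have ia : m2.-integrable setT (fun y => (a x y)%:E).
  have := integrableZr measurableT (b x)^-1 ix.
  apply: eq_integrable => // y _ /=.
  by rewrite -EFinM mulfK.
by rewrite EFinM fineK ?integrable_fin_num// -integralZr.
Qed.

End FineFubini.

(** Positive and negative parts commute with composition, so a change of variables established for
    nonnegative functions extends to signed ones. *)
Lemma integral_signed_transfer {R : realType} {d1 d2}
    {T1 : measurableType d1} {T2 : measurableType d2}
    (m1 : {measure set T1 -> \bar R}) (m2 : {measure set T2 -> \bar R})
    (psi : T1 -> T2) :
  (forall F : T2 -> \bar R, measurable_fun setT F -> (forall x, (0 <= F x)%E) ->
     \int[m1]_x F (psi x) = \int[m2]_x F x)%E ->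
  forall F : T2 -> \bar R, measurable_fun setT F ->
    (\int[m1]_x F (psi x) = \int[m2]_x F x)%E.
Proof.
move=> H F mF; rewrite [LHS]integralE [RHS]integralE.
have pE x : ((fun x => F (psi x))^\+ x = F^\+ (psi x))%E by rewrite unlock.
have nE x : ((fun x => F (psi x))^\- x = F^\- (psi x))%E by rewrite unlock.
rewrite -(H _ (measurable_funepos mF)); last by move=> x; exact: funepos_ge0.
rewrite -(H _ (measurable_funeneg mF)); last by move=> x; exact: funeneg_ge0.
apply: (congr2 (fun a b : \bar R => a - b)%E); apply: eq_integral => x _.
  exact: pE.
exact: nE.
Qed.

Lemma integral_itvco_ind {R : realType} (a b : R) : a <= b ->
  (\int[@lebesgue_measure R]_t (a <= t < b)%R%:R%:E = (b - a)%:E)%E.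
Proof.
move=> ab; transitivity (\int[@lebesgue_measure R]_t (\1_(`[a, b[ : set R) t)%:E)%E.
  by apply: eq_integral => t _; rewrite indicE mem_setE in_itv.
rewrite integral_indic//= setIT lebesgue_measure_itv/= lte_fin.
by case: ltP => ab'; rewrite -?EFinB//; congr EFin; lra.
Qed.

(** * Averaging over the offset cells *)

Section Rounding.
Context {R : realType}.
Local Notation mu := (@lebesgue_measure R).
Variables (del c : R).
Hypothesis del0 : 0 < del.

(* Nearest point of the lattice [del * (Z - c)]; for [c = (P + 1) / 2] it maps
   every cell S_p to s_p. *)
Definition lattice_round (s : R) : R :=
  del * ((Num.floor (s / del + c + 2^-1))%:~R - c).

Lemma lattice_round_cell (k : int) (s : R) :
  del * (k%:~R - c) - del / 2 <= s < del * (k%:~R - c) + del / 2 ->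
  lattice_round s = del * (k%:~R - c).
Proof.
move=> /andP[sk ks]; rewrite /lattice_round; congr (_ * (_%:~R - _)).
apply: Num.Theory.floor_def; rewrite intrD1.
have e : s = del * (s / del) by rewrite mulrC divfK// gt_eqF.
move: sk ks; rewrite {1 2}e; move: (s / del) => y sk ks.
have : del * (k%:~R - c - 2^-1) <= del * y by lra.
have : del * y < del * (k%:~R - c + 2^-1) by lra.
by rewrite ler_pM2l// ltr_pM2l//; lra.
Qed.

Lemma lattice_round_itv (s : R) :
  lattice_round s - del / 2 <= s < lattice_round s + del / 2.
Proof.
rewrite /lattice_round; set k := Num.floor _.
have k1 : k%:~R <= s / del + c + 2^-1 by exact: Num.Theory.floor_le.
have k2 : s / del + c + 2^-1 < k%:~R + 1.
  by have /andP[_] := Num.Theory.floor_itv (s / del + c + 2^-1); rewrite intrD1.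
have e : s = del * (s / del) by rewrite mulrC divfK// gt_eqF.
clearbody k; rewrite {1 2}e; move: k1 k2; move: (s / del) => y k1 k2.
have := ler_wpM2l (ltW del0) k1.
have : del * (y + c + 2^-1) < del * (k%:~R + 1) by rewrite ltr_pM2l.
by move=> ? ?; apply/andP; split; lra.
Qed.

Lemma lattice_round_dist (s : R) : `|lattice_round s - s| <= del / 2.
Proof.
have /andP[? ?] := lattice_round_itv s.
by rewrite ler_norml; apply/andP; split; lra.
Qed.

Lemma measurable_lattice_round : measurable_fun setT lattice_round.
Proof.
apply: nondecreasing_measurable => // s t st.
rewrite ler_pM2l// lerD2r ler_int; apply: Num.Theory.le_floor.
by rewrite !lerD2r ler_pM2r ?invr_gt0.
Qed.

Definition lattice_kernel (s sg : R) : R :=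
  (del ^+ 2)^-1 * weight del (sg - lattice_round s).

Lemma measurable_weight d (T : measurableType d) (f : T -> R) :
  measurable_fun setT f -> measurable_fun setT (fun x => weight del (f x)).
Proof.
move=> mf; rewrite /weight.
have -> : (fun x => Num.max 0 (del - `|f x|)) =
    (fun x => (0 <= del - `|f x|)%R%:R * (del - `|f x|)).
  by apply/funext => x; case: leP => _; rewrite ?mul1r ?mul0r.
by meas.
Qed.

Lemma measurable_lattice_kernel :
  measurable_fun setT (fun z : R * R => lattice_kernel z.1 z.2).
Proof.
have mr := measurable_lattice_round.
by apply: measurable_funM; [meas | apply: measurable_weight; meas].
Qed.

Lemma weight_ge0 t : 0 <= weight del t.
Proof. by rewrite le_max lexx. Qed.

Lemma weight_eq0 t : del <= `|t| -> weight del t = 0.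
Proof. by move=> td; apply/max_idPl; rewrite subr_le0. Qed.

Lemma weight_le t : weight del t <= del * (`|t| <= del)%R%:R.
Proof.
rewrite /weight; case: (leP `|t| del) => td.
  by rewrite mulr1 ge_max (ltW del0)/= lerBlDr lerDl.
by rewrite mulr0 ge_max lexx/= subr_le0 ltW.
Qed.

Lemma weight_lipschitz t t' : `|weight del t - weight del t'| <= `|t - t'|.
Proof.
have H x y : weight del x - weight del y <= `|x - y|.
  rewrite /weight lerBlDr ge_max addr_ge0 ?normr_ge0 ?le_max ?lexx//=.
  apply: (@le_trans _ _ (`|x - y| + (del - `|y|))); last first.
    by rewrite lerD2l le_max lexx orbT.
  have : `|y| <= `|x - y| + `|x|.
    by rewrite -{1}[y](subKr x) (le_trans (ler_normB _ _))// addrC.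
  by lra.
by rewrite ler_norml; apply/andP; split; last exact: H; rewrite lerNl opprB distrC.
Qed.

Lemma lattice_kernel_ge0 s sg : 0 <= lattice_kernel s sg.
Proof. by rewrite mulr_ge0 ?weight_ge0// invr_ge0 sqr_ge0. Qed.

(** The constant [3 / 2] adds the half-width [del] of the weight and the rounding error
    [del / 2]. *)
Lemma lattice_kernel_le s sg :
  lattice_kernel s sg <= del^-1 * (`|sg - s| <= 3 / 2 * del)%R%:R.
Proof.
rewrite /lattice_kernel.
apply: (@le_trans _ _ ((del ^+ 2)^-1 * (del * (`|sg - lattice_round s| <= del)%R%:R))).
  by rewrite ler_wpM2l ?weight_le// invr_ge0 sqr_ge0.
have -> : (del ^+ 2)^-1 * (del * (`|sg - lattice_round s| <= del)%R%:R)
    = del^-1 * (`|sg - lattice_round s| <= del)%R%:R.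
  by field; rewrite gt_eqF.
apply: ler_wpM2l; first by rewrite invr_ge0 ltW.
rewrite ler_nat.
case: (leP _ del) => // sd; suff -> : `|sg - s| <= 3 / 2 * del by [].
have -> : sg - s = (sg - lattice_round s) + (lattice_round s - s) by ring.
by rewrite (le_trans (ler_normD _ _))//; have := lattice_round_dist s; lra.
Qed.

(* [weight del] and its translate by [del] sum to [del] on [`[0, del]]. *)
Lemma integral_weight (v : R) :
  (\int[mu]_t (weight del (t - v))%:E = (del ^+ 2)%:E)%E.
Proof.
have w0 t : (0 <= (weight del t)%:E)%E by rewrite lee_fin weight_ge0.
have mw : measurable_fun setT (fun t => (weight del t)%:E).
  by apply: measurable_fun_EFin; apply: measurable_weight; meas.
have mw' : measurable_fun setT (fun t : R => (weight del (t - del))%:E).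
  by apply: measurable_fun_EFin; apply: measurable_weight; meas.
rewrite (ge0_integral_translation (f := fun t => (weight del t)%:E) (- v))//.
have -> : (\int[mu]_t (weight del t)%:E = \int[mu]_t ((0 <= t < del)%R%:R%:E * (weight del t)%:E) + \int[mu]_t ((- del <= t < 0)%R%:R%:E * (weight del t)%:E))%E.
  rewrite -ge0_integralD//; last 4 first.
  - by move=> t _; rewrite mule_ge0// lee_fin ler0n.
  - by meas.
  - by move=> t _; rewrite mule_ge0// lee_fin ler0n.
  - by meas.
  apply: eq_integral => t _; rewrite -!EFinM -EFinD; congr EFin.
  rewrite -mulrDl -natrD.
  have [td|] := leP del `|t|; first by rewrite weight_eq0 ?mulr0.
  rewrite ltr_norml => /andP[/ltW -> ->]; rewrite andbT /=.
  by case: ltP => _; rewrite ?mul1r.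
have -> : (\int[mu]_t ((- del <= t < 0)%R%:R%:E * (weight del t)%:E) =
   \int[mu]_t ((0 <= t < del)%R%:R%:E * (weight del (t - del))%:E))%E.
  have H := ge0_integral_translation (f := fun t => ((- del <= t < 0)%R%:R%:E * (weight del t)%:E)%E) (- del).
  rewrite -H; last 2 first.
  - by meas.
  - by move=> t; rewrite mule_ge0// lee_fin ler0n.
  apply: eq_integral => t _; congr ((nat_of_bool (_ && _))%:R%:E * _)%E; lra.
rewrite -ge0_integralD//; last 4 first.
- by move=> t _; rewrite mule_ge0// lee_fin ler0n.
- by meas.
- by move=> t _; rewrite mule_ge0// lee_fin ler0n.
- by meas.
have -> : (del ^+ 2)%:E = (del%:E * \int[mu]_t (0 <= t < del)%R%:R%:E)%E.
  by rewrite integral_itvco_ind ?ltW// subr0 -EFinM expr2.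
rewrite -ge0_integralZl//; last 2 first.
- by meas.
- by rewrite lee_fin ltW.
apply: eq_integral => t _; rewrite -!EFinM -EFinD; congr EFin.
rewrite /weight; have [t0|t0] := leP 0 t; last by rewrite !mul0r mulr0 addr0.
have [td|td] := ltP t del; last by rewrite !mul0r mulr0 addr0.
rewrite !mul1r mulr1 ger0_norm// ltr0_norm ?subr_lt0//.
by rewrite !max_r; lra.
Qed.

Lemma integral_lattice_kernel (s : R) :
  (\int[mu]_sg (lattice_kernel s sg)%:E = 1)%E.
Proof.
rewrite /lattice_kernel; under eq_integral do rewrite EFinM.
rewrite ge0_integralZl//; last 3 first.
- by apply: measurable_fun_EFin; apply: measurable_weight; meas.
- by move=> t _; rewrite lee_fin weight_ge0.
- by rewrite lee_fin invr_ge0 sqr_ge0.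
by rewrite integral_weight -EFinM mulVf// expf_neq0// gt_eqF.
Qed.

(* The hat functions centred at the lattice points form a partition of unity. *)
Lemma integral_lattice_kernel_left (sg : R) :
  (\int[mu]_s (lattice_kernel s sg)%:E = 1)%E.
Proof.
pose k := Num.floor (sg / del + c).
pose v := del * (k%:~R - c).
have e : sg = del * (sg / del) by rewrite mulrC divfK// gt_eqF.
have [v1 v2] : v <= sg /\ sg < v + del.
  have k1 : k%:~R <= sg / del + c by exact: Num.Theory.floor_le.
  have k2 : sg / del + c < k%:~R + 1.
    by have /andP[_] := Num.Theory.floor_itv (sg / del + c); rewrite intrD1.
  rewrite /v; clearbody k; rewrite e; move: k1 k2; move: (sg / del) => y k1 k2.
  have := ler_wpM2l (ltW del0) k1.
  have : del * (y + c) < del * (k%:~R + 1) by rewrite ltr_pM2l.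
  by move=> ? ?; split; lra.
pose J (w s : R) : R := (w - del / 2 <= s < w + del / 2)%R%:R.
have J0 w s : (0 <= (J w s)%:E)%E by rewrite lee_fin ler0n.
have intJ w : (\int[mu]_s (J w s)%:E = del%:E)%E.
  by rewrite integral_itvco_ind; [congr EFin|]; lra.
(* Only the hats centred at [v] and [v + del], the lattice points on either side of [sg], can be
   nonzero at [sg]; the indicators [J] tell for which [s] each is selected by rounding. *)
have kE s : lattice_kernel s sg = (del ^+ 2)^-1 *
    ((del - (sg - v)) * J v s + (sg - v) * J (v + del) s).
  rewrite /lattice_kernel; congr (_ * _); rewrite /J.
  case: (boolP (v - del / 2 <= s < v + del / 2)) => sv.
    rewrite (lattice_round_cell sv) -/v mulr1.
    have -> : (v + del - del / 2 <= s < v + del + del / 2) = false.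
      by apply/negP => /andP[? _]; move: sv => /andP[_ ?]; lra.
    by rewrite mulr0 addr0 /weight ger0_norm ?subr_ge0// max_r//; lra.
  rewrite mulr0 add0r.
  have vd : v + del = del * ((k + 1)%:~R - c) by rewrite /v intrD1; ring.
  case: (boolP (v + del - del / 2 <= s < v + del + del / 2)) => sv'.
    rewrite vd in sv'; rewrite (lattice_round_cell sv') mulr1 -vd.
    by rewrite /weight ler0_norm ?max_r//; lra.
  rewrite mulr0 weight_eq0//.
  have sr := lattice_round_itv s; move: sr; rewrite /lattice_round.
  set m := Num.floor _; clearbody m => sr.
  have [mk|mk|mk] := ltgtP m k; last by rewrite mk -/v in sr; rewrite sr in sv.
    have : (m + 1)%:~R <= k%:~R :> R by rewrite ler_int lezD1.
    rewrite intrD1 => /(ler_wpM2l (ltW del0)) => ?.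
    by rewrite ger0_norm; rewrite /v in v1; lra.
  have [mk'|mk'|mk'] := ltgtP m (k + 1); last by rewrite vd -mk' sr in sv'.
    by move: mk'; rewrite ltzD1 leNgt mk.
  have : (k + 1 + 1)%:~R <= m%:~R :> R by rewrite ler_int lezD1.
  rewrite !intrD1 => /(ler_wpM2l (ltW del0)) => ?.
  by rewrite ler0_norm; rewrite /v in v2; lra.
transitivity (\int[mu]_s (((del ^+ 2)^-1 * (del - (sg - v)))%:E * (J v s)%:E +
    ((del ^+ 2)^-1 * (sg - v))%:E * (J (v + del) s)%:E))%E.
  by apply: eq_integral => s _; rewrite kE -!EFinM -EFinD; congr EFin; ring.
have d2 : 0 <= (del ^+ 2)^-1 by rewrite invr_ge0 sqr_ge0.
have a0 : (0 <= ((del ^+ 2)^-1 * (del - (sg - v)))%:E)%E.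
  by rewrite lee_fin mulr_ge0//; lra.
have b0 : (0 <= ((del ^+ 2)^-1 * (sg - v))%:E)%E.
  by rewrite lee_fin mulr_ge0//; lra.
have mJ w : measurable_fun setT (fun s => (J w s)%:E) by rewrite /J; meas.
have mJ1 := mJ v; have mJ2 := mJ (v + del).
rewrite ge0_integralD//; last 4 first.
- by move=> s _; apply: mule_ge0.
- by meas.
- by move=> s _; apply: mule_ge0.
- by meas.
rewrite ge0_integralZl// ge0_integralZl// !intJ -!EFinM -EFinD.
by congr EFin; field; rewrite gt_eqF.
Qed.

End Rounding.

(** * Integrals over two offsets and an angle *)

Section Mu3.
Context {R : realType}.
Local Notation mu := (@lebesgue_measure R).
Local Notation mu3 := (@mu2_sf R \x mu)%E.

Lemma tonelli_mu3 (F : R * R * R -> \bar R) :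
  measurable_fun setT F -> (forall x, (0 <= F x)%E) ->
  (\int[mu3]_x F x = \int[mu2]_z \int[mu]_t F (z, t))%E.
Proof. by move=> mF F0; rewrite fubini_tonelli1. Qed.

(** The coordinates are an offset, an angle and a second offset; Tonelli exchanges the two offsets
    at each fixed angle. *)
Lemma ge0_swap_mu2 (F : R * R * R -> \bar R) :
  measurable_fun setT F -> (forall x, (0 <= F x)%E) ->
  (\int[mu2]_z \int[mu]_t F (t, z.2, z.1) = \int[mu2]_z \int[mu]_t F (z, t))%E.
Proof.
move=> mF F0.
rewrite tonelli_mu2_swap; last 2 first.
- by meas.
- by move=> x; apply: integral_ge0.
rewrite tonelli_mu2_swap; last 2 first.
- by meas.
- by move=> x; apply: integral_ge0.
by apply: eq_integral => phi _; apply: tonelli_swap => //; meas.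
Qed.

Lemma swap_mu3 (F : R * R * R -> \bar R) : measurable_fun setT F ->
  (\int[mu3]_x F (x.2, x.1.2, x.1.1) = \int[mu3]_x F x)%E.
Proof.
move=> mF.
apply: (@integral_signed_transfer R _ _ _ _ mu3 mu3
  (fun x => (x.2, x.1.2, x.1.1))) => // {mF}F mF F0.
rewrite tonelli_mu3//; last by meas.
by rewrite tonelli_mu3// -ge0_swap_mu2.
Qed.

End Mu3.

Section Averaging.
Context {R : realType}.
Local Notation mu := (@lebesgue_measure R).
Variables (del c : R).
Hypothesis del0 : 0 < del.
Local Notation kappa := (lattice_kernel del c).
Implicit Types u v g : R * R -> R.

Let mk : measurable_fun setT (fun z : R * R => kappa z.1 z.2).
Proof. exact: measurable_lattice_kernel. Qed.

Let mk2 d (T : measurableType d) (a b : T -> R) :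
  measurable_fun setT a -> measurable_fun setT b ->
  measurable_fun setT (fun x => kappa (a x) (b x)).
Proof.
move=> ma mb; apply: (measurableT_comp mk (g := fun x => (a x, b x))).
by meas.
Qed.

Let k0 s sg : 0 <= kappa s sg. Proof. exact: lattice_kernel_ge0. Qed.

Definition avg v (s phi : R) : R :=
  fine (\int[mu]_sg (kappa s sg * v (sg, phi))%:E)%E.

Definition dispersion v : \bar R :=
  (\int[mu2]_z \int[mu]_sg (kappa z.1 sg * (v (sg, z.2) - v z) ^+ 2)%:E)%E.

Definition shift_sq v (h : R) : \bar R :=
  (\int[mu2]_z ((v ((z.1 + h)%R, z.2) - v z) ^+ 2)%:E)%E.

Lemma dispersion_ge0 v : (0 <= dispersion v)%E.
Proof.
apply: integral_ge0 => z _; apply: integral_ge0 => sg _.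
by rewrite lee_fin mulr_ge0// sqr_ge0.
Qed.

(** The kernel is at most [1 / del] and lives on shifts in an interval of length [3 * del], which
    gives the factor 3. *)
Lemma dispersion_le v (K : R) : measurable_fun setT v -> 0 <= K ->
  (forall h, `|h| <= 3 / 2 * del -> (shift_sq v h <= K%:E)%E) ->
  (dispersion v <= (3 * K)%:E)%E.
Proof.
move=> mv K0 vK.
pose I (h : R) : R := del^-1 * (`|h| <= 3 / 2 * del)%R%:R.
have d0 : 0 <= del^-1 by rewrite invr_ge0 ltW.
have I0 h : 0 <= I h by apply: mulr_ge0 => //; rewrite ler0n.
have mI : measurable_fun setT I by rewrite /I; meas.
have Kd0 : 0 <= K / del by apply: divr_ge0 => //; exact: ltW.
pose G (z : R * R) (h : R) : \bar R :=
  (I h * (v (h + z.1, z.2) - v z) ^+ 2)%:E.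
have G0 z h : (0 <= G z h)%E by rewrite lee_fin mulr_ge0// sqr_ge0.
apply: (@le_trans _ _ (\int[mu2]_z \int[mu]_h G z h)%E).
  apply: le_ge0_integral => z.
    by apply: integral_ge0 => sg _; rewrite lee_fin mulr_ge0// sqr_ge0.
  pose H (sg : R) : \bar R := (I (sg - z.1) * (v (sg, z.2) - v z) ^+ 2)%:E.
  have H0 sg : (0 <= H sg)%E by rewrite lee_fin mulr_ge0// sqr_ge0.
  have mH : measurable_fun setT H by rewrite /H; meas.
  apply: (@le_trans _ _ (\int[mu]_sg H sg)%E).
    apply: le_ge0_integral => sg; first by rewrite lee_fin mulr_ge0// sqr_ge0.
    rewrite lee_fin ler_wpM2r ?sqr_ge0//.
    exact: lattice_kernel_le.
  rewrite -(ge0_integral_translation z.1 mH)//.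
  by rewrite /H /G; under eq_integral do rewrite addrK.
rewrite tonelli_swap_mu2//; last by rewrite /G; meas.
apply: (@le_trans _ _ (\int[mu]_h ((K / del)%:E * (- (3 / 2 * del) <= h <= 3 / 2 * del)%R%:R%:E))%E).
  apply: le_ge0_integral => h; first exact: integral_ge0.
  rewrite /G /I; have [hd|hd] := leP `|h| (3 / 2 * del); last first.
    rewrite integral0_eq; last by move=> z _; rewrite mulr0 mul0r.
    by apply: mule_ge0; rewrite lee_fin// ler0n.
  rewrite -ler_norml hd mule1.
  apply: (@le_trans _ _ ((del^-1)%:E * shift_sq v h)%E).
    rewrite /shift_sq -ge0_integralZl//; last 2 first.
    - by meas.
    - by move=> z _; rewrite lee_fin sqr_ge0.
    apply: le_ge0_integral => z.
      by rewrite lee_fin mulr_ge0 ?sqr_ge0// mulr1 invr_ge0 ltW.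
    by rewrite mulr1 (addrC h).
  rewrite [X in (_ <= X)%E](_ : _ = (del^-1)%:E * K%:E)%E; last first.
    by rewrite -EFinM mulrC.
  by rewrite lee_wpmul2l ?vK// lee_fin invr_ge0 ltW.
rewrite ge0_integralZl//; last by meas.
rewrite integral_itv_ind; last by have := del0; lra.
by rewrite -EFinM lee_fin le_eqVlt; apply/orP; left; apply/eqP; field; rewrite gt_eqF.
Qed.

Lemma kernel_integrable v (s phi : R) : measurable_fun setT v ->
  (\int[mu]_sg `|v (sg, phi)|%:E < +oo)%E ->
  mu.-integrable setT (fun sg => (kappa s sg * v (sg, phi))%:E).
Proof.
move=> mv vfin; apply/integrableP; split.
  by apply: measurable_fun_EFin; apply: measurable_funM; [apply: mk2|]; meas.
apply: (@le_lt_trans _ _ (\int[mu]_sg ((del^-1)%:E * `|v (sg, phi)|%:E))%E).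
  apply: le_ge0_integral => sg; first exact: abse_ge0.
  rewrite /= normrM -EFinM lee_fin ler_wpM2r// ger0_norm//.
  apply: (le_trans (lattice_kernel_le c del0 s sg)).
  by apply: ler_piMr; [rewrite invr_ge0 ltW|rewrite lern1 leq_b1].
rewrite ge0_integralZl//; last 2 first.
- by meas.
- by rewrite lee_fin invr_ge0 ltW.
by rewrite lte_mul_pinfty// lee_fin invr_ge0 ltW.
Qed.

Lemma avg_sub_sqr_le v (s phi : R) : measurable_fun setT v ->
  (\int[mu]_sg `|v (sg, phi)|%:E < +oo)%E ->
  (((avg v s phi - v (s, phi)) ^+ 2)%:E <=
   \int[mu]_sg (kappa s sg * (v (sg, phi) - v (s, phi)) ^+ 2)%:E)%E.
Proof.
move=> mv vfin.
have iv := kernel_integrable s mv vfin.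
have mks : measurable_fun setT (kappa s) by apply: (mk2 (a := fun=> s) (b := id)); meas.
have ik : mu.-integrable setT (fun sg => (kappa s sg)%:E).
  apply/integrableP; split; first by meas.
  under eq_integral do rewrite gee0_abs ?lee_fin//.
  by rewrite integral_lattice_kernel// ltry.
have ikv : mu.-integrable setT (fun sg => (kappa s sg * v (s, phi))%:E).
  by have := integrableZr measurableT (v (s, phi)) ik.
have ma : measurable_fun setT (fun sg => v (sg, phi) - v (s, phi)) by meas.
have dE : ((avg v s phi - v (s, phi))%:E =
    \int[mu]_sg (kappa s sg * (v (sg, phi) - v (s, phi)))%:E)%E.
  transitivity (\int[mu]_sg ((kappa s sg * v (sg, phi))%:E - (kappa s sg * v (s, phi))%:E))%E; last first.
    by apply: eq_integral => sg _; rewrite -EFinB -mulrBr.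
  rewrite integralB//= EFinB /avg fineK ?integrable_fin_num//; congr (_ - _)%E.
  under eq_integral do rewrite EFinM.
  by rewrite integralZr// integral_lattice_kernel// mul1e.
have le : (`|avg v s phi - v (s, phi)|%:E <=
    \int[mu]_sg (kappa s sg * `|v (sg, phi) - v (s, phi)|)%:E)%E.
  rewrite -abse_EFin dE; apply: le_trans.
    by apply: le_abse_integral => //; meas.
  by apply: le_ge0_integral => sg; rewrite ?abse_ge0//= normrM (ger0_norm (k0 _ _)).
have k1 : (\int[mu]_sg (kappa s sg)%:E <= 1)%E by rewrite integral_lattice_kernel.
apply: le_trans (@jensen_sqr_integral R _ _ mu _ _ mks ma (k0 s) k1).
by rewrite -real_normK ?num_real// expr2 EFinM lee_pmul// lee_fin.
Qed.

Lemma integral_avg_sub_sqr_le v : measurable_fun setT v ->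
  (forall phi, \int[mu]_sg `|v (sg, phi)|%:E < +oo)%E ->
  (norm_sq (fun z => avg v z.1 z.2 - v z)%R <= dispersion v)%E.
Proof.
move=> mv vfin; apply: le_ge0_integral => z; first by rewrite lee_fin sqr_ge0.
by have := @avg_sub_sqr_le v z.1 z.2 mv (vfin z.2); rewrite -surjective_pairing.
Qed.

Lemma measurable_avg v : measurable_fun setT v ->
  measurable_fun setT (fun z : R * R => avg v z.1 z.2).
Proof.
move=> mv; rewrite /avg; apply: measurable_fun_fine.
apply: measurable_fun_integral; apply: measurable_fun_EFin.
by apply: measurable_funM; [apply: mk2|]; meas.
Qed.

Lemma kernel_sqr_right v : measurable_fun setT v ->
  (\int[mu2]_z \int[mu]_sg (kappa z.1 sg * v z ^+ 2)%:E = norm_sq v)%E.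
Proof.
move=> mv; apply: eq_integral => z _; under eq_integral do rewrite EFinM.
rewrite ge0_integralZr//; last 3 first.
- by apply: measurable_fun_EFin; apply: mk2; meas.
- by move=> sg _; rewrite lee_fin.
- by rewrite lee_fin sqr_ge0.
by rewrite integral_lattice_kernel// mul1e.
Qed.

Lemma kernel_sqr_left v : measurable_fun setT v ->
  (\int[mu2]_z \int[mu]_sg (kappa z.1 sg * v (sg, z.2) ^+ 2)%:E = norm_sq v)%E.
Proof.
move=> mv.
rewrite -(ge0_swap_mu2 (F := fun x => (kappa x.1.1 x.2 * v (x.2, x.1.2) ^+ 2)%:E)); last 2 first.
- apply: measurable_fun_EFin; apply: measurable_funM; last by meas.
  by apply: mk2; meas.
- by move=> x; rewrite lee_fin mulr_ge0// sqr_ge0.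
apply: eq_integral => z _ /=; under eq_integral do rewrite EFinM.
rewrite ge0_integralZr//; last 3 first.
- by apply: measurable_fun_EFin; apply: mk2; meas.
- by move=> sg _; rewrite lee_fin.
- by rewrite lee_fin sqr_ge0.
by rewrite integral_lattice_kernel_left// mul1e -surjective_pairing.
Qed.

End Averaging.

(** * Pairing the averaging error with a function *)

Section Pairing.
Context {R : realType}.
Local Notation mu := (@lebesgue_measure R).
Local Notation mu3 := (@mu2_sf R \x mu)%E.
Variables (del c : R).
Hypothesis del0 : 0 < del.
Local Notation kappa := (lattice_kernel del c).

Lemma integrable_mul_norm_sq (u g : R * R -> R) :
  measurable_fun setT u -> measurable_fun setT g ->
  (norm_sq u < +oo)%E -> (norm_sq g < +oo)%E ->
  mu2.-integrable setT (fun z => (u z * g z)%:E).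
Proof.
move=> mu_ mg ufin gfin; apply/integrableP; split; first by meas.
apply: (@le_lt_trans _ _ (\int[mu2]_z ((u z ^+ 2)%:E + (g z ^+ 2)%:E))%E).
  apply: le_ge0_integral => z; first exact: abse_ge0.
  rewrite /= -EFinD lee_fin ler_norml.
  have := sqr_ge0 (u z - g z); have := sqr_ge0 (u z + g z).
  by move=> ? ?; apply/andP; split; nra.
rewrite ge0_integralD; last 5 first.
- exact: measurableT.
- by move=> x _; rewrite lee_fin sqr_ge0.
- by meas.
- by move=> x _; rewrite lee_fin sqr_ge0.
- by meas.
exact: lte_add_pinfty.
Qed.

Section Main.
Variables u g : R * R -> R.
Hypothesis mu_ : measurable_fun setT u.
Hypothesis mg : measurable_fun setT g.
Hypothesis ufin : (norm_sq u < +oo)%E.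
Hypothesis gfin : (norm_sq g < +oo)%E.

Let mk : measurable_fun setT (fun x : R * R * R => kappa x.1.1 x.2).
Proof.
apply: (measurableT_comp (measurable_lattice_kernel c del0)
  (g := fun x : R * R * R => (x.1.1, x.2))).
by meas.
Qed.

Let mk' : measurable_fun setT (fun x : R * R * R => kappa x.2 x.1.1).
Proof.
apply: (measurableT_comp (measurable_lattice_kernel c del0)
  (g := fun x : R * R * R => (x.2, x.1.1))).
by meas.
Qed.

Let k0 s sg : 0 <= kappa s sg. Proof. exact: lattice_kernel_ge0. Qed.

Let mus : measurable_fun setT (fun x : R * R * R => u (x.2, x.1.2)).
Proof. by meas. Qed.
Let mgs : measurable_fun setT (fun x : R * R * R => g (x.2, x.1.2)).
Proof. by meas. Qed.
Let mgl : measurable_fun setT (fun x : R * R * R => g x.1).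
Proof. by meas. Qed.

(** Serves for [g] at the first and at the second offset alike. The dominating function
    [kappa * (u ^ 2 + h ^ 2)] has integral [norm_sq u + norm_sq g]. *)
Let int_dom (h : R * R * R -> R) : measurable_fun setT h ->
  (\int[mu2]_z \int[mu]_sg (kappa z.1 sg * h (z, sg) ^+ 2)%:E = norm_sq g)%E ->
  mu3.-integrable setT (fun x => (kappa x.1.1 x.2 * u (x.2, x.1.2) * h x)%:E).
Proof.
move=> mh hg; apply/integrableP; split; first by meas.
rewrite tonelli_mu3; last 2 first.
- by apply: measurable_fun_EFin; meas.
- by move=> x; exact: abse_ge0.
apply: (@le_lt_trans _ _ (\int[mu2]_z \int[mu]_sg
   ((kappa z.1 sg * u (sg, z.2) ^+ 2)%:E + (kappa z.1 sg * h (z, sg) ^+ 2)%:E))%E).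
  apply: le_ge0_integral => z; first by apply: integral_ge0 => sg _; exact: abse_ge0.
  apply: le_ge0_integral => sg; first exact: abse_ge0.
  rewrite /= -EFinD lee_fin -mulrA normrM ger0_norm// -mulrDr.
  apply: ler_wpM2l => //; rewrite ler_norml.
  set a := u _; set b := h _.
  have := sqr_ge0 (a - b); have := sqr_ge0 (a + b).
  by move=> ? ?; apply/andP; split; nra.
rewrite (_ : (\int[mu2]_z _)%E = (norm_sq u + norm_sq g)%E).
  exact: lte_add_pinfty.
rewrite -(kernel_sqr_left c del0 mu_) -hg -ge0_integralD; last 5 first.
- exact: measurableT.
- by move=> z _; apply: integral_ge0 => sg _; rewrite lee_fin mulr_ge0// sqr_ge0.
- apply: measurable_fun_integral; apply: measurable_fun_EFin.
  by apply: measurable_funM; [exact: mk|meas].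
- by move=> z _; apply: integral_ge0 => sg _; rewrite lee_fin mulr_ge0// sqr_ge0.
- apply: measurable_fun_integral; apply: measurable_fun_EFin.
  apply: measurable_funM; [exact: mk|].
  apply: measurable_funX; apply: (measurableT_comp mh (g := fun x : R * R * R => (x.1, x.2))).
  by meas.
apply: eq_integral => z _; apply: ge0_integralD => //.
- by move=> sg _; rewrite lee_fin mulr_ge0// sqr_ge0.
- apply: measurable_fun_EFin; apply: measurable_funM; last by meas.
  by apply: (measurableT_comp mk (g := fun sg : R => (z, sg))); meas.
- by move=> sg _; rewrite lee_fin mulr_ge0// sqr_ge0.
- apply: measurable_fun_EFin; apply: measurable_funM; last by meas.
  by apply: (measurableT_comp mk (g := fun sg : R => (z, sg))); meas.
Qed.

Let F1 (x : R * R * R) : \bar R := (kappa x.1.1 x.2 * u (x.2, x.1.2) * g x.1)%:E.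
Let F2 (x : R * R * R) : \bar R :=
  (kappa x.1.1 x.2 * u (x.2, x.1.2) * g (x.2, x.1.2))%:E.

Let iF1 : mu3.-integrable setT F1.
Proof. exact: (@int_dom (fun x => g x.1) mgl (kernel_sqr_right c del0 mg)). Qed.

Let iF2 : mu3.-integrable setT F2.
Proof. exact: (@int_dom (fun x => g (x.2, x.1.2)) mgs (kernel_sqr_left c del0 mg)). Qed.

Let int_F1 : (\int[mu2]_z (avg del c u z.1 z.2 * g z)%:E = \int[mu3]_x F1 x)%E.
Proof.
rewrite -(integral12_prod_meas1 iF1).
pose a (z : R * R) (sg : R) := kappa z.1 sg * u (sg, z.2).
have ma : measurable_fun setT (fun x : R * R * R => a x.1 x.2).
  by apply: measurable_funM; [exact: mk|exact: mus].
apply: (@integral_fine_mul R _ _ _ _ mu2_sf mu a g ma mg).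
by have /integrable12ltyP := iF1; apply; exact: (measurable_int _ iF1).
Qed.

Let int_F2 : (\int[mu2]_z (u z * g z)%:E = \int[mu3]_x F2 x)%E.
Proof.
(* [F2] with its two offsets exchanged: the last variable now occurs in the kernel alone, which
   integrates to 1 in it. *)
pose F2' (x : R * R * R) : \bar R := (kappa x.2 x.1.1 * (u x.1 * g x.1))%:E.
have mF2' : measurable_fun setT F2'.
  apply: measurable_fun_EFin; apply: measurable_funM; first exact: mk'.
  by meas.
have iug := integrable_mul_norm_sq mu_ mg ufin gfin.
have k1 z : (\int[mu]_sg (kappa sg z.1)%:E = 1)%E by exact: integral_lattice_kernel_left.
have mkz (z : R * R) : measurable_fun setT (fun sg => (kappa sg z.1)%:E).
  apply: measurable_fun_EFin.
  by apply: (measurableT_comp mk' (g := fun sg : R => (z, sg))); meas.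
have iF2' : mu3.-integrable setT F2'.
  apply/integrable12ltyP => //.
  have /integrableP[_] := iug; apply: le_lt_trans.
  rewrite le_eqVlt; apply/orP; left; apply/eqP; apply: eq_integral => z _.
  under eq_integral do rewrite /F2' /= normrM (ger0_norm (k0 _ _)) EFinM.
  rewrite ge0_integralZr//; last 2 first.
  - exact: mkz.
  - by move=> sg _; rewrite lee_fin.
  by rewrite k1 mul1e.
transitivity (\int[mu3]_x F2' x)%E; last first.
  rewrite -[LHS](swap_mu3 mF2'); apply: eq_integral => x _.
  by rewrite /F2 /F2' /= -!mulrA.
rewrite -(integral12_prod_meas1 iF2'); apply: eq_integral => z _.
rewrite /fubini_F /F2' /=; under eq_integral do rewrite EFinM.
rewrite integralZr//; first by rewrite k1 mul1e.
apply/integrableP; split; first exact: mkz.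
by under eq_integral do rewrite gee0_abs ?lee_fin//; rewrite k1 ltry.
Qed.

(* [kappa] has integral 1 in each variable, so the difference [avg u - u] may be
   moved to [g]. *)
Lemma avg_pairing (M : R) : 0 <= M ->
  (norm_sq u * dispersion del c g <= (M ^+ 2)%:E)%E ->
  `|inner (fun z => avg del c u z.1 z.2 - u z) g| <= M.
Proof.
move=> M0 HM.
have iug := integrable_mul_norm_sq mu_ mg ufin gfin.
have mavg := measurable_avg c del0 mu_.
have iag : mu2.-integrable setT (fun z => (avg del c u z.1 z.2 * g z)%:E).
  apply/integrableP; split; first by apply: measurable_fun_EFin; meas.
  have /integrable12ltyP := iF1 => /(_ (measurable_int _ iF1)).
  apply: le_lt_trans; apply: le_ge0_integral => z; first exact: abse_ge0.
  have mkz : measurable_fun setT (fun sg : R => kappa z.1 sg * u (sg, z.2)).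
    apply: measurable_funM; last by meas.
    by apply: (measurableT_comp mk (g := fun sg : R => (z, sg))); meas.
  rewrite [leRHS](_ : _ = \int[mu]_sg (`|kappa z.1 sg * u (sg, z.2)|%:E * `|g z|%:E))%E; last first.
    by apply: eq_integral => sg _; rewrite -EFinM -normrM.
  rewrite ge0_integralZr//; last by meas.
  rewrite /= normrM EFinM; apply: lee_wpmul2r; first by rewrite lee_fin.
  apply: (@le_trans _ _ `|\int[mu]_sg (kappa z.1 sg * u (sg, z.2))%:E|%E).
    by rewrite /avg; case: (\int[mu]_sg _)%E => //=; rewrite normr0 leey.
  by apply: le_abse_integral => //; meas.
have -> : inner (fun z => avg del c u z.1 z.2 - u z) g =
    fine (\int[mu3]_x (F1 x - F2 x)).
  rewrite /inner /Rintegral integralB// -int_F1 -int_F2 -integralB//.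
  by congr fine; apply: eq_integral => z _; rewrite mulrBl EFinB.
(* Cauchy-Schwarz with the kernel shared between the factors: the squares integrate to [norm_sq u]
   and to the dispersion of [g]. *)
pose a (x : R * R * R) : R := Num.sqrt (kappa x.1.1 x.2) * u (x.2, x.1.2).
pose b (x : R * R * R) : R := Num.sqrt (kappa x.1.1 x.2) * (g x.1 - g (x.2, x.1.2)).
have ma : measurable_fun setT a by rewrite /a; meas.
have mb : measurable_fun setT b by rewrite /b; meas.
have ab x : (F1 x - F2 x = (a x * b x)%:E)%E.
  rewrite -EFinB /a /b; congr EFin.
  rewrite -[in LHS](sqr_sqrtr (k0 x.1.1 x.2)); ring.
have CS := @cauchy_schwarz_integral R _ _ mu3 a b ma mb.
have na : (\int[mu3]_x (a x ^+ 2)%:E = norm_sq u)%E.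
  rewrite tonelli_mu3; last 2 first.
  - by meas.
  - by move=> x; rewrite lee_fin sqr_ge0.
  rewrite -(kernel_sqr_left c del0 mu_); apply: eq_integral => z _.
  by apply: eq_integral => sg _; rewrite /a exprMn sqr_sqrtr.
have nb : (\int[mu3]_x (b x ^+ 2)%:E = dispersion del c g)%E.
  rewrite tonelli_mu3; last 2 first.
  - by meas.
  - by move=> x; rewrite lee_fin sqr_ge0.
  apply: eq_integral => z _; apply: eq_integral => sg _.
  by rewrite /b exprMn sqr_sqrtr//= -[in LHS]sqrrN opprB.
rewrite na nb in CS; have {}CS := le_trans CS HM.
have ->: (\int[mu3]_x (F1 x - F2 x) = \int[mu3]_x (a x * b x)%:E)%E.
  by apply: eq_integral => x _; exact: ab.
have iab : mu3.-integrable setT (fun x => (a x * b x)%:E).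
  by have := integrableB measurableT iF1 iF2; apply: eq_integrable => // x _; rewrite -ab.
have le : (`|\int[mu3]_x (a x * b x)%:E| <= \int[mu3]_x `|a x * b x|%:E)%E.
  by apply: le_abse_integral => //; meas.
move: CS le; have := integrable_fin_num measurableT iab.
case: (\int[mu3]_x (a x * b x)%:E)%E => // r _.
case E : (\int[mu3]_x `|a x * b x|%:E)%E => [q||//].
  rewrite -EFinM !lee_fin /= => qM rq; apply: (le_trans rq).
  by rewrite -(@ler_pXn2r _ 2)// ?expr2 ?nnegrE// (le_trans _ rq).
by rewrite mulyy leye_eq.
Qed.

End Main.
End Pairing.

(** * The Radon transform on L2 and its adjoint *)

Section L2Facts.
Context {R : realType}.
Implicit Types (D : set (R * R)) (f : R * R -> R).

Lemma sqr_normL2 f : (normL2 f * normL2 f = norm_sq f)%E.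
Proof. exact: sqr_Lnorm2. Qed.

Lemma normL2_ge0 f : (0 <= normL2 f)%E.
Proof. exact: Lnorm_ge0. Qed.

Lemma normL2_lty f : (normL2 f < +oo)%E <-> (norm_sq f < +oo)%E.
Proof.
rewrite -sqr_normL2; have := normL2_ge0 f.
by case: (normL2 f) => [r|_|//]; rewrite ?mulyy -?EFinM ?ltry.
Qed.

Lemma L2P D f : L2 D f <->
  [/\ measurable_fun setT f, (norm_sq f < +oo)%E & forall x, ~ D x -> f x = 0].
Proof.
split.
  move=> [+ f0]; rewrite inE => /andP[]; rewrite !inE /= /finite_norm => mf fN.
  by split=> //; apply/normL2_lty.
move=> [mf fN f0]; split; last exact: f0.
rewrite inE; apply/andP; split; rewrite inE/=; first exact: mf.
by rewrite /finite_norm; apply/normL2_lty.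
Qed.

Lemma normL2_le f (M : R) : 0 <= M ->
  (normL2 f <= M%:E)%E <-> (norm_sq f <= (M ^+ 2)%:E)%E.
Proof.
move=> M0; rewrite -sqr_normL2; have := normL2_ge0 f.
case: (normL2 f) => [r|_|//]; last by rewrite mulyy !leye_eq.
by rewrite -EFinM !lee_fin -expr2 => r0; rewrite ler_pXn2r.
Qed.

End L2Facts.

Section Radon.
Context {R : realType}.
Local Notation mu := (@lebesgue_measure R).
Variable A : set R.
Hypothesis mA : measurable A.
Hypothesis A_pi : forall phi, A phi -> - pi <= phi < pi.
Implicit Types f g : R * R -> R.

Lemma indic_le_circle phi : ((\1_A phi)%:E <= circle phi)%E.
Proof.
rewrite indicE lee_fin ler_nat; case: (boolP (phi \in A)) => // /set_mem/A_pi.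
by move=> ->.
Qed.

Lemma measurable_indic_A : measurable_fun setT (\1_A : R -> R).
Proof. exact: measurable_indic. Qed.

Lemma xray_eq0 f s phi : (forall x, ~ Omega x -> f x = 0) -> 1 <= `|s| ->
  xray f s phi = 0.
Proof.
move=> fO s1; rewrite /xray /line_integral integral0_eq//= => t _.
rewrite line_point_eq0//.
by have := sqr_ge0 t; rewrite -[s ^+ 2]real_normK ?num_real//; nra.
Qed.

(** Lines at offset [|s| >= 1] miss the disc, so of the cut-off to [OmegaA A] only the one in the
    angle remains, and shifts in [s] do not interfere with it. *)
Lemma radonE f : (forall x, ~ Omega x -> f x = 0) ->
  radon A f = fun z => \1_A z.2 * xray f z.1 z.2.
Proof.
move=> fO; apply/funext => -[s phi]; rewrite /radon /patch indicE/=.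
case: ifPn => [/set_mem[/= s1 Aphi]|sA].
  by rewrite mem_set// mul1r.
have [phiA|_] := boolP (phi \in A); last by rewrite mul0r.
rewrite mul1r xray_eq0// leNgt ltr_norml; apply/negP => s1.
move/negP: sA; apply; apply/mem_set; split => //=; last exact: set_mem.
Qed.

Section Bounded.
Variable f : R * R -> R.
Hypothesis mf : measurable_fun setT f.
Hypothesis fO : forall x, ~ Omega x -> f x = 0.
Hypothesis f_fin : (norm_sq f < +oo)%E.

Lemma measurable_radon : measurable_fun setT (radon A f).
Proof.
rewrite radonE//; have mx := measurable_xray mf; have mI := measurable_indic_A.
by meas.
Qed.

Lemma norm_sq_radon_le : (norm_sq (radon A f) <= (4 * pi)%:E * norm_sq f)%E.
Proof.
have mx := measurable_radon; have mc := @measurable_circle R.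
rewrite /norm_sq tonelli_mu2_swap; last 2 first.
- by meas.
- by move=> z; rewrite lee_fin sqr_ge0.
apply: (@le_trans _ _ (\int[mu]_phi (circle phi * (2%:E * norm_sq f)))%E).
  apply: le_ge0_integral => phi.
    by apply: integral_ge0 => s _; rewrite lee_fin sqr_ge0.
  apply: (@le_trans _ _ ((\1_A phi)%:E * \int[mu]_s (xray f s phi ^+ 2)%:E)%E).
    rewrite -ge0_integralZl//; last 2 first.
    - by rewrite /xray /line_integral; meas.
    - by move=> s _; rewrite lee_fin sqr_ge0.
    apply: le_ge0_integral => s; first by rewrite lee_fin sqr_ge0.
    rewrite radonE// -EFinM lee_fin exprMn indicE /=.
    by case: (_ \in _); rewrite ?expr1n// expr0n.
  apply: lee_pmul.
  - by rewrite lee_fin.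
  - by apply: integral_ge0 => s _; rewrite lee_fin sqr_ge0.
  - exact: indic_le_circle.
  - exact: integral_xray_sqr.
rewrite ge0_integralZr//; last 2 first.
- by move=> phi _; exact: circle_ge0.
- by rewrite mule_ge0// norm_sq_ge0.
rewrite integral_circle muleA -EFinM.
by have -> : 2 * pi * 2 = 4 * pi :> R by ring.
Qed.

Lemma integral_abs_radon_lty phi : (\int[mu]_s `|radon A f (s, phi)|%:E < +oo)%E.
Proof.
apply: le_lt_trans (integral_abs_line_integral_lty mf fO f_fin phi).
apply: le_ge0_integral => s; first by rewrite lee_fin.
rewrite radonE//=; apply: le_trans (xray_abs_le s phi mf).
rewrite lee_fin normrM indicE; case: (_ \in _).
  by rewrite normr1 mul1r.
by rewrite normr0 mul0r.
Qed.

Let fp (x : R * R) : R := Num.max (f x) 0.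
Let fm (x : R * R) : R := Num.max (- f x) 0.

Let fp0 x : 0 <= fp x. Proof. by rewrite le_max lexx orbT. Qed.
Let fm0 x : 0 <= fm x. Proof. by rewrite le_max lexx orbT. Qed.

Let mfp : measurable_fun setT fp.
Proof.
have -> : fp = (fun x => (0 <= f x)%R%:R * f x).
  by apply/funext => x; rewrite /fp; case: leP => _; rewrite ?mul1r ?mul0r.
by meas.
Qed.

Let mfm : measurable_fun setT fm.
Proof.
have -> : fm = (fun x => (0 <= - f x)%R%:R * (- f x)).
  by apply/funext => x; rewrite /fm; case: leP => _; rewrite ?mul1r ?mul0r.
by meas.
Qed.

Let fp_le x : fp x <= `|f x|.
Proof. by rewrite ge_max ler_norm normr_ge0. Qed.
Let fm_le x : fm x <= `|f x|.
Proof. by rewrite ge_max -normrN ler_norm normr_ge0. Qed.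

Let norm_sq_le_abs (g : R * R -> R) : (forall x, 0 <= g x) ->
  (forall x, g x <= `|f x|) -> (norm_sq g <= norm_sq f)%E.
Proof.
move=> g0 gf; apply: le_ge0_integral => x; first by rewrite lee_fin sqr_ge0.
by rewrite lee_fin -[leRHS]real_normK ?num_real// ler_pXn2r ?nnegrE.
Qed.

Let fpO x : ~ Omega x -> fp x = 0.
Proof. by move=> /fO fx; rewrite /fp fx maxxx. Qed.
Let fmO x : ~ Omega x -> fm x = 0.
Proof. by move=> /fO fx; rewrite /fm fx oppr0 maxxx. Qed.

Let xray_split s phi : abs_line_integral f s phi \is a fin_num ->
  xray f s phi = xray fp s phi - xray fm s phi.
Proof.
move=> Lfin; rewrite /xray.
have le_fin (g : R * R -> R) : (forall x, 0 <= g x) ->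
    (forall x, g x <= `|f x|) -> line_integral g s phi \is a fin_num.
  move=> g0 gf; rewrite ge0_fin_numE; last first.
    by apply: integral_ge0 => t _; rewrite lee_fin.
  apply: (@le_lt_trans _ _ (abs_line_integral f s phi)).
    by apply: le_ge0_integral => t; rewrite lee_fin.
  by rewrite -ge0_fin_numE// abs_line_integral_ge0.
rewrite -fineB; [|exact: le_fin..].
congr fine; rewrite /line_integral [LHS]integralE.
by congr (_ - _)%E; apply: eq_integral => t _; rewrite unlock /= EFin_max.
Qed.

Lemma xray_shift_sqr_le (phi h : R) :
  (\int[mu]_s ((xray f (s + h) phi - xray f s phi) ^+ 2)%:E <=
   2%:E * \int[mu]_s ((xray fp (s + h) phi - xray fp s phi) ^+ 2)%:E +
   2%:E * \int[mu]_s ((xray fm (s + h) phi - xray fm s phi) ^+ 2)%:E)%E.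
Proof.
have mD (g : R * R -> R) : measurable_fun setT g ->
    measurable_fun setT (fun s : R => ((xray g (s + h) phi - xray g s phi) ^+ 2)%:E).
  by move=> mg; rewrite /xray /line_integral; meas.
have mDp := mD _ mfp; have mDm := mD _ mfm; have mDf := mD _ mf.
rewrite -!ge0_integralZl//; [|by move=> s _; rewrite lee_fin sqr_ge0..].
rewrite -ge0_integralD//; last 4 first.
- by move=> s _; rewrite mule_ge0// lee_fin sqr_ge0.
- by meas.
- by move=> s _; rewrite mule_ge0// lee_fin sqr_ge0.
- by meas.
apply: ae_ge0_le_integral => //.
- by move=> s _; rewrite lee_fin sqr_ge0.
- by move=> s _; rewrite adde_ge0// mule_ge0// lee_fin sqr_ge0.
- by meas.
have FF : Filter (nbhs (almost_everywhere mu)) := ae_filter_ringOfSetsType mu.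
have A1 := ae_abs_line_integral_lty mf fO f_fin phi h.
have A2 := ae_abs_line_integral_lty mf fO f_fin phi 0.
apply: filterS2 A1 A2 => s + + _; rewrite addr0.
move=> /xray_split -> /xray_split ->; rewrite -!EFinM -EFinD lee_fin.
set a := xray fp _ _; set b := xray fp _ _; set c := xray fm _ _; set d := xray fm _ _.
by have := sqr_ge0 ((a - b) + (c - d)); nra.
Qed.

(** The positive and the negative part each contribute [16 * pi], doubled by
    [(a - b) ^ 2 <= 2 * a ^ 2 + 2 * b ^ 2]. *)
Lemma shift_sq_radon_le (h : R) :
  (shift_sq (radon A f) h <= (64 * pi * `|h|)%:E * norm_sq f)%E.
Proof.
have mx := measurable_radon; have mc := @measurable_circle R.
pose W (g : R * R -> R) phi : \bar R :=
  (\int[mu]_s ((xray g (s + h) phi - xray g s phi) ^+ 2)%:E)%E.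
have W0 g phi : (0 <= W g phi)%E.
  by apply: integral_ge0 => s _; rewrite lee_fin sqr_ge0.
have mW g : measurable_fun setT g -> measurable_fun setT (W g).
  by move=> mg; rewrite /W /xray /line_integral; meas.
have mWp := mW _ mfp; have mWm := mW _ mfm.
rewrite /shift_sq tonelli_mu2_swap; last 2 first.
- by meas.
- by move=> z; rewrite lee_fin sqr_ge0.
apply: (@le_trans _ _ (\int[mu]_phi (2%:E * (circle phi * W fp phi) + 2%:E * (circle phi * W fm phi)))%E).
  apply: le_ge0_integral => phi.
    by apply: integral_ge0 => s _; rewrite lee_fin sqr_ge0.
  apply: (@le_trans _ _ ((\1_A phi)%:E * W f phi)%E).
    rewrite /W -ge0_integralZl//; last 2 first.
    - by rewrite /xray /line_integral; meas.
    - by move=> s _; rewrite lee_fin sqr_ge0.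
    apply: le_ge0_integral => s; first by rewrite lee_fin sqr_ge0.
    rewrite radonE// -EFinM lee_fin -mulrBr exprMn indicE /=.
    by case: (_ \in _); rewrite ?expr1n// expr0n.
  rewrite (muleCA 2%:E _ (W fp phi)) (muleCA 2%:E _ (W fm phi)) -ge0_muleDr; [|by apply: mule_ge0; [rewrite lee_fin|exact: W0]..].
  apply: lee_pmul.
  - by rewrite lee_fin.
  - exact: W0.
  - exact: indic_le_circle.
  - exact: xray_shift_sqr_le.
have cW0 g phi : (0 <= circle phi * W g phi)%E.
  by apply: mule_ge0; [exact: circle_ge0|exact: W0].
have mcp : measurable_fun setT (fun phi => circle phi * W fp phi)%E.
  exact: emeasurable_funM mc mWp.
have mcm : measurable_fun setT (fun phi => circle phi * W fm phi)%E.
  exact: emeasurable_funM mc mWm.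
have two0 : (0 <= 2%:E :> \bar R)%E by rewrite lee_fin.
rewrite (ge0_integralD _ measurableT); last 4 first.
- by move=> phi _; apply: mule_ge0.
- exact: emeasurable_funM (measurable_cst _) mcp.
- by move=> phi _; apply: mule_ge0.
- exact: emeasurable_funM (measurable_cst _) mcm.
rewrite [X in (X + _)%E]ge0_integralZl; [|exact: measurableT|exact: mcp|by move=> phi _; exact: cW0|exact: two0].
rewrite [X in (_ + X)%E]ge0_integralZl; [|exact: measurableT|exact: mcm|by move=> phi _; exact: cW0|exact: two0].
have Wle g : measurable_fun setT g -> (forall x, 0 <= g x) ->
    (forall x, ~ Omega x -> g x = 0) -> (forall x, g x <= `|f x|) ->
    (\int[mu]_phi (circle phi * W g phi) <= (16 * pi * `|h|)%:E * norm_sq f)%E.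
  move=> mg g0 gO gf; apply: (le_trans (xray_modulus_ge0 mg g0 gO _ h)).
    exact: le_lt_trans (norm_sq_le_abs g0 gf) f_fin.
  rewrite lee_wpmul2l ?norm_sq_le_abs// lee_fin !mulr_ge0//.
  exact: pi_ge0.
have H1 := Wle _ mfp fp0 fpO fp_le; have H2 := Wle _ mfm fm0 fmO fm_le.
apply: (le_trans (leeD (lee_wpmul2l two0 H1) (lee_wpmul2l two0 H2))).
rewrite muleA -ge0_muleDl ?norm_sq_ge0//.
- by rewrite -!EFinM -EFinD lee_wpmul2r ?norm_sq_ge0// lee_fin; lra.
- by rewrite -EFinM lee_fin !mulr_ge0// pi_ge0.
- by rewrite -EFinM lee_fin !mulr_ge0// pi_ge0.
Qed.

End Bounded.

End Radon.

Local Notation dot_angle x phi := (x.1 * cos phi + x.2 * sin phi).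

(** * Backprojection and the adjoint of the Radon transform *)

Section Backprojection.
Context {R : realType}.
Local Notation mu := (@lebesgue_measure R).
Local Notation mu3 := (@mu2_sf R \x mu)%E.

Lemma dot_line_point (s phi t : R) :
  dot_angle (line_point s phi t) phi = s.
Proof.
rewrite /=; have -> : (s * cos phi - t * sin phi) * cos phi +
    (s * sin phi + t * cos phi) * sin phi = s * (cos phi ^+ 2 + sin phi ^+ 2).
  by ring.
by rewrite cos2Dsin2 mulr1.
Qed.

(** At each fixed angle the passage from line coordinates to the point of the plane is a
    rotation. *)
Lemma ge0_integral_line_point_angle (F : R * R * R -> \bar R) :
  measurable_fun setT F -> (forall x, (0 <= F x)%E) ->
  (\int[mu2]_z \int[mu]_t F (line_point z.1 z.2 t, z.2) =
   \int[mu2]_x \int[mu]_phi F (x, phi))%E.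
Proof.
move=> mF F0; rewrite tonelli_mu2_swap; last 2 first.
- by meas.
- by move=> z; apply: integral_ge0.
rewrite (tonelli_swap_mu2 (f := fun x phi => F (x, phi)))//; last by meas.
apply: eq_integral => phi _ /=.
rewrite -(ge0_integral_rotation (f := fun x => F (x, phi)) (cos2Dsin2 phi))//; last by meas.
by rewrite tonelli_mu2//; meas.
Qed.

Lemma integral_line_point_angle (F : R * R * R -> \bar R) :
  measurable_fun setT F ->
  (\int[mu3]_x F (line_point x.1.1 x.1.2 x.2, x.1.2) = \int[mu3]_x F x)%E.
Proof.
move=> mF.
apply: (@integral_signed_transfer R _ _ _ _ mu3 mu3
  (fun x => (line_point x.1.1 x.1.2 x.2, x.1.2))) => // {mF}F mF F0.
rewrite tonelli_mu3//; last by meas.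
by rewrite tonelli_mu3// -ge0_integral_line_point_angle.
Qed.

Lemma Omega_measurable : measurable (@Omega R).
Proof.
have mO : measurable_fun setT (fun x : R * R => x.1 ^+ 2 + x.2 ^+ 2 < 1).
  by meas.
have := mO measurableT [set true] I.
rewrite setTI; congr measurable.
Qed.

(** In line coordinates the integrand is constant along the line, and the points of the disc on a
    line have parameters in [[-1, 1]]: hence the factor 2. *)
Lemma ge0_integral_Omega_dot (G : R * R -> \bar R) :
  measurable_fun setT G -> (forall x, (0 <= G x)%E) ->
  (\int[mu2]_x \int[mu]_phi ((\1_Omega x)%:E * G (dot_angle x phi, phi)) <=
   2%:E * \int[mu2]_z G z)%E.
Proof.
move=> mG G0.
have mO : measurable_fun setT (\1_Omega : R * R -> R).
  by apply: measurable_indic; exact: Omega_measurable.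
rewrite -(ge0_integral_line_point_angle
  (F := fun y => ((\1_Omega y.1)%:E * G (dot_angle y.1 y.2, y.2))%E)); last 2 first.
- by meas.
- by move=> y; rewrite mule_ge0// lee_fin.
rewrite -ge0_integralZl//.
apply: le_ge0_integral => z.
  by apply: integral_ge0 => t _; rewrite mule_ge0// lee_fin.
apply: (@le_trans _ _ (\int[mu]_t ((-1 <= t <= 1)%R%:R%:E * G z))%E).
  apply: le_ge0_integral => t; first by rewrite mule_ge0// lee_fin.
  rewrite dot_line_point -surjective_pairing lee_wpmul2r// lee_fin indicE ler_nat.
  case: (boolP (_ \in _)) => // /set_mem/Omega_line_point zt.
  have -> : -1 <= t <= 1.
    by have := sqr_ge0 z.1; move=> z0; apply/andP; split; nra.
  by [].
rewrite ge0_integralZr//; last by meas.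
rewrite integral_itv_ind; last by lra.
by rewrite lee_wpmul2r// lee_fin; lra.
Qed.

Variable A : set R.
Hypothesis A_pi : forall phi, A phi -> - pi <= phi < pi.

Section Adjoint.
Variable g : R * R -> R.
Hypothesis mg : measurable_fun setT g.
Hypothesis gA : forall x, ~ OmegaA A x -> g x = 0.
Hypothesis g_fin : (norm_sq g < +oo)%E.

(** The angle runs over the whole line because the restriction to [A] is carried by [g], which
    vanishes outside [OmegaA A]. *)
Definition backprojection (x : R * R) : R :=
  \1_Omega x * fine (\int[mu]_phi (g (dot_angle x phi, phi))%:E)%E.

Let g_circle s phi : `|g (s, phi)| = (- pi <= phi < pi)%R%:R * `|g (s, phi)|.
Proof.
have [Aphi|nA] := pselect (A phi); first by rewrite A_pi// mul1r.
by rewrite gA ?normr0 ?mulr0// => -[].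
Qed.

Let mO : measurable_fun setT (\1_Omega : R * R -> R).
Proof. by apply: measurable_indic; exact: Omega_measurable. Qed.

Let gsq_dot_fin :
  (\int[mu2]_x \int[mu]_phi ((\1_Omega x)%:E * (g (dot_angle x phi, phi) ^+ 2)%:E)
   <= 2%:E * norm_sq g)%E.
Proof.
apply: (ge0_integral_Omega_dot (G := fun z => (g z ^+ 2)%:E)); first by meas.
by move=> z; rewrite lee_fin sqr_ge0.
Qed.

(** Cauchy-Schwarz against the indicator of one period bounds the square by [2 * pi] times the
    backprojection of [g ^ 2], which is integrable over the disc. *)
Lemma L2_backprojection : L2 Omega backprojection.
Proof.
apply/L2P; split; last first.
- by move=> x xO; rewrite /backprojection indicE memNset// mul0r.
- apply: (@le_lt_trans _ _ ((2 * pi)%:E * (2%:E * norm_sq g))%E); last first.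
    rewrite muleA -EFinM lte_mul_pinfty// lee_fin !mulr_ge0// pi_ge0//.
  apply: le_trans (lee_wpmul2l _ gsq_dot_fin); last first.
    by rewrite lee_fin mulr_ge0// pi_ge0.
  rewrite -ge0_integralZl//; last 3 first.
  - by meas.
  - by move=> x _; apply: integral_ge0 => phi _; rewrite mule_ge0// lee_fin ?sqr_ge0.
  - by rewrite lee_fin mulr_ge0// pi_ge0.
  apply: le_ge0_integral => x; first by rewrite lee_fin sqr_ge0.
  rewrite /backprojection indicE; case: (x \in Omega); last first.
    rewrite mul0r expr0n/= mule_ge0// ?lee_fin ?mulr_ge0 ?pi_ge0//.
    by apply: integral_ge0 => phi _; rewrite mul0e.
  rewrite (_ : true%:R = 1 :> R)// mul1r.
  rewrite [X in (_ <= _ * X)%E](_ : _ = \int[mu]_phi (g (dot_angle x phi, phi) ^+ 2)%:E)%E; last first.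
    by apply: eq_integral => phi _; rewrite mul1e.
  pose a (phi : R) : R := (- pi <= phi < pi)%R%:R.
  pose b (phi : R) := g (dot_angle x phi, phi).
  have ma : measurable_fun setT a by rewrite /a; meas.
  have mb : measurable_fun setT b by rewrite /b; meas.
  have CS := @cauchy_schwarz_integral R _ _ mu a b ma mb.
  have a2 : (\int[mu]_phi (a phi ^+ 2)%:E = (2 * pi)%:E)%E.
    rewrite -integral_circle; apply: eq_integral => phi _.
    by rewrite /a /circle -natrX; case: (_ && _).
  rewrite a2 in CS; apply: le_trans CS.
  have le : (`|fine (\int[mu]_phi (b phi)%:E)%E|%:E <= \int[mu]_phi `|a phi * b phi|%:E)%E.
    apply: (@le_trans _ _ `|\int[mu]_phi (b phi)%:E|%E).
      by case: (\int[mu]_phi _)%E => //=; rewrite normr0 leey.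
    apply: (@le_trans _ _ (\int[mu]_phi `|b phi|%:E)%E).
      by apply: le_abse_integral => //; meas.
    apply: le_ge0_integral => phi; first by rewrite lee_fin.
    by rewrite /a /b normrM normr_nat -g_circle.
  by rewrite -real_normK ?num_real// expr2 EFinM lee_pmul// lee_fin.
rewrite /backprojection; apply: measurable_funM; first exact: mO.
by meas.
Qed.

(** Both sides integrate the value of [f] at a point times that of [g] on a line through it, over
    points and angles. Fubini applies as the product is dominated by [f ^ 2] on one period plus
    [g ^ 2] on the disc. *)
Lemma radon_adjointE f : L2 Omega f ->
  inner (radon A f) g = inner f backprojection.
Proof.
move=> /L2P[mf f_fin fO].
pose F (y : R * R * R) : \bar R := (f y.1 * g (dot_angle y.1 y.2, y.2))%:E.
have mF : measurable_fun setT F by rewrite /F; meas.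
have Ffin : (\int[mu2]_x \int[mu]_phi `|F (x, phi)| < +oo)%E.
  apply: (@le_lt_trans _ _ (\int[mu2]_x \int[mu]_phi
    ((circle phi * (f x ^+ 2)%:E) +
     (\1_Omega x)%:E * (g (dot_angle x phi, phi) ^+ 2)%:E))%E).
    apply: le_ge0_integral => x; first by apply: integral_ge0 => phi _; exact: abse_ge0.
    apply: le_ge0_integral => phi; first exact: abse_ge0.
    rewrite /F /= normrM g_circle /circle -!EFinM -EFinD lee_fin indicE.
    have [xO|xO] := pselect (Omega x); last first.
      by rewrite fO// normr0 mul0r addr_ge0// mulr_ge0 ?sqr_ge0.
    rewrite mem_set// mul1r; case: (_ <= phi < _); last first.
      by rewrite !mul0r mulr0 add0r sqr_ge0.
    rewrite !mul1r -[f x ^+ 2]real_normK ?num_real// -[g _ ^+ 2]real_normK ?num_real//.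
    set a := `|f x|; set b := `|g _|.
    by have := sqr_ge0 (a - b); have := normr_ge0 (f x); have := normr_ge0 (g (dot_angle x phi, phi)); nra.
  have mc := @measurable_circle R.
  rewrite (_ : (\int[mu2]_x _)%E = ((2 * pi)%:E * norm_sq f + \int[mu2]_x \int[mu]_phi
     ((\1_Omega x)%:E * (g (dot_angle x phi, phi) ^+ 2)%:E))%E).
    apply: lte_add_pinfty.
      by rewrite lte_mul_pinfty// lee_fin mulr_ge0// pi_ge0.
    by apply: (le_lt_trans gsq_dot_fin); rewrite lte_mul_pinfty.
  have -> : ((2 * pi)%:E * norm_sq f = \int[mu2]_x \int[mu]_phi (circle phi * (f x ^+ 2)%:E))%E.
    rewrite -ge0_integralZl//; last 3 first.
    - by meas.
    - by move=> x _; rewrite lee_fin sqr_ge0.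
    - by rewrite lee_fin mulr_ge0// pi_ge0.
    apply: eq_integral => x _; rewrite ge0_integralZr//.
    - by rewrite integral_circle.
    - by move=> phi _; exact: circle_ge0.
    - by rewrite lee_fin sqr_ge0.
  rewrite -ge0_integralD; last 5 first.
  - exact: measurableT.
  - by move=> x _; apply: integral_ge0 => phi _; rewrite mule_ge0 ?circle_ge0// lee_fin sqr_ge0.
  - by meas.
  - by move=> x _; apply: integral_ge0 => phi _; rewrite mule_ge0// lee_fin// sqr_ge0.
  - by meas.
  apply: eq_integral => x _; apply: ge0_integralD => //.
  - by move=> phi _; rewrite mule_ge0 ?circle_ge0// lee_fin sqr_ge0.
  - by meas.
  - by move=> phi _; rewrite mule_ge0// lee_fin// sqr_ge0.
  - by meas.
have iF : mu3.-integrable setT F.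
  by apply/integrable12ltyP; [exact: mF|exact: Ffin].
have iFpsi : mu3.-integrable setT (fun y => F (line_point y.1.1 y.1.2 y.2, y.1.2)).
  apply/integrable12ltyP; first by rewrite /F; meas.
  rewrite (ge0_integral_line_point_angle (F := fun y => `|F y|%E)).
  - exact: Ffin.
  - exact: (measurableT_comp _ mF).
  - by move=> y; exact: abse_ge0.
rewrite /inner /Rintegral; congr fine.
transitivity (\int[mu2]_z (fine (line_integral f z.1 z.2) * g z)%:E)%E.
  apply: eq_integral => -[s phi] _; rewrite radonE//= indicE.
  have [Aphi|nA] := pselect (A phi); first by rewrite mem_set// mul1r.
  by rewrite (gA (x := (s, phi))) ?mulr0// => -[].
rewrite [LHS](@integral_fine_mul R _ _ _ _ mu2_sf mu (fun z t => f (line_point z.1 z.2 t)) g); last 3 first.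
- by meas.
- exact: mg.
- have /integrable12ltyP := iFpsi => /(_ (measurable_int _ iFpsi)).
  apply: le_lt_trans; apply: le_ge0_integral => z; first by apply: integral_ge0 => t _; rewrite lee_fin.
  apply: le_ge0_integral => t; first by rewrite lee_fin.
  by rewrite /F dot_line_point -surjective_pairing.
transitivity (\int[mu3]_y F (line_point y.1.1 y.1.2 y.2, y.1.2))%E.
  rewrite -(integral12_prod_meas1 iFpsi); apply: eq_integral => z _.
  apply: eq_integral => t _.
  by rewrite /F dot_line_point -surjective_pairing.
rewrite (integral_line_point_angle mF) -(integral12_prod_meas1 iF).
transitivity (\int[mu2]_x (fine (\int[mu]_phi (g (dot_angle x phi, phi))%:E) * f x)%:E)%E.
  rewrite [RHS](@integral_fine_mul R _ _ _ _ mu2_sf mu (fun x phi => g (dot_angle x phi, phi)) f); last 3 first.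
  - by meas.
  - exact: mf.
  - have /integrable12ltyP := iF => /(_ mF); apply: le_lt_trans.
    apply: le_ge0_integral => z; first by apply: integral_ge0 => t _; rewrite lee_fin.
    apply: le_ge0_integral => t; first by rewrite lee_fin.
    by rewrite /F mulrC.
  by apply: eq_integral => x _; apply: eq_integral => phi _; rewrite /F mulrC.
apply: eq_integral => x _; rewrite /backprojection mulrC; congr EFin.
have [xO|xO] := pselect (Omega x); first by rewrite indicE mem_set// mul1r.
by rewrite fO// !mul0r.
Qed.

End Adjoint.
End Backprojection.

(** * Integrals over strips *)

Section Strip.
Context {R : realType}.
Local Notation mu := (@lebesgue_measure R).

Definition strip (b s phi : R) (x : R * R) : R :=
  (`|dot_angle x phi - s| <= b)%R%:R.

Lemma integral_strip_ind (b a : R) : 0 <= b ->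
  (\int[mu]_s (`|a - s| <= b)%R%:R%:E = (2 * b)%:E)%E.
Proof.
move=> b0; have -> : 2 * b = (a + b) - (a - b) by ring.
rewrite -integral_itv_ind; last by lra.
apply: eq_integral => s _; congr (_%:R%:E); congr nat_of_bool.
by rewrite ler_norml; apply/andP/andP => -[? ?]; split; lra.
Qed.

Let mO : measurable_fun setT (\1_Omega : R * R -> R).
Proof. by apply: measurable_indic; exact: Omega_measurable. Qed.

(** In rotated coordinates the part of the strip in the disc lies in a rectangle of length 2 and
    width [2 * b]. *)
Lemma integral_Omega_strip (b s phi : R) : 0 <= b ->
  (\int[mu2]_x (\1_Omega x * strip b s phi x)%:E <= (4 * b)%:E)%E.
Proof.
move=> b0.
rewrite -(ge0_integral_rotation (f := fun x => (\1_Omega x * strip b s phi x)%:E)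
  (cos2Dsin2 phi)); last 2 first.
- by rewrite /strip; meas.
- by move=> x; rewrite lee_fin mulr_ge0// ler0n.
rewrite tonelli_mu2; last 2 first.
- by rewrite /strip; meas.
- by move=> x; rewrite lee_fin mulr_ge0// ler0n.
apply: (@le_trans _ _ (\int[mu]_sg (2%:E * (`|s - sg| <= b)%R%:R%:E))%E).
  apply: le_ge0_integral => sg.
    by apply: integral_ge0 => t _; rewrite lee_fin mulr_ge0// ler0n.
  apply: (@le_trans _ _ (\int[mu]_t ((-1 <= t <= 1)%R%:R%:E * (`|s - sg| <= b)%R%:R%:E))%E).
    apply: le_ge0_integral => t; first by rewrite lee_fin mulr_ge0// ler0n.
    rewrite -EFinM lee_fin /strip (dot_line_point sg phi t) distrC /=.
    apply: ler_wpM2r => //; rewrite indicE ler_nat.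
    case: (boolP (_ \in _)) => // /set_mem/Omega_line_point zt.
    have -> : -1 <= t <= 1.
      by have := sqr_ge0 sg; move=> z0; apply/andP; split; nra.
    by [].
  rewrite ge0_integralZr//; last by meas.
  rewrite integral_itv_ind; last by lra.
  by apply: lee_wpmul2r; rewrite lee_fin ?ler0n//; lra.
rewrite ge0_integralZl//; last by meas.
by rewrite integral_strip_ind// -EFinM lee_fin; lra.
Qed.

Variable f : R * R -> R.
Hypothesis mf : measurable_fun setT f.
Hypothesis fO : forall x, ~ Omega x -> f x = 0.

Lemma integral_strip_sqr (b s phi : R) : 0 <= b ->
  ((\int[mu2]_x (strip b s phi x * `|f x|)%:E) *
   (\int[mu2]_x (strip b s phi x * `|f x|)%:E) <=
   (4 * b)%:E * \int[mu2]_x (strip b s phi x * f x ^+ 2)%:E)%E.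
Proof.
move=> b0; pose a (x : R * R) : R := \1_Omega x * strip b s phi x.
pose g x := strip b s phi x * f x.
have ma : measurable_fun setT a by rewrite /a /strip; meas.
have mg : measurable_fun setT g by rewrite /g /strip; meas.
have st x : strip b s phi x ^+ 2 = strip b s phi x.
  by rewrite /strip -natrX; case: (_ <= _).
have st0 x : 0 <= strip b s phi x by rewrite ler0n.
have agE x : `|a x * g x| = strip b s phi x * `|f x|.
  have -> : a x * g x = \1_Omega x * (strip b s phi x * f x).
    by rewrite -[in RHS]st /a /g; ring.
  have [xO|xO] := pselect (Omega x).
    by rewrite indicE mem_set// mul1r normrM ger0_norm.
  by rewrite fO// !mulr0 normr0 mulr0.
have CS := @cauchy_schwarz_integral R _ _ mu2 a g ma mg.
have -> : (\int[mu2]_x (strip b s phi x * `|f x|)%:E = \int[mu2]_x `|a x * g x|%:E)%E.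
  by apply: eq_integral => x _; rewrite agE.
apply: (le_trans CS); apply: lee_pmul.
- by apply: integral_ge0 => x _; rewrite lee_fin sqr_ge0.
- by apply: integral_ge0 => x _; rewrite lee_fin sqr_ge0.
- apply: le_trans (integral_Omega_strip s phi b0).
  apply: le_ge0_integral => x; first by rewrite lee_fin sqr_ge0.
  rewrite lee_fin /a exprMn st; apply: ler_wpM2r => //.
  by rewrite indicE -natrX; case: (_ \in _).
- apply: le_ge0_integral => x; first by rewrite lee_fin sqr_ge0.
  by rewrite lee_fin /g exprMn st.
Qed.

(** Cauchy-Schwarz on the strip gives [4 * b]; exchanging the integrals gives [2 * b] from the
    offsets whose strip contains a given point, and [2 * pi] from the angles. The resulting order
    [K * b] of the norm compensates one of the two factors [1 / ds] in the kernel error. *)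
Lemma norm_sq_strip_le (b : R) (D : R * R -> R) (K : R) :
  0 <= b -> 0 <= K ->
  (forall s phi, ~ (- pi <= phi < pi) -> D (s, phi) = 0) ->
  (forall s phi, `|D (s, phi)|%:E <=
     K%:E * \int[mu2]_x (strip b s phi x * `|f x|)%:E)%E ->
  measurable_fun setT D ->
  (norm_sq D <= (K ^+ 2 * (16 * pi * b ^+ 2))%:E * norm_sq f)%E.
Proof.
move=> b0 K0 D0 DK mD; have mc := @measurable_circle R.
have st0 s phi x : 0 <= strip b s phi x by rewrite ler0n.
have K1 : (0 <= (K ^+ 2 * (4 * b))%:E)%E by rewrite lee_fin mulr_ge0 ?sqr_ge0// mulr_ge0.
pose G (phi s : R) (x : R * R) : \bar R :=
  (circle phi * (strip b s phi x * f x ^+ 2)%:E)%E.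
have G0 phi s x : (0 <= G phi s x)%E.
  by rewrite mule_ge0 ?circle_ge0// lee_fin mulr_ge0// sqr_ge0.
rewrite /norm_sq tonelli_mu2_swap; last 2 first.
- by meas.
- by move=> x; rewrite lee_fin sqr_ge0.
apply: (@le_trans _ _ (\int[mu]_phi \int[mu]_s
    ((K ^+ 2 * (4 * b))%:E * \int[mu2]_x G phi s x))%E).
  apply: le_ge0_integral => phi.
    by apply: integral_ge0 => s _; rewrite lee_fin sqr_ge0.
  apply: le_ge0_integral => s; first by rewrite lee_fin sqr_ge0.
  case: (boolP (- pi <= phi < pi)) => phipi; last first.
    rewrite D0; last exact/negP.
    rewrite expr0n/= mule_ge0//; apply: integral_ge0 => x _; exact: G0.
  have -> : (\int[mu2]_x G phi s x = \int[mu2]_x (strip b s phi x * f x ^+ 2)%:E)%E.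
    apply: eq_integral => x _; rewrite /G /circle phipi.
    by rewrite (_ : true%:R = 1 :> R)// mul1e.
  rewrite [(K ^+ 2 * (4 * b))%:E]EFinM -muleA; apply: le_trans (lee_wpmul2l _ (integral_strip_sqr s phi b0)); last first.
    by rewrite lee_fin sqr_ge0.
  rewrite -real_normK ?num_real// !expr2 !EFinM muleACA.
  by apply: lee_pmul => //; rewrite lee_fin.
rewrite /norm_sq.
have -> : (\int[mu]_phi \int[mu]_s ((K ^+ 2 * (4 * b))%:E * \int[mu2]_x G phi s x) =
  (K ^+ 2 * (4 * b))%:E * \int[mu]_phi \int[mu]_s \int[mu2]_x G phi s x)%E.
  rewrite -ge0_integralZl//; last 2 first.
  - by rewrite /G /strip; meas.
  - by move=> phi _; apply: integral_ge0 => s _; apply: integral_ge0.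
  apply: eq_integral => phi _; rewrite -ge0_integralZl//.
  - by rewrite /G /strip; meas.
  - by move=> s _; apply: integral_ge0.
have -> : (K ^+ 2 * (16 * pi * b ^+ 2) = K ^+ 2 * (4 * b) * (2 * pi * (2 * b)))%R by ring.
rewrite [in leRHS]EFinM -muleA lee_wpmul2l//.
have -> : (\int[mu]_phi \int[mu]_s \int[mu2]_x G phi s x =
   \int[mu]_phi \int[mu2]_x \int[mu]_s G phi s x)%E.
  apply: eq_integral => phi _.
  by rewrite (tonelli_swap_mu2 (f := fun x s => G phi s x))//; rewrite /G /strip; meas.
rewrite -(tonelli_swap_mu2 (f := fun x phi => \int[mu]_s G phi s x)%E); last 2 first.
- by rewrite /G /strip; meas.
- by move=> x phi; apply: integral_ge0.
rewrite -ge0_integralZl//; last 3 first.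
- by meas.
- by move=> x _; rewrite lee_fin sqr_ge0.
- by rewrite lee_fin !mulr_ge0// pi_ge0.
apply: le_ge0_integral => x.
  by apply: integral_ge0 => phi _; apply: integral_ge0.
have -> : (\int[mu]_phi \int[mu]_s G phi s x =
    \int[mu]_phi (circle phi * ((2 * b)%:E * (f x ^+ 2)%:E)))%E.
  apply: eq_integral => phi _; rewrite /G ge0_integralZl//; last 3 first.
  - by rewrite /strip; meas.
  - by move=> s _; rewrite lee_fin mulr_ge0// sqr_ge0.
  - exact: circle_ge0.
  congr (_ * _)%E; under eq_integral do rewrite EFinM.
  rewrite ge0_integralZr//; last 3 first.
  - by rewrite /strip; meas.
  - by move=> s _; rewrite lee_fin.
  - by rewrite lee_fin sqr_ge0.
  by rewrite integral_strip_ind.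
rewrite ge0_integralZr//; last 2 first.
- by move=> phi _; exact: circle_ge0.
- by rewrite -EFinM lee_fin mulr_ge0 ?sqr_ge0// mulr_ge0.
by rewrite integral_circle muleA -EFinM.
Qed.

End Strip.

Section AvgRadon.
Context {R : realType}.
Local Notation mu := (@lebesgue_measure R).
Variables (A : set R) (del c : R).
Hypothesis del0 : 0 < del.
Local Notation kappa := (lattice_kernel del c).

Variable f : R * R -> R.
Hypothesis mf : measurable_fun setT f.
Hypothesis fO : forall x, ~ Omega x -> f x = 0.
Hypothesis f_fin : (norm_sq f < +oo)%E.

Lemma integrable_bounded_mul (k : R * R -> R) (M : R) :
  measurable_fun setT k -> (forall x, `|k x| <= M) ->
  mu2.-integrable setT (fun x => (k x * f x)%:E).
Proof.
move=> mk kM; have M0 : 0 <= M by apply: le_trans (kM (0, 0)).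
apply/integrableP; split; first by meas.
apply: (@le_lt_trans _ _ (M%:E * \int[mu2]_x `|f x|%:E)%E).
  rewrite -ge0_integralZl//; last by meas.
  apply: le_ge0_integral => x; first exact: abse_ge0.
  by rewrite /= normrM -EFinM lee_fin ler_wpM2r.
by rewrite lte_mul_pinfty// integral_abs_lty.
Qed.

Lemma lattice_kernel_abs_le s sg : `|kappa s sg| <= del^-1.
Proof.
rewrite ger0_norm ?lattice_kernel_ge0//.
apply: (le_trans (lattice_kernel_le c del0 s sg)).
by apply: ler_piMr; [rewrite invr_ge0 ltW|rewrite lern1 leq_b1].
Qed.

(** Integrating along the lines and then over their offsets is integrating over the plane in rotated
    coordinates. The average thus becomes an integral operator on [f], whose kernel can be compared
    pointwise with the discrete one. *)
Lemma avg_radonE (s phi : R) : A phi ->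
  avg del c (radon A f) s phi = inner (fun x => kappa s (dot_angle x phi)) f.
Proof.
move=> Aphi; rewrite /avg /inner /Rintegral; congr fine.
have mks : measurable_fun setT (kappa s).
  apply: (measurableT_comp (measurable_lattice_kernel c del0) (g := fun sg => (s, sg))).
  by meas.
pose F (x : R * R) : \bar R := (kappa s (dot_angle x phi) * f x)%:E.
have mF : measurable_fun setT F by rewrite /F; meas.
have iF : mu2.-integrable setT F.
  apply: (integrable_bounded_mul (M := del^-1)); first by meas.
  by move=> x; exact: lattice_kernel_abs_le.
pose a (sg t : R) := f (line_point sg phi t).
have ma : measurable_fun setT (fun z : R * R => a z.1 z.2) by rewrite /a; meas.
have Fa sg t : F (line_point sg phi t) = (a sg t * kappa s sg)%:E.
  by rewrite /F dot_line_point mulrC.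
have iFr : mu2.-integrable setT (fun z => F (line_point z.1 phi z.2)).
  apply/integrableP; split; first by rewrite /F; meas.
  rewrite (ge0_integral_rotation (f := fun x => `|F x|%E) (cos2Dsin2 phi)).
  - by have /integrableP[] := iF.
  - exact: (measurableT_comp _ mF).
  - by move=> y; exact: abse_ge0.
transitivity (\int[mu]_sg (fine (\int[mu]_t (a sg t)%:E) * kappa s sg)%:E)%E.
  by apply: eq_integral => sg _; rewrite radonE//= indicE mem_set// mul1r mulrC.
rewrite (integral_fine_mul (m1 := mu) (m2 := mu) ma mks); last first.
  have /integrableP[_] := iFr; apply: le_lt_trans.
  rewrite tonelli_mu2; last 2 first.
  - exact: (measurableT_comp _ (measurable_int _ iFr)).
  - by move=> z; exact: abse_ge0.
  apply: le_ge0_integral => sg; first by apply: integral_ge0 => t _; rewrite lee_fin.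
  apply: le_ge0_integral => t; first by rewrite lee_fin.
  by rewrite Fa.
transitivity (\int[mu2]_z F (line_point z.1 phi z.2))%E.
  rewrite -(@integral12_prod_meas1 _ _ _ _ R mu mu (fun z => F (line_point z.1 phi z.2)))//.
  by apply: eq_integral => sg _; apply: eq_integral => t _; rewrite Fa.
apply: (@integral_signed_transfer R _ _ _ _ mu2 mu2 (fun z => line_point z.1 phi z.2)) => // G mG G0.
exact: ge0_integral_rotation (cos2Dsin2 phi) mG G0.
Qed.

End AvgRadon.

(** * The discrete Radon transform *)

Section Angles.
Context {R : realType}.

Lemma periodicDz (f : R -> R) (x : R) (k : int) :
  (forall y, f (y + 2 * pi) = f y) -> f (x + 2 * pi * k%:~R) = f x.
Proof.
move=> fp; have fn y (n : nat) : f (y + 2 * pi * n%:R) = f y.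
  elim: n => [|n IH]; first by rewrite mulr0 addr0.
  by rewrite -[n.+1%:R]natr1 mulrDr mulr1 addrA fp IH.
case: k => n; first by rewrite fn.
by rewrite -[LHS](fn _ n.+1) NegzE mulrNz mulrN addrNK.
Qed.

Lemma cosDz (x : R) (k : int) : cos (x + 2 * pi * k%:~R) = cos x.
Proof. by apply: periodicDz => y; rewrite mulr_natl cosD2pi. Qed.

Lemma sinDz (x : R) (k : int) : sin (x + 2 * pi * k%:~R) = sin x.
Proof. by apply: periodicDz => y; rewrite mulr_natl sinD2pi. Qed.

Lemma lipschitz1_of_deriv (f df : R -> R) (x y : R) :
  (forall z : R, is_derive z 1 f (df z)) -> (forall z, `|df z| <= 1) ->
  `|f y - f x| <= `|y - x|.
Proof.
move=> fdf df1.
wlog xy : x y / x <= y.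
  by move=> H; case: (leP x y) => [/H//|/ltW/H]; rewrite distrC [leRHS]distrC.
have [|z _ ->] := @MVT_segment R f df x y xy (fun z _ => fdf z).
  by apply: continuous_subspaceT => z; apply: differentiable_continuous; apply/derivable1_diffP; have [] := fdf z.
by rewrite normrM ler_piMl.
Qed.

Lemma cos_lipschitz (x y : R) : `|cos y - cos x| <= `|y - x|.
Proof.
apply: (lipschitz1_of_deriv (df := fun z => - sin z)) => z.
by rewrite normrN ler_norml sin_geN1 sin_le1.
Qed.

Lemma sin_lipschitz (x y : R) : `|sin y - sin x| <= `|y - x|.
Proof.
apply: (lipschitz1_of_deriv (df := cos)) => z.
by rewrite ler_norml cos_geN1 cos_le1.
Qed.

Lemma measurable_mod2pi (S : set R) : measurable (S : set (measurableTypeR R)) ->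
  measurable (mod2pi S : set (measurableTypeR R)).
Proof.
move=> mS; rewrite (_ : mod2pi S = `[-pi, pi[ `&`
  \bigcup_(k in @setT int) ((fun phi : R => phi + 2 * pi * k%:~R) @^-1` S)).
  apply: measurableI; first exact: measurable_itv.
  apply: countable_bigcupT_measurable => [|k]; first exact: countableP.
  rewrite -[X in measurable X]setTI.
  apply: (_ : measurable_fun setT (fun phi : R => phi + 2 * pi * k%:~R)) => //.
  by meas.
apply/seteqP; split=> phi /=.
  by move=> [p [k Sk]]; split; [rewrite in_itv|exists k].
by move=> [p [k _ Sk]]; split; [move: p; rewrite in_itv|exists k].
Qed.

Lemma mod2pi_range (S : set R) phi : mod2pi S phi -> - pi <= phi < pi.
Proof. by case. Qed.

Lemma mod2pi_long (a b : R) : 2 * pi < b - a -> mod2pi `]a, b[ = `[- pi, pi[%classic.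
Proof.
move=> ab; apply/seteqP; split=> phi /=; first by move=> [p _]; rewrite in_itv.
rewrite in_itv/= => p; split=> //.
have pi0 : 0 < 2 * pi :> R by have := pi_gt0 R; lra.
(* The least number of turns that brings [phi] strictly beyond [a]. *)
exists (Num.floor ((a - phi) / (2 * pi)) + 1); rewrite intrD1 /= in_itv/=.
have k1 := Num.Theory.floor_le ((a - phi) / (2 * pi)).
have /andP[_] := Num.Theory.floor_itv ((a - phi) / (2 * pi)); rewrite intrD1 => k2.
have e : a - phi = 2 * pi * ((a - phi) / (2 * pi)) by rewrite mulrC divfK// gt_eqF.
have := ler_wpM2l (ltW pi0) k1.
move: k2; rewrite -(ltr_pM2l pi0) => k2 k3.
by apply/andP; split; lra.
Qed.

End Angles.

(** * Covering and disjointness of the cells *)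

Section Cells.
Context {R : realType}.
Variables (A : set R) (d : discretization A).
Hypothesis A_proper : A <> `[- pi, pi[%classic.
Implicit Types (q k : nat) (s phi : R).

Let a q := angle d q.
(** Right end of the cell [q] and left end of the next; the conventions for the angles of index 0
    and [nQ + 1] make [m 0] and [m (nQ d)] the ends of the whole interval. *)
Let m q := (a q + a q.+1) / 2.

Lemma angle_gap q : (1 <= q < (nQ d).+1)%N -> a q.+1 - a q <= dphi d.
Proof.
move=> qn; rewrite /dphi.
apply: (le_bigmax_seq (r := index_iota 1 (nQ d).+1) 0 q predT (fun q => a q.+1 - a q)) => //.
by rewrite mem_index_iota.
Qed.

Lemma dphi_ge0 : 0 <= dphi d.
Proof. exact: bigmax_ge_id. Qed.

Let a_step q : (q < (nQ d).+1)%N -> a q <= a q.+1.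
Proof.
rewrite ltnS /a; case: q => [_|q qn]; first by rewrite angle_first.
move: qn; rewrite leq_eqVlt => /orP[/eqP qn|qn]; first by rewrite qn angle_last.
exact/ltW/angle_lt.
Qed.

Lemma angle_gap_pred q : (1 <= q < (nQ d).+1)%N -> a q - a q.-1 <= dphi d.
Proof.
case: q => // -[_|q] /=; first by rewrite /a angle_first subrr dphi_ge0.
by move=> qn; apply: angle_gap; rewrite /= ltnW.
Qed.

Let m_step q : (q < nQ d)%N -> m q <= m q.+1.
Proof.
move=> qn; rewrite /m ler_pM2r ?invr_gt0//.
by apply: lerD; apply: a_step; rewrite // ltnW.
Qed.

Let m_mono q q' : (q <= q' <= nQ d)%N -> m q <= m q'.
Proof.
elim: q' => [|q' IH] /andP[]; first by rewrite leqn0 => /eqP->.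
rewrite leq_eqVlt => /orP[/eqP->//|qq'] q'n.
by apply: (le_trans (IH _)); [rewrite -ltnS qq' ltnW|exact: m_step].
Qed.

Let m0 : m 0 = a 1.
Proof. by rewrite /m /a angle_first; lra. Qed.

Let mn : m (nQ d) = a (nQ d).
Proof. by rewrite /m /a angle_last; lra. Qed.

(** A longer interval would cover the circle, contrary to [A_proper]. *)
Let angle_length : a (nQ d) - a 1 <= 2 * pi.
Proof.
rewrite leNgt; apply/negP => /mod2pi_long H.
by apply: A_proper; rewrite -(angle_range d) H.
Qed.

(** The integer [k] lifts [phi] into the interval of angles, and the cell is the first whose right
    end exceeds the lift. A cell extends by half a gap on either side of its angle. *)
Lemma angle_cell_cover phi : A phi -> exists q (k : int),
  [/\ (1 <= q < (nQ d).+1)%N, angle_cell d q phi &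
      `|phi + 2 * pi * k%:~R - a q| <= dphi d / 2].
Proof.
rewrite -{1}(angle_range d) => -[phipi [k]]; rewrite /= in_itv/= => /andP[ak ka].
set phi' := phi + _ in ak ka *.
have ex : exists q, (q <= nQ d)%N && (phi' < m q) by exists (nQ d); rewrite leqnn mn.
case: (ex_minnP ex) => q /andP[qn phiq qmin].
have q0 : (0 < q)%N.
  by rewrite lt0n; apply/eqP => q0; move: phiq; rewrite q0 m0 => /ltW; rewrite leNgt ak.
have qphi : m q.-1 <= phi'.
  rewrite leNgt; apply/negP => H.
  have := qmin q.-1; rewrite H (leq_trans (leq_pred _) qn) => /(_ isT).
  by rewrite leqNgt prednK ?leqnn.
have qin : (1 <= q < (nQ d).+1)%N by rewrite q0 ltnS.
exists q, k; split => //.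
  split=> //; exists k; rewrite /= in_itv/= -/phi'.
  by move: qphi; rewrite /m prednK// => ->.
move: qphi phiq; rewrite /m prednK// => H1 H2.
have := angle_gap qin; have := angle_gap_pred qin.
rewrite -/phi' ler_norml /a => G1 G2; rewrite /a in H1 H2.
by apply/andP; split; lra.
Qed.

(** Two lifts of [phi] into a half-open interval no longer than a period have the same number of
    turns; the intervals before reduction modulo [2 * pi] are ordered by the monotonicity of [m]. *)
Lemma angle_cell_inj q q' phi :
  (1 <= q < (nQ d).+1)%N -> (1 <= q' < (nQ d).+1)%N ->
  angle_cell d q phi -> angle_cell d q' phi -> q = q'.
Proof.
move=> qin q'in.
wlog qq' : q q' qin q'in / (q < q')%N.
  move=> H hq hq'; case: (ltngtP q q') => // qq'; first exact: (H q q').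
  by symmetry; exact: (H q' q).
move=> [_ [k]]; rewrite /= in_itv/= => /andP[k1 k2].
move=> [_ [k']]; rewrite /= in_itv/= => /andP[k'1 k'2].
exfalso; case/andP: qin => q0 qn; case/andP: q'in => q'0 q'n.
rewrite !ltnS in qn q'n.
have qp : q'.-1.+1 = q' by rewrite prednK.
have : m q <= m q'.-1 by apply: m_mono; rewrite -ltnS qp qq'/= (leq_trans (leq_pred _)).
have : m 0 <= m q.-1 by apply: m_mono; rewrite /= (leq_trans (leq_pred _)).
have : m q' <= m (nQ d) by apply: m_mono; rewrite leqnn q'n.
rewrite m0 mn /m qp (prednK q0) /a => H1 H2 H3.
have pi0 : 0 < 2 * pi :> R by have := pi_gt0 R; lra.
have len : angle d (nQ d) - angle d 1 <= 2 * pi := angle_length.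
have [kk|kk|kk] := ltgtP k k'.
- have : (k%:~R + 1 : R) <= k'%:~R by rewrite -intrD1 ler_int lezD1.
  by move=> /(ler_wpM2l (ltW pi0)); lra.
- have : (k'%:~R + 1 : R) <= k%:~R by rewrite -intrD1 ler_int lezD1.
  by move=> /(ler_wpM2l (ltW pi0)); lra.
- by rewrite kk in k1 k2; lra.
Qed.

Let cell_round (n : nat) (del s : R) (p : nat) : 0 < del ->
  del * (p%:R - n.+1%:R / 2) - del / 2 <= s < del * (p%:R - n.+1%:R / 2) + del / 2 ->
  lattice_round del (n.+1%:R / 2) s = del * (p%:R - n.+1%:R / 2).
Proof. by move=> del0; exact: (lattice_round_cell (k := Posz p) del0). Qed.

Let cell_inj (n : nat) (del : R) (p p' : nat) : 0 < del ->
  del * (p%:R - n.+1%:R / 2) = del * (p'%:R - n.+1%:R / 2) -> p = p'.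
Proof.
move=> del0 /(mulfI (lt0r_neq0 del0)) /addIr /eqP.
by rewrite eqr_nat => /eqP.
Qed.

(** Each cell lies in a fibre of the rounding map: this yields both the disjointness of the cells
    and the identification with [lattice_kernel]. *)
Lemma offset_cell_round p s : offset_cell (nP d) (ds d) p s ->
  lattice_round (ds d) ((nP d).+1%:R / 2) s = offset (nP d) (ds d) p.
Proof. by rewrite /offset_cell /= in_itv/=; apply: cell_round; exact: ds_gt0. Qed.

Lemma offset_cell_inj p p' s : offset_cell (nP d) (ds d) p s ->
  offset_cell (nP d) (ds d) p' s -> p = p'.
Proof.
move=> /offset_cell_round H /offset_cell_round; rewrite H.
by apply: cell_inj; exact: ds_gt0.
Qed.

Lemma pixel_round i j x : pixel (nN d) (nM d) (dx d) i j x ->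
  (lattice_round (dx d) ((nN d).+1%:R / 2) x.1,
   lattice_round (dx d) ((nM d).+1%:R / 2) x.2) = pixel_center (nN d) (nM d) (dx d) i j.
Proof.
rewrite /pixel /= !in_itv/= => -[h1 h2].
by congr pair; apply: cell_round => //; exact: dx_gt0.
Qed.

Lemma pixel_inj i j i' j' x : pixel (nN d) (nM d) (dx d) i j x ->
  pixel (nN d) (nM d) (dx d) i' j' x -> i = i' /\ j = j'.
Proof.
move=> /pixel_round H /pixel_round; rewrite H => -[].
by move=> /(cell_inj (dx_gt0 d)) -> /(cell_inj (dx_gt0 d)) ->.
Qed.

End Cells.

(** * Integral operators with a bounded kernel *)

Section BoundedKernel.
Context {R : realType}.
Local Notation mu := (@lebesgue_measure R).
Implicit Types (D E : set (R * R)) (k : R * R -> R * R -> R) (f g : R * R -> R).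

Lemma integral_abs_L2_lty D f : measurable D -> (mu2 D < +oo)%E -> L2 D f ->
  (\int[mu2]_x `|f x|%:E < +oo)%E.
Proof.
move=> mD Dfin /L2P[mf ffin fD].
have mI : measurable_fun setT (\1_D : R * R -> R) by exact: measurable_indic.
apply: (@le_lt_trans _ _ (\int[mu2]_x ((\1_D x)%:E + (f x ^+ 2)%:E))%E).
  apply: le_ge0_integral => x; first by rewrite lee_fin.
  rewrite -EFinD lee_fin indicE.
  have [xD|xD] := pselect (D x); last by rewrite fD// normr0 addr_ge0// sqr_ge0.
  rewrite mem_set// (_ : true%:R = 1 :> R)//.
  rewrite -[f x ^+ 2]real_normK ?num_real//; set a := `|f x|.
  by have := sqr_ge0 (a - 1); have : 0 <= a := normr_ge0 _; nra.
rewrite ge0_integralD; last 5 first.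
- exact: measurableT.
- by move=> x _; rewrite lee_fin.
- by meas.
- by move=> x _; rewrite lee_fin sqr_ge0.
- by meas.
by rewrite integral_indic// setIT lte_add_pinfty.
Qed.

Section Operator.
Variables (D E : set (R * R)) (k : R * R -> R * R -> R) (M : R).
Hypotheses (mD : measurable D) (mE : measurable E).
Hypotheses (D_fin : (mu2 D < +oo)%E) (E_fin : (mu2 E < +oo)%E).
Hypothesis mk : measurable_fun setT (fun z : (R * R) * (R * R) => k z.1 z.2).
Hypothesis kM : forall y x, `|k y x| <= M.
Hypothesis kE : forall y x, ~ E y -> k y x = 0.

Lemma measurable_kernel_op f : measurable_fun setT f ->
  measurable_fun setT (fun y => inner (k y) f).
Proof. by move=> mf; rewrite /inner; meas. Qed.

Lemma kernel_op_le y f : L2 D f ->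
  (`|inner (k y) f|%:E <= M%:E * \int[mu2]_x `|f x|%:E)%E.
Proof.
move=> /L2P[mf _ _].
have mky : measurable_fun setT (k y).
  by apply: (measurableT_comp mk (g := fun x => (y, x))); meas.
have M0 : 0 <= M by apply: le_trans (kM (0, 0) (0, 0)).
apply: (@le_trans _ _ `|\int[mu2]_x (k y x * f x)%:E|%E).
  by rewrite /inner /Rintegral; case: (\int[mu2]_x _)%E => //=; rewrite normr0 leey.
apply: (@le_trans _ _ (\int[mu2]_x `|(k y x * f x)%:E|)%E).
  by apply: le_abse_integral => //; meas.
rewrite -ge0_integralZl//; last by meas.
apply: le_ge0_integral => x; first exact: abse_ge0.
by rewrite /= normrM -EFinM lee_fin ler_wpM2r.
Qed.

Lemma L2_kernel_op f : L2 D f -> L2 E (fun y => inner (k y) f).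
Proof.
move=> fL; have /L2P[mf _ _] := fL; apply/L2P; split.
- exact: measurable_kernel_op.
- have Ifin := integral_abs_L2_lty mD D_fin fL.
  have le := fun y => kernel_op_le y fL.
  have M0 : 0 <= M by apply: le_trans (kM (0, 0) (0, 0)).
  have I0 : (0 <= \int[mu2]_x `|f x|%:E)%E by apply: integral_ge0.
  move: Ifin I0 le; case: (\int[mu2]_x _)%E => [r _ r0 le|//|//].
  apply: (@le_lt_trans _ _ (\int[mu2]_y ((M * r) ^+ 2 * \1_E y)%:E)%E).
    apply: le_ge0_integral => y; first by rewrite lee_fin sqr_ge0.
    rewrite lee_fin indicE; have [yE|yE] := pselect (E y).
      rewrite mem_set// mulr1 -[leLHS]real_normK ?num_real// ler_pXn2r ?nnegrE//.
        by have := le y; rewrite -EFinM lee_fin.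
      by rewrite mulr_ge0.
    rewrite (_ : inner _ _ = 0) ?expr0n/= ?mulr_ge0 ?sqr_ge0//.
    rewrite /inner /Rintegral integral0_eq// => x _.
    by rewrite kE// mul0r.
  have mI : measurable_fun setT (\1_E : R * R -> R) by exact: measurable_indic.
  rewrite (_ : (\int[mu2]_y _ = (((M * r) ^+ 2)%:E * \int[mu2]_y (\1_E y)%:E))%E).
    by rewrite integral_indic// setIT lte_mul_pinfty// lee_fin sqr_ge0.
  rewrite -ge0_integralZl//; first by meas.
  by rewrite lee_fin sqr_ge0.
- move=> y yE; rewrite /inner /Rintegral integral0_eq// => x _.
  by rewrite kE// mul0r.
Qed.

(** Square integrable functions on sets of finite measure are integrable, so [M * |f| * |g|]
    dominates the integrand and Fubini applies. The factor [\1_D x] makes the transposed operator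
    vanish outside [D]. *)
Lemma kernel_op_adjointE f g : L2 D f -> L2 E g ->
  inner (fun y => inner (k y) f) g =
  inner f (fun x => inner (fun y => \1_D x * k y x) g).
Proof.
move=> fL gL; have /L2P[mf _ fD] := fL; have /L2P[mg _ gE] := gL.
have M0 : 0 <= M by apply: le_trans (kM (0, 0) (0, 0)).
have fI := integral_abs_L2_lty mD D_fin fL.
have gI := integral_abs_L2_lty mE E_fin gL.
pose F (z : (R * R) * (R * R)) : \bar R := (k z.1 z.2 * f z.2 * g z.1)%:E.
have mF : measurable_fun setT F by rewrite /F; meas.
have Ffin : (\int[mu2]_y \int[mu2]_x `|F (y, x)| < +oo)%E.
  apply: (@le_lt_trans _ _ (\int[mu2]_y ((M%:E * \int[mu2]_x `|f x|%:E) * `|g y|%:E))%E).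
    apply: le_ge0_integral => y; first by apply: integral_ge0 => x _; exact: abse_ge0.
    rewrite -ge0_integralZl//; last by meas.
    rewrite -ge0_integralZr//; last 2 first.
    - by meas.
    - by move=> x _; rewrite -EFinM lee_fin mulr_ge0.
    apply: le_ge0_integral => x; first exact: abse_ge0.
    by rewrite /F /= !normrM -!EFinM lee_fin !ler_wpM2r.
  rewrite ge0_integralZl//; last 2 first.
  - by meas.
  - by rewrite mule_ge0//; apply: integral_ge0.
  rewrite lte_mul_pinfty//; first by rewrite mule_ge0//; apply: integral_ge0.
  rewrite ge0_fin_numE ?lte_mul_pinfty//.
  by rewrite mule_ge0//; apply: integral_ge0.
have iF : (@mu2_sf R \x @mu2_sf R)%E.-integrable setT F.
  by apply/integrable12ltyP; [exact: mF|exact: Ffin].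
rewrite /inner /Rintegral; congr fine.
rewrite (@integral_fine_mul R _ _ _ _ mu2_sf mu2_sf (fun y x => k y x * f x) g)//; last by meas.
transitivity (\int[mu2]_x \int[mu2]_y F (y, x))%E.
  exact: Fubini iF.
have iF' := proj1 (integrable21ltyP mu2_sf mu2_sf mF) iF.
transitivity (\int[mu2]_x (fine (\int[mu2]_y (\1_D x * k y x * g y)%:E) * f x)%:E)%E; last first.
  by apply: eq_integral => x _; rewrite mulrC.
have mI : measurable_fun setT (\1_D : R * R -> R) by exact: measurable_indic.
have FE x y : \1_D x * k y x * g y * f x = k y x * f x * g y.
  have [xD|xD] := pselect (D x); last by rewrite fD// !mulr0 mul0r.
  by rewrite indicE mem_set// mul1r mulrAC.
rewrite [RHS](@integral_fine_mul R _ _ _ _ mu2_sf mu2_sf (fun x y => \1_D x * k y x * g y) f).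
- by apply: eq_integral => x _; apply: eq_integral => y _; rewrite FE.
- have mk' : measurable_fun setT (fun z : (R * R) * (R * R) => k z.2 z.1).
    by apply: (measurableT_comp mk (g := fun z : (R * R) * (R * R) => (z.2, z.1))); meas.
  by meas.
- exact: mf.
- apply: le_lt_trans iF'; apply: le_ge0_integral => x.
    by apply: integral_ge0 => y _; rewrite lee_fin.
  by apply: le_ge0_integral => y; rewrite ?lee_fin// FE.
Qed.

End Operator.
End BoundedKernel.

Lemma big_pick (V : nmodType) (n q : nat) (F : nat -> V) :
  (1 <= q < n.+1)%N -> (forall k, (1 <= k < n.+1)%N -> k != q -> F k = 0) ->
  \sum_(1 <= k < n.+1) F k = F q.
Proof.
move=> qn F0; rewrite (bigD1_seq q)/= ?mem_index_iota ?iota_uniq//.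
rewrite big1_seq ?addr0// => k /andP[kq]; rewrite mem_index_iota => kn.
exact: F0.
Qed.

(** * The discrete transform as an integral operator *)

Section DiscreteKernel.
Context {R : realType}.
Local Notation mu := (@lebesgue_measure R).
Variables (A : set R) (d : discretization A).
Implicit Types (f g : R * R -> R) (y x : R * R).

Lemma mu2_rect_lty (S : set (R * R)) (a b : R) : measurable S ->
  (forall z, S z -> -a <= z.1 <= a /\ - b <= z.2 <= b) -> (mu2 S < +oo)%E.
Proof.
move=> mS Sab.
apply: (@le_lt_trans _ _ (mu2 (`[-a, a] `*` `[- b, b]))).
  apply: le_measure; rewrite ?inE; [exact: mS|by apply: measurableX; exact: measurable_itv|].
  by move=> z /Sab[? ?]; split; rewrite /= in_itv.
rewrite /mu2 /= product_measure1E//= !lebesgue_measure_itv/=.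
by case: ifP; case: ifP => _ _; rewrite ?mule0 ?mul0e// -!EFinB -EFinM ltry.
Qed.

Lemma Omega_bound x : Omega x -> `|x.1| <= 1 /\ `|x.2| <= 1.
Proof.
rewrite /Omega /= => x1.
have H (t : R) : t ^+ 2 <= 1 -> `|t| <= 1.
  by rewrite -real_normK ?num_real// expr_le1.
by split; apply: H; [have := sqr_ge0 x.2|have := sqr_ge0 x.1]; lra.
Qed.

Lemma mu2_Omega_lty : (mu2 (@Omega R) < +oo)%E.
Proof.
apply: (mu2_rect_lty (a := 1) (b := 1) (@Omega_measurable R)) => x /Omega_bound.
by rewrite !ler_norml.
Qed.

Lemma discretization_measurable : measurable (A : set (measurableTypeR R)).
Proof. by rewrite -(angle_range d); apply: measurable_mod2pi; exact: measurable_itv. Qed.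

Lemma discretization_range phi : A phi -> - pi <= phi < pi.
Proof. by rewrite -(angle_range d) => /mod2pi_range. Qed.

Lemma OmegaA_measurable : measurable (OmegaA A).
Proof. by apply: measurableX; [exact: measurable_itv|exact: discretization_measurable]. Qed.

Lemma mu2_OmegaA_lty : (mu2 (OmegaA A) < +oo)%E.
Proof.
apply: (mu2_rect_lty (a := 1) (b := pi) OmegaA_measurable) => x [].
rewrite /= in_itv/= => /andP[x1 x2] /discretization_range/andP[x3 x4].
by split; apply/andP; split=> //; exact: ltW.
Qed.

(** The integrals over pixels become integrals against their indicators. *)
Definition discrete_kernel y x : R :=
  \1_(OmegaA A) y * ((ds d ^+ 2)^-1 *
    \sum_(1 <= q < (nQ d).+1) \sum_(1 <= p < (nP d).+1)
      \1_(offset_cell (nP d) (ds d) p) y.1 * \1_(angle_cell d q) y.2 *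
      \sum_(1 <= i < (nN d).+1) \sum_(1 <= j < (nM d).+1)
        weight (ds d) (dot_angle (pixel_center (nN d) (nM d) (dx d) i j) (angle d q)
                       - offset (nP d) (ds d) p) *
        \1_(pixel (nN d) (nM d) (dx d) i j) x).

Lemma pixel_measurable i j : measurable (pixel (nN d) (nM d) (dx d) i j).
Proof. by apply: measurableX; exact: measurable_itv. Qed.

Lemma angle_cell_measurable q :
  measurable (angle_cell d q : set (measurableTypeR R)).
Proof. by apply: measurable_mod2pi; exact: measurable_itv. Qed.

Lemma measurable_discrete_kernel :
  measurable_fun setT (fun z : (R * R) * (R * R) => discrete_kernel z.1 z.2).
Proof.
have m1 : measurable_fun setT (\1_(OmegaA A) : R * R -> R).
  exact: measurable_indic OmegaA_measurable.
rewrite /discrete_kernel; apply: measurable_funM; first by meas.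
apply: measurable_funM; first by meas.
apply: measurable_sum => q; apply: measurable_sum => p.
have m2 : measurable_fun setT (\1_(offset_cell (nP d) (ds d) p) : R -> R).
  exact: measurable_indic (measurable_itv _).
have m3 : measurable_fun setT (\1_(angle_cell d q) : R -> R).
  exact: measurable_indic (angle_cell_measurable q).
apply: measurable_funM; first by meas.
apply: measurable_sum => i; apply: measurable_sum => j.
have m4 : measurable_fun setT (\1_(pixel (nN d) (nM d) (dx d) i j) : R * R -> R).
  exact: measurable_indic (pixel_measurable i j).
by meas.
Qed.

(** Some bound is enough: it serves integrability and Fubini, while the error estimates rest on the
    comparison with [lattice_kernel]. *)
Let bounded (F : R * R -> R * R -> R) := exists M : R, forall y x, `|F y x| <= M.

Let bounded_mul F G : bounded F -> bounded G -> bounded (fun y x => F y x * G y x).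
Proof.
move=> [M FM] [N GN]; exists (M * N) => y x.
by rewrite normrM ler_pM.
Qed.

Let bounded_sum (s : seq nat) (F : nat -> R * R -> R * R -> R) :
  (forall i, bounded (F i)) -> bounded (fun y x => \sum_(i <- s) F i y x).
Proof.
move=> FB; elim: s => [|i s [M IH]].
  by exists 0 => y x; rewrite big_nil normr0.
have [N FN] := FB i; exists (N + M) => y x.
by rewrite big_cons (le_trans (ler_normD _ _))// lerD.
Qed.

Let bounded_cst c : bounded (fun _ _ => c).
Proof. by exists `|c|. Qed.

Let bounded_bool (b : R * R -> R * R -> bool) : bounded (fun y x => (b y x)%:R).
Proof. by exists 1 => y x; rewrite normr_nat lern1 leq_b1. Qed.

Lemma discrete_kernel_bounded : exists M : R, forall y x, `|discrete_kernel y x| <= M.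
Proof.
apply: bounded_mul; first exact: bounded_bool.
apply: bounded_mul; first exact: bounded_cst.
apply: bounded_sum => q; apply: bounded_sum => p.
apply: bounded_mul; first by apply: bounded_mul; exact: bounded_bool.
apply: bounded_sum => i; apply: bounded_sum => j.
by apply: bounded_mul; [exact: bounded_cst|exact: bounded_bool].
Qed.

Lemma discrete_kernel_eq0 y x : ~ OmegaA A y -> discrete_kernel y x = 0.
Proof. by move=> yA; rewrite /discrete_kernel indicE memNset// mul0r. Qed.

Section Apply.
Variable f : R * R -> R.
Hypothesis fL : L2 Omega f.

(** Integrability is carried along with the value so that finite sums can be built term by term. *)
Let represents (k : R * R -> R) (c : R) :=
  mu2.-integrable setT (fun x => (k x * f x)%:E) /\ inner k f = c.

Let represents_sum (s : seq nat) (k : nat -> R * R -> R) (c : nat -> R) :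
  (forall i, represents (k i) (c i)) ->
  represents (fun x => \sum_(i <- s) k i x) (\sum_(i <- s) c i).
Proof.
move=> kc; elim: s => [|i s [IH1 IH2]].
  rewrite big_nil; split.
    rewrite [X in mu2.-integrable _ X](_ : _ = cst 0%E); first exact: integrable0.
    by apply/funext => x; rewrite big_nil mul0r.
  by rewrite /inner /Rintegral integral0_eq// => x _; rewrite big_nil mul0r.
have [k1 k2] := kc i.
have E : (fun x => ((\sum_(j <- i :: s) k j x) * f x)%:E) =
    (fun x => (k i x * f x)%:E + ((\sum_(j <- s) k j x) * f x)%:E)%E.
  by apply/funext => x; rewrite big_cons mulrDl.
split; first by rewrite E; exact: integrableD.
rewrite big_cons -k2 -IH2 /inner -RintegralD//.
by congr fine; apply: eq_integral => x _; rewrite big_cons mulrDl.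
Qed.

Let represents_scale (c e : R) k : represents k e ->
  represents (fun x => c * k x) (c * e).
Proof.
move=> [k1 k2]; split.
  rewrite [X in mu2.-integrable _ X](_ : _ = (fun x => c%:E * (k x * f x)%:E)%E).
    exact: integrableZl.
  by apply/funext => x; rewrite -mulrA EFinM.
rewrite -k2 /inner -RintegralZl//.
by congr fine; apply: eq_integral => x _; rewrite -mulrA.
Qed.

Lemma discrete_radonE : discrete_radon d f = fun y => inner (discrete_kernel y) f.
Proof.
apply/funext => y; have /L2P[mf ffin fO] := fL.
suff [] : represents (discrete_kernel y) (discrete_radon d f y) by [].
have -> : discrete_radon d f y = \1_(OmegaA A) y * ((ds d ^+ 2)^-1 *
    \sum_(1 <= q < (nQ d).+1) \sum_(1 <= p < (nP d).+1)
      \1_(offset_cell (nP d) (ds d) p) y.1 * \1_(angle_cell d q) y.2 *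
      \sum_(1 <= i < (nN d).+1) \sum_(1 <= j < (nM d).+1)
        weight (ds d) (dot_angle (pixel_center (nN d) (nM d) (dx d) i j) (angle d q)
                       - offset (nP d) (ds d) p) *
        \int[mu2]_(z in pixel (nN d) (nM d) (dx d) i j) f z).
  by rewrite /discrete_radon /patch indicE; case: ifP; rewrite ?mul1r ?mul0r.
apply: represents_scale; apply: represents_scale.
apply: represents_sum => q; apply: represents_sum => p; apply: represents_scale.
apply: represents_sum => i; apply: represents_sum => j; apply: represents_scale.
have m4 : measurable_fun setT (\1_(pixel (nN d) (nM d) (dx d) i j) : R * R -> R).
  exact: measurable_indic (pixel_measurable i j).
split.
  apply: (integrable_bounded_mul mf fO ffin (M := 1)) => // x.
  by rewrite indicE normr_nat lern1 leq_b1.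
rewrite /Rintegral integral_mkcond; congr fine; apply: eq_integral => x _.
by rewrite patchE indicE; case: (_ \in _); rewrite ?mul1r ?mul0r.
Qed.

End Apply.

End DiscreteKernel.

Section DiscreteSubAvg.
Context {R : realType}.
Local Notation mu := (@lebesgue_measure R).
Variables (A : set R) (d : discretization A).
Hypothesis A_proper : A <> `[- pi, pi[%classic.
Implicit Types (f g : R * R -> R) (x y : R * R).

Local Notation c := ((nP d).+1%:R / 2).
Local Notation mesh := (dx d + dphi d).

Lemma discrete_kernel_cell s phi x (q p i j : nat) : OmegaA A (s, phi) ->
  (1 <= q < (nQ d).+1)%N -> (1 <= p < (nP d).+1)%N ->
  (1 <= i < (nN d).+1)%N -> (1 <= j < (nM d).+1)%N ->
  angle_cell d q phi -> offset_cell (nP d) (ds d) p s ->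
  pixel (nN d) (nM d) (dx d) i j x ->
  discrete_kernel d (s, phi) x = (ds d ^+ 2)^-1 *
    weight (ds d) (dot_angle (pixel_center (nN d) (nM d) (dx d) i j) (angle d q)
                   - offset (nP d) (ds d) p).
Proof.
move=> yA qn pn iN jM cq cp cx.
rewrite /discrete_kernel indicE mem_set// mul1r; congr (_ * _).
rewrite (big_pick qn) => [|k kn /eqP kq]; last first.
  rewrite big1 // => l _; rewrite [\1_(angle_cell d k) _]indicE memNset ?mulr0 ?mul0r//.
  by move=> ck; apply: kq; exact: (angle_cell_inj A_proper kn qn ck cq).
rewrite (big_pick pn) => [|k kn /eqP kp]; last first.
  rewrite [\1_(offset_cell _ _ k) _]indicE memNset ?mul0r//.
  by move=> ck; apply: kp; exact: (offset_cell_inj ck cp).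
rewrite !indicE !mem_set// !mul1r.
rewrite (big_pick iN) => [|k kn /eqP ki]; last first.
  rewrite big1 // => l _; rewrite indicE memNset ?mulr0//.
  by move=> ck; apply: ki; have [] := pixel_inj ck cx.
rewrite (big_pick jM) => [|k kn /eqP kj]; last first.
  rewrite indicE memNset ?mulr0//.
  by move=> ck; apply: kj; have [] := pixel_inj ck cx.
by rewrite indicE mem_set// mulr1.
Qed.

(** Moving to the centre of the pixel costs [dx / 2] in each coordinate; changing the angle costs
    [dphi / 2] for the cosine and for the sine, with coordinates bounded by 1 in the disc. *)
Lemma dot_pixel_dist x i j phi q (k : int) : Omega x ->
  pixel (nN d) (nM d) (dx d) i j x ->
  `|phi + 2 * pi * k%:~R - angle d q| <= dphi d / 2 ->
  `|dot_angle (pixel_center (nN d) (nM d) (dx d) i j) (angle d q) - dot_angle x phi|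
    <= mesh.
Proof.
move=> /Omega_bound[x1 x2]; rewrite /pixel /pixel_center => -[]; rewrite /= !in_itv/=.
set z1 := dx d * (i%:R - _); set z2 := dx d * (j%:R - _) => zx1 zx2.
rewrite -(cosDz phi k) -(sinDz phi k).
set phi' := phi + _; set b := angle d q => pb.
rewrite (_ : z1 * cos b + z2 * sin b - _ =
  ((z1 - x.1) * cos b + (z2 - x.2) * sin b) +
  (x.1 * (cos b - cos phi') + x.2 * (sin b - sin phi'))); last by ring.
have b1 (t t' w : R) : `|t| <= w -> `|t'| <= 1 -> `|t * t'| <= w.
  by move=> tw t'1; rewrite normrM; apply: le_trans tw; exact: ler_piMr.
have c1 : `|cos b| <= 1 by rewrite ler_norml cos_geN1 cos_le1.
have s1 : `|sin b| <= 1 by rewrite ler_norml sin_geN1 sin_le1.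
have h1 : `|(z1 - x.1) * cos b| <= dx d / 2.
  by apply: b1 => //; rewrite ler_norml; case/andP: zx1 => ? ?; apply/andP; split; lra.
have h2 : `|(z2 - x.2) * sin b| <= dx d / 2.
  by apply: b1 => //; rewrite ler_norml; case/andP: zx2 => ? ?; apply/andP; split; lra.
have h3 : `|x.1 * (cos b - cos phi')| <= dphi d / 2.
  rewrite mulrC; apply: b1 => //; apply: le_trans pb.
  by rewrite distrC cos_lipschitz.
have h4 : `|x.2 * (sin b - sin phi')| <= dphi d / 2.
  rewrite mulrC; apply: b1 => //; apply: le_trans pb.
  by rewrite distrC sin_lipschitz.
apply: le_trans (ler_normD _ _) _.
apply: le_trans (lerD (ler_normD _ _) (ler_normD _ _)) _.
by lra.
Qed.

(** Outside the strip the projection of [x] is at least [ds + mesh] away from the centre of its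
    offset cell, after deducting [ds / 2] for rounding; that of the pixel centre is then at least
    [ds] away, and both weights vanish. *)
Lemma discrete_sub_lattice_kernel s phi x : OmegaA A (s, phi) -> Omega x ->
  `|discrete_kernel d (s, phi) x - lattice_kernel (ds d) c s (dot_angle x phi)| <=
  (ds d ^+ 2)^-1 * mesh * strip (3 / 2 * ds d + mesh) s phi x.
Proof.
move=> yA xO; have [/= s1 phiA] := yA.
have del0 := ds_gt0 d.
have [p /= pn cp] := @offset_cover _ _ d _ s1.
have [i /= iN [j /= jM cx]] := @pixel_cover _ _ d _ xO.
have [q [k [qn cq kq]]] := angle_cell_cover d phiA.
have L := dot_pixel_dist xO cx kq.
have {}pn : (1 <= p < (nP d).+1)%N by move: pn; rewrite in_itv.
have {}iN : (1 <= i < (nN d).+1)%N by move: iN; rewrite in_itv.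
have {}jM : (1 <= j < (nM d).+1)%N by move: jM; rewrite in_itv.
rewrite (discrete_kernel_cell yA qn pn iN jM cq cp cx).
rewrite /lattice_kernel (offset_cell_round cp) -mulrBr normrM.
have i0 : 0 <= (ds d ^+ 2)^-1 by rewrite invr_ge0 sqr_ge0.
rewrite (ger0_norm i0) -mulrA; apply: ler_wpM2l => //.
move: L; set t := dot_angle (pixel_center _ _ _ _ _) _; set u := dot_angle x phi.
set o := offset _ _ _ => L.
have so : `|o - s| <= ds d / 2.
  by rewrite /o -(offset_cell_round cp); exact: lattice_round_dist.
have eta0 : 0 <= mesh by apply: le_trans L.
rewrite /strip -/u; case: (leP `|u - s| _) => us.
  rewrite mulr1; apply: (le_trans (weight_lipschitz _ _ _)).
  by rewrite (_ : t - o - (u - o) = t - u)//; ring.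
have uo : ds d + mesh <= `|u - o|.
  have : `|u - s| <= `|u - o| + `|o - s|.
    by rewrite -(subrKA o u) (le_trans (ler_normD _ _))// opprK.
  lra.
have to : ds d <= `|t - o|.
  have : `|u - o| <= `|t - u| + `|t - o|.
    rewrite distrC [`|t - u|]distrC; have -> : o - u = (t - u) - (t - o) by ring.
    by rewrite (le_trans (ler_normB _ _))// distrC.
  lra.
rewrite (weight_eq0 to) (weight_eq0 (le_trans _ uo)) ?subrr ?normr0 ?mulr0//.
by rewrite lerDl.
Qed.

Section Apply.
Variable f : R * R -> R.
Hypothesis fL : L2 Omega f.

(** Averaging spreads the Radon transform beyond the offsets in []-1, 1[], hence the cut-off of the
    average. *)
Definition discrete_sub_avg y : R :=
  discrete_radon d f y - \1_(OmegaA A) y * avg (ds d) c (radon A f) y.1 y.2.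

Lemma measurable_discrete_radon : measurable_fun setT (discrete_radon d f).
Proof.
have /L2P[mf _ _] := fL; rewrite (discrete_radonE d fL).
exact: (measurable_kernel_op (measurable_discrete_kernel d) mf).
Qed.

Lemma measurable_discrete_sub_avg : measurable_fun setT discrete_sub_avg.
Proof.
have /L2P[mf _ fO] := fL; have mr := measurable_discrete_radon.
have ma := measurable_avg c (ds_gt0 d)
  (measurable_radon (discretization_measurable d) mf fO).
have mI : measurable_fun setT (\1_(OmegaA A) : R * R -> R).
  exact: measurable_indic (OmegaA_measurable d).
by rewrite /discrete_sub_avg; meas.
Qed.

Lemma norm_sq_discrete_sub_avg_le :
  (norm_sq discrete_sub_avg <=
   (((ds d ^+ 2)^-1 * mesh) ^+ 2 *
     (16 * pi * (3 / 2 * ds d + mesh) ^+ 2))%:E * norm_sq f)%E.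
Proof.
have /L2P[mf ffin fO] := fL; have del0 := ds_gt0 d.
have eta0 : 0 <= mesh by rewrite addr_ge0 ?dphi_ge0// ltW// dx_gt0.
have K0 : 0 <= (ds d ^+ 2)^-1 * mesh by rewrite mulr_ge0// invr_ge0 sqr_ge0.
have b0 : 0 <= 3 / 2 * ds d + mesh by lra.
have D0 s phi : ~ OmegaA A (s, phi) -> discrete_sub_avg (s, phi) = 0.
  move=> yA; rewrite /discrete_sub_avg indicE memNset// mul0r subr0.
  by rewrite /discrete_radon /patch memNset.
apply: (norm_sq_strip_le mf fO b0 K0 _ _ measurable_discrete_sub_avg) => s phi.
  by move=> nphi; apply: D0 => -[_ /= /(discretization_range d)].
have [yA|yA] := pselect (OmegaA A (s, phi)); last first.
  rewrite D0// normr0 mule_ge0//; apply: integral_ge0 => x _.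
  by rewrite lee_fin mulr_ge0// ler0n.
have [_ /= phiA] := yA.
pose k x := discrete_kernel d (s, phi) x - lattice_kernel (ds d) c s (dot_angle x phi).
have mk1 : measurable_fun setT (discrete_kernel d (s, phi)).
  apply: (measurableT_comp (measurable_discrete_kernel d) (g := fun x => ((s, phi), x))).
  by meas.
have mk2 : measurable_fun setT (fun x => lattice_kernel (ds d) c s (dot_angle x phi)).
  apply: (measurableT_comp (measurable_lattice_kernel c del0)
    (g := fun x => (s, dot_angle x phi))).
  by meas.
have [M kM] := discrete_kernel_bounded d.
have i1 := integrable_bounded_mul mf fO ffin mk1 (kM (s, phi)).
have i2 := integrable_bounded_mul mf fO ffin mk2
  (fun x => lattice_kernel_abs_le c del0 s (dot_angle x phi)).
have -> : discrete_sub_avg (s, phi) = inner k f.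
  rewrite /discrete_sub_avg (discrete_radonE d fL) indicE mem_set// mul1r.
  rewrite (avg_radonE c del0 mf fO ffin s phiA).
  rewrite /inner -RintegralB//; congr fine; apply: eq_integral => x _.
  by rewrite /k mulrBl.
apply: (@le_trans _ _ (\int[mu2]_x `|k x * f x|%:E)%E).
  apply: (@le_trans _ _ `|\int[mu2]_x (k x * f x)%:E|%E).
    by rewrite /inner /Rintegral; case: (\int[mu2]_x _)%E => //=; rewrite normr0 leey.
  by apply: le_abse_integral => //; rewrite /k; meas.
rewrite -ge0_integralZl//; last 2 first.
- by rewrite /strip; meas.
- by move=> x _; rewrite lee_fin mulr_ge0// ler0n.
apply: le_ge0_integral => x; first by rewrite lee_fin.
rewrite -EFinM lee_fin normrM mulrA.
have [xO|xO] := pselect (Omega x); last by rewrite fO// normr0 !mulr0.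
by apply: ler_wpM2r => //; exact: discrete_sub_lattice_kernel.
Qed.

Lemma L2_discrete_radon : L2 (OmegaA A) (discrete_radon d f).
Proof.
have [M kM] := discrete_kernel_bounded d.
rewrite (discrete_radonE d fL).
exact: (L2_kernel_op (@Omega_measurable R) (OmegaA_measurable d) (@mu2_Omega_lty R)
  (mu2_OmegaA_lty d) (measurable_discrete_kernel d) kM (discrete_kernel_eq0 d) fL).
Qed.

End Apply.

Lemma discrete_radon_adjoint_exists g : L2 (OmegaA A) g ->
  exists h, L2 Omega h /\
    forall f, L2 Omega f -> inner (discrete_radon d f) g = inner f h.
Proof.
move=> gL; have [M kM] := discrete_kernel_bounded d.
exists (fun x => inner (fun y => \1_Omega x * discrete_kernel d y x) g); split.
  have mI : measurable_fun setT (\1_Omega : R * R -> R).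
    exact: measurable_indic (@Omega_measurable R).
  apply: (L2_kernel_op (M := M) (k := fun x y => \1_Omega x * discrete_kernel d y x)
    (OmegaA_measurable d) (@Omega_measurable R) (mu2_OmegaA_lty d) (@mu2_Omega_lty R)) => //.
  - have mk : measurable_fun setT (fun z : (R * R) * (R * R) => discrete_kernel d z.2 z.1).
      apply: (measurableT_comp (measurable_discrete_kernel d)
        (g := fun z : (R * R) * (R * R) => (z.2, z.1))).
      by meas.
    by meas.
  - move=> x y; rewrite normrM indicE normr_nat; case: (x \in Omega).
      by rewrite mul1r.
    by rewrite mul0r (le_trans _ (kM (0, 0) (0, 0))).
  - by move=> x y xO; rewrite indicE memNset// mul0r.
move=> f fL; rewrite (discrete_radonE d fL).
exact: (kernel_op_adjointE (@Omega_measurable R) (OmegaA_measurable d) (@mu2_Omega_lty R)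
  (mu2_OmegaA_lty d) (measurable_discrete_kernel d) kM fL gL).
Qed.

End DiscreteSubAvg.

(** * Error estimates *)

Section NormSq.
Context {R : realType}.
Implicit Types (u v : R * R -> R).

(** A triangle inequality up to a factor 2, from [(x + y) ^ 2 <= 2 * x ^ 2 + 2 * y ^ 2]; rates are
    unaffected. *)
Lemma norm_sq_add_le u v (a b : R) :
  measurable_fun setT u -> measurable_fun setT v -> 0 <= a -> 0 <= b ->
  (norm_sq u <= (a ^+ 2)%:E)%E -> (norm_sq v <= (b ^+ 2)%:E)%E ->
  (norm_sq (fun y => u y + v y)%R <= ((2 * (a + b)) ^+ 2)%:E)%E.
Proof.
move=> mu_ mv a0 b0 ua vb.
apply: (@le_trans _ _ (\int[mu2]_y ((2 * u y ^+ 2)%:E + (2 * v y ^+ 2)%:E))%E).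
  apply: le_ge0_integral => y; first by rewrite lee_fin sqr_ge0.
  by rewrite -EFinD lee_fin; have := sqr_ge0 (u y - v y); nra.
rewrite ge0_integralD; last 5 first.
- exact: measurableT.
- by move=> x _; rewrite lee_fin mulr_ge0// sqr_ge0.
- by meas.
- by move=> x _; rewrite lee_fin mulr_ge0// sqr_ge0.
- by meas.
have H (w : R * R -> R) : measurable_fun setT w ->
    (\int[mu2]_y (2 * w y ^+ 2)%:E = 2%:E * norm_sq w)%E.
  move=> mw; under eq_integral do rewrite EFinM.
  by rewrite ge0_integralZl//; [meas|move=> x _; rewrite lee_fin sqr_ge0].
rewrite H// H//.
apply: (@le_trans _ _ (2%:E * (a ^+ 2)%:E + 2%:E * (b ^+ 2)%:E)%E).
  by apply: leeD; apply: lee_wpmul2l.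
by rewrite -!EFinM -EFinD lee_fin; nra.
Qed.

Lemma inner_le u v (a b : R) :
  measurable_fun setT u -> measurable_fun setT v -> 0 <= a -> 0 <= b ->
  (norm_sq u <= (a ^+ 2)%:E)%E -> (norm_sq v <= (b ^+ 2)%:E)%E ->
  `|inner u v| <= a * b.
Proof.
move=> mu_ mv a0 b0 ua vb.
have CS := @cauchy_schwarz_integral R _ _ mu2 u v mu_ mv.
have le : (`|inner u v|%:E <= \int[mu2]_x `|u x * v x|%:E)%E.
  apply: (@le_trans _ _ `|\int[mu2]_x (u x * v x)%:E|%E).
    by rewrite /inner /Rintegral; case: (\int[mu2]_x _)%E => //=; rewrite normr0 leey.
  by apply: le_abse_integral => //; meas.
have : (`|inner u v|%:E * `|inner u v|%:E <= (a ^+ 2)%:E * (b ^+ 2)%:E)%E.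
  apply: (@le_trans _ _ ((\int[mu2]_x `|u x * v x|%:E) * (\int[mu2]_x `|u x * v x|%:E))%E).
    by apply: lee_pmul.
  by apply: (le_trans CS); apply: lee_pmul => //; exact: norm_sq_ge0.
rewrite -!EFinM lee_fin -expr2 -exprMn ler_pXn2r// nnegrE//.
exact: mulr_ge0.
Qed.

Lemma inner_self u : inner u u = fine (norm_sq u).
Proof.
by rewrite /inner /Rintegral /norm_sq; congr fine; apply: eq_integral => x _; rewrite expr2.
Qed.

Lemma norm_sq_sqrt u : (norm_sq u < +oo)%E ->
  norm_sq u = (Num.sqrt (fine (norm_sq u)) ^+ 2)%:E.
Proof.
move=> ufin; have u0 := norm_sq_ge0 u.
by rewrite sqr_sqrtr ?fine_ge0// fineK// ge0_fin_numE.
Qed.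

Lemma inner_subl u v w : (norm_sq u < +oo)%E -> (norm_sq v < +oo)%E ->
  (norm_sq w < +oo)%E ->
  measurable_fun setT u -> measurable_fun setT v -> measurable_fun setT w ->
  inner (fun y => u y - v y) w = inner u w - inner v w.
Proof.
move=> uf vf wf mu_ mv mw; rewrite /inner.
rewrite -RintegralB//; [|exact: integrable_mul_norm_sq..].
by congr fine; apply: eq_integral => x _; rewrite mulrBl.
Qed.

Lemma innerC u v : inner u v = inner v u.
Proof. by congr fine; apply: eq_integral => x _; rewrite mulrC. Qed.

End NormSq.

Section Estimates.
Context {R : realType}.
Local Notation mu := (@lebesgue_measure R).
Variables (A : set R) (d : discretization A).
Hypothesis A_proper : A <> `[- pi, pi[%classic.
Implicit Types (f g : R * R -> R) (y : R * R).
Local Notation c := ((nP d).+1%:R / 2).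

Let mA := discretization_measurable d.
Let A_pi := @discretization_range R A d.

Definition mesh_ratio : R := dx d / ds d + dphi d / ds d.
(** The bound of [norm_sq_discrete_sub_avg_le] after a square root; 8 comes from [16 * pi <= 64]. *)
Definition kernel_error : R := 8 * mesh_ratio * (3 / 2 + mesh_ratio).

Lemma mesh_ratio_ge0 : 0 <= mesh_ratio.
Proof.
rewrite /mesh_ratio addr_ge0// divr_ge0 ?dphi_ge0//; exact: ltW (ds_gt0 d) || exact: ltW (dx_gt0 d).
Qed.

Lemma kernel_error_ge0 : 0 <= kernel_error.
Proof. by have := mesh_ratio_ge0; rewrite /kernel_error => ?; rewrite !mulr_ge0// addr_ge0. Qed.

Let pi4 : pi <= 4 :> R.
Proof. by have := pihalf_lt2 R; lra. Qed.

Lemma norm_sq_discrete_sub_avg f (N : R) : L2 Omega f -> 0 <= N ->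
  (norm_sq f <= (N ^+ 2)%:E)%E ->
  (norm_sq (discrete_sub_avg d f) <= ((kernel_error * N) ^+ 2)%:E)%E.
Proof.
move=> fL N0 fN; apply: (le_trans (norm_sq_discrete_sub_avg_le d A_proper fL)).
have del0 := ds_gt0 d.
have -> : (ds d ^+ 2)^-1 * (dx d + dphi d) = mesh_ratio / ds d.
  by rewrite /mesh_ratio; field; rewrite gt_eqF.
have -> : 3 / 2 * ds d + (dx d + dphi d) = ds d * (3 / 2 + mesh_ratio).
  by rewrite /mesh_ratio; field; rewrite gt_eqF.
set r := mesh_ratio.
have -> : (r / ds d) ^+ 2 * (16 * pi * (ds d * (3 / 2 + r)) ^+ 2) =
    16 * pi * (r * (3 / 2 + r)) ^+ 2.
  by field; rewrite gt_eqF.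
have p0 := pi_ge0 R.
apply: (@le_trans _ _ ((16 * pi * (r * (3 / 2 + r)) ^+ 2)%:E * (N ^+ 2)%:E)%E).
  apply: lee_wpmul2l => //; rewrite lee_fin; apply: mulr_ge0; last exact: sqr_ge0.
  by rewrite mulr_ge0.
rewrite -EFinM lee_fin /kernel_error -/r.
have -> : (8 * r * (3 / 2 + r) * N) ^+ 2 = 16 * 4 * (r * (3 / 2 + r)) ^+ 2 * N ^+ 2 by ring.
by rewrite !ler_wpM2r ?sqr_ge0// ler_wpM2l.
Qed.

Lemma discrete_sub_radonE f y : L2 Omega f ->
  discrete_radon d f y - radon A f y = discrete_sub_avg d f y +
    \1_(OmegaA A) y * (avg (ds d) c (radon A f) y.1 y.2 - radon A f y).
Proof.
move=> fL; rewrite /discrete_sub_avg mulrBr addrA subrK; congr (_ - _).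
rewrite indicE; case: (boolP (y \in OmegaA A)) => yA; first by rewrite mul1r.
by rewrite mul0r /radon /patch (negbTE yA).
Qed.

Section Fixed.
Variable f : R * R -> R.
Hypothesis fL : L2 Omega f.
Let u := radon A f.

Let mf : measurable_fun setT f. Proof. by have /L2P[] := fL. Qed.
Let ffin : (norm_sq f < +oo)%E. Proof. by have /L2P[] := fL. Qed.
Let fO : forall x, ~ Omega x -> f x = 0. Proof. by have /L2P[] := fL. Qed.
Let m_u : measurable_fun setT u. Proof. exact: measurable_radon. Qed.

Lemma L2_radon : L2 (OmegaA A) u.
Proof.
apply/L2P; split => //.
  apply: (le_lt_trans (norm_sq_radon_le mA A_pi mf fO)).
  by rewrite lte_mul_pinfty// lee_fin mulr_ge0// pi_ge0.
by move=> y yA; rewrite /u /radon /patch memNset.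
Qed.

Let u_fin : (norm_sq u < +oo)%E. Proof. by have /L2P[] := L2_radon. Qed.

Let mI : measurable_fun setT (\1_(OmegaA A) : R * R -> R).
Proof. exact: measurable_indic (OmegaA_measurable d). Qed.

Let w y := \1_(OmegaA A) y * (avg (ds d) c u y.1 y.2 - u y).

Let mw : measurable_fun setT w.
Proof. by have ma := measurable_avg c (ds_gt0 d) m_u; rewrite /w; meas. Qed.

Let norm_sq_w : (norm_sq w <= dispersion (ds d) c u)%E.
Proof.
apply: (@le_trans _ _ (norm_sq (fun y => avg (ds d) c u y.1 y.2 - u y)%R)).
  apply: le_ge0_integral => y; first by rewrite lee_fin sqr_ge0.
  by rewrite lee_fin /w exprMn ler_piMl ?sqr_ge0//.
apply: (integral_avg_sub_sqr_le c (ds_gt0 d) m_u).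
exact: integral_abs_radon_lty.
Qed.

Lemma norm_sq_discrete_sub_radon (N e : R) : 0 <= N -> 0 <= e ->
  (norm_sq f <= (N ^+ 2)%:E)%E ->
  (dispersion (ds d) c u <= (e ^+ 2)%:E)%E ->
  (norm_sq (discrete_radon d f \- u)%R <= ((2 * (kernel_error * N + e)) ^+ 2)%:E)%E.
Proof.
move=> N0 e0 fN ue.
rewrite (_ : _ \- _ = (fun y => discrete_sub_avg d f y + w y)); last first.
  by apply/funext => y; rewrite -discrete_sub_radonE.
apply: norm_sq_add_le => //.
- exact: measurable_discrete_sub_avg.
- by rewrite mulr_ge0// kernel_error_ge0.
- exact: norm_sq_discrete_sub_avg.
- exact: le_trans norm_sq_w ue.
Qed.

(** Shifts up to [3 / 2 * ds] give [3 * 64 * pi * 3 / 2 = 288 * pi], at most 1152, and 34 squared is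
    1156. *)
Lemma dispersion_radon_le (N : R) : 0 <= N -> (norm_sq f <= (N ^+ 2)%:E)%E ->
  (dispersion (ds d) c u <= ((34 * Num.sqrt (ds d) * N) ^+ 2)%:E)%E.
Proof.
move=> N0 fN; have del0 := ds_gt0 d; have p0 := pi_ge0 R.
have K0 : 0 <= 64 * pi * (3 / 2 * ds d) * N ^+ 2.
  by rewrite !mulr_ge0 ?sqr_ge0// ltW.
apply: (le_trans (dispersion_le c del0 m_u K0 _)) => [h hd|].
  apply: (le_trans (shift_sq_radon_le mA A_pi mf fO ffin h)).
  rewrite [leRHS]EFinM; apply: lee_pmul => //.
  - by rewrite lee_fin !mulr_ge0.
  - exact: norm_sq_ge0.
  - by rewrite lee_fin ler_wpM2l// mulr_ge0.
rewrite lee_fin !exprMn sqr_sqrtr; last exact: ltW.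
have -> : 3 * (64 * pi * (3 / 2 * ds d) * N ^+ 2) = 288 * pi * (ds d * N ^+ 2) by field.
rewrite -[leRHS]mulrA; apply: ler_wpM2r; first by rewrite mulr_ge0 ?sqr_ge0// ltW.
by have := pi4; lra.
Qed.

(** The kernel error is paired with [g] by Cauchy-Schwarz, the averaging error by [avg_pairing]. The
    factor 4 bounds the norm of the Radon transform, as [4 * pi <= 16]. *)
Lemma inner_discrete_sub_radon g (N G e : R) : L2 (OmegaA A) g ->
  0 <= N -> 0 <= G -> 0 <= e ->
  (norm_sq f <= (N ^+ 2)%:E)%E -> (norm_sq g <= (G ^+ 2)%:E)%E ->
  (dispersion (ds d) c g <= (e ^+ 2)%:E)%E ->
  `|inner (discrete_radon d f \- u) g| <= (kernel_error * G + 4 * e) * N.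
Proof.
move=> /L2P[mg gfin gA] N0 G0 e0 fN gG ge.
have del0 := ds_gt0 d; have p0 := pi_ge0 R; have k0 := kernel_error_ge0.
have mD := measurable_discrete_sub_avg d fL.
have Dle := norm_sq_discrete_sub_avg fL N0 fN.
have Dfin : (norm_sq (discrete_sub_avg d f) < +oo)%E by apply: le_lt_trans Dle (ltry _).
have uN : (norm_sq u <= ((4 * N) ^+ 2)%:E)%E.
  apply: (le_trans (norm_sq_radon_le mA A_pi mf fO)).
  apply: (@le_trans _ _ ((4 * pi)%:E * (N ^+ 2)%:E)%E).
    by apply: lee_wpmul2l => //; rewrite lee_fin mulr_ge0.
  rewrite -EFinM lee_fin exprMn ler_wpM2r ?sqr_ge0//.
  by have := pi4; lra.
have wfin : (norm_sq w < +oo)%E.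
  apply: (le_lt_trans norm_sq_w).
  exact: le_lt_trans (dispersion_radon_le N0 fN) (ltry _).
have -> : inner (discrete_radon d f \- u) g =
    inner (discrete_sub_avg d f) g + inner w g.
  rewrite /inner -RintegralD//; [|exact: integrable_mul_norm_sq..].
  congr fine; apply: eq_integral => y _; rewrite -mulrDl.
  by rewrite -discrete_sub_radonE.
apply: le_trans (ler_normD _ _) _; rewrite mulrDl; apply: lerD.
  have := inner_le mD mg (mulr_ge0 k0 N0) G0 Dle gG.
  by rewrite mulrAC.
(* The cut-off in [w] is absorbed by [g], which vanishes outside [OmegaA A]. *)
have -> : inner w g = inner (fun y => avg (ds d) c u y.1 y.2 - u y) g.
  congr fine; apply: eq_integral => y _; rewrite /w indicE.
  have [yA|yA] := pselect (OmegaA A y); first by rewrite mem_set// mul1r.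
  by rewrite (gA y yA) !mulr0.
apply: (avg_pairing del0 m_u mg u_fin gfin).
  by rewrite !mulr_ge0.
apply: (@le_trans _ _ (((4 * N) ^+ 2)%:E * (e ^+ 2)%:E)%E).
  apply: lee_pmul; [exact: norm_sq_ge0|exact: dispersion_ge0|exact: uN|exact: ge].
by rewrite -EFinM lee_fin -exprMn (_ : 4 * N * e = 4 * e * N)//; ring.
Qed.

End Fixed.

(** [adjoint] falls back on 0 when no element represents the pairing, so existence has to be
    supplied for each operator. *)
Lemma adjointP T g : (exists h, L2 Omega h /\
    forall f, L2 Omega f -> inner (T f) g = inner f h) ->
  L2 Omega (adjoint Omega T g) /\
  forall f, L2 Omega f -> inner (T f) g = inner f (adjoint Omega T g).
Proof. by rewrite /adjoint => -[h hP]; case: xgetP => [h' -> //|/(_ h)]. Qed.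

(** The pairing bound is left as a hypothesis to serve twice: with the operator error for a general
    [g], and with the dispersion of [g] for a regular one. *)
Lemma norm_sq_adjoint_sub g (C : R) : L2 (OmegaA A) g -> 0 <= C ->
  (forall f N, L2 Omega f -> 0 <= N -> (norm_sq f <= (N ^+ 2)%:E)%E ->
    `|inner (discrete_radon d f \- radon A f) g| <= C * N) ->
  (norm_sq (adjoint Omega (discrete_radon d) g \- adjoint Omega (radon A) g)%R
    <= (C ^+ 2)%:E)%E.
Proof.
move=> gL C0 HC; have /L2P[mg gfin gA] := gL.
have [h1L h1P] := adjointP (discrete_radon_adjoint_exists d gL).
have [h2L h2P] : L2 Omega (adjoint Omega (radon A) g) /\
    forall f, L2 Omega f -> inner (radon A f) g = inner f (adjoint Omega (radon A) g).
  apply: adjointP; exists (backprojection g); split.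
    exact: (L2_backprojection A_pi mg gA gfin).
  by move=> f fL; exact: radon_adjointE.
set h1 := adjoint Omega (discrete_radon d) g in h1L h1P *.
set h2 := adjoint Omega (radon A) g in h2L h2P *.
have /L2P[m1 f1 o1] := h1L; have /L2P[m2 f2 o2] := h2L.
pose v := h1 \- h2.
have mv : measurable_fun setT v by exact: measurable_funB.
have vfin : (norm_sq v < +oo)%E.
  have := norm_sq_add_le m1 (measurable_fun_opp m2) (sqrtr_ge0 _) (sqrtr_ge0 _).
  move=> /(_ (fine (norm_sq h1)) (fine (norm_sq h2))) H.
  apply: le_lt_trans (H _ _) (ltry _); first by rewrite -norm_sq_sqrt.
  rewrite -norm_sq_sqrt//; apply: le_ge0_integral => y; first by rewrite lee_fin sqr_ge0.
  by rewrite sqrrN.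
have vL : L2 Omega v by apply/L2P; split => // x xO; rewrite /v /= o1// o2// subrr.
set N := Num.sqrt (fine (norm_sq v)).
have vN : norm_sq v = (N ^+ 2)%:E by exact: norm_sq_sqrt.
have N0 : 0 <= N by exact: sqrtr_ge0.
have /L2P[mR fR _] := L2_radon vL.
have /L2P[mD fD _] := L2_discrete_radon d vL.
have : N ^+ 2 <= C * N.
  apply: le_trans (HC v N vL N0 _); last by rewrite vN.
  have -> : inner (discrete_radon d v \- radon A v) g = N ^+ 2.
    rewrite inner_subl// h1P// h2P// innerC [inner v h2]innerC.
    by rewrite -inner_subl// inner_self vN.
  by rewrite ger0_norm// sqr_ge0.
rewrite vN lee_fin ler_pXn2r//.
have [->//|Nn0] := eqVneq N 0.
by rewrite expr2 ler_pM2r// lt_neqAle eq_sym Nn0.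
Qed.

End Estimates.

Section OperatorBounds.
Context {R : realType}.
Implicit Types (f g : R * R -> R) (D : set (R * R)).

Lemma opnorm_ge0 D (T : (R * R -> R) -> (R * R -> R)) : (0 <= opnorm D T)%E.
Proof.
apply: (@le_trans _ _ (normL2 (T (cst 0)))); first exact: normL2_ge0.
have n0 : norm_sq (cst 0 : R * R -> R) = 0%E.
  by rewrite /norm_sq integral0_eq// => x _; rewrite /= expr0n.
apply: ereal_sup_ubound; exists (cst 0) => //; split.
  by apply/L2P; split => //; rewrite n0 ltry.
by apply/normL2_le => //; rewrite n0 lee_fin sqr_ge0.
Qed.

Lemma opnorm_le D (T : (R * R -> R) -> (R * R -> R)) (C : R) : 0 <= C ->
  (forall f, L2 D f -> (norm_sq f <= 1)%E -> (norm_sq (T f) <= (C ^+ 2)%:E)%E) ->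
  (opnorm D T <= C%:E)%E.
Proof.
move=> C0 TC; apply: ge_ereal_sup => _ [f [fL f1] <-].
apply/normL2_le => //; apply: TC => //.
by have /normL2_le := f1; rewrite expr1n => /(_ ler01).
Qed.

Variables (A : set R) (d : discretization A).
Hypothesis A_proper : A <> `[- pi, pi[%classic.

(** The term in [Num.sqrt (ds d)] comes from the dispersion of a general Radon transform and
    confines the rate to exponents at most one half. *)
Definition operator_error : R := 2 * (kernel_error d + 34 * Num.sqrt (ds d)).

Lemma operator_error_ge0 : 0 <= operator_error.
Proof. by rewrite mulr_ge0// addr_ge0 ?kernel_error_ge0// mulr_ge0// sqrtr_ge0. Qed.

Lemma norm_sq_operator_error f (N : R) : L2 Omega f -> 0 <= N ->
  (norm_sq f <= (N ^+ 2)%:E)%E ->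
  (norm_sq (discrete_radon d f \- radon A f)%R <= ((operator_error * N) ^+ 2)%:E)%E.
Proof.
move=> fL N0 fN.
have -> : operator_error * N = 2 * (kernel_error d * N + 34 * Num.sqrt (ds d) * N).
  by rewrite /operator_error; ring.
apply: (norm_sq_discrete_sub_radon A_proper fL) => //.
- by rewrite !mulr_ge0// sqrtr_ge0.
- exact: dispersion_radon_le.
Qed.

Lemma opnorm_discrete_sub_radon :
  (opnorm Omega (fun f => discrete_radon d f \- radon A f)%R <= operator_error%:E)%E.
Proof.
apply: opnorm_le => [|f fL f1]; first exact: operator_error_ge0.
rewrite -[operator_error]mulr1; apply: norm_sq_operator_error => //.
by rewrite expr1n.
Qed.

Lemma opnorm_adjoint_sub :
  (opnorm (OmegaA A) (fun g => adjoint Omega (discrete_radon d) g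
                               \- adjoint Omega (radon A) g)%R <= operator_error%:E)%E.
Proof.
apply: opnorm_le => [|g gL g1]; first exact: operator_error_ge0.
apply: (norm_sq_adjoint_sub gL) => [|f N fL N0 fN].
  exact: operator_error_ge0.
have /L2P[mg _ _] := gL; have /L2P[mf _ fO] := fL.
rewrite -[leRHS]mulr1; apply: inner_le => //.
- apply: measurable_funB; first exact: measurable_discrete_radon.
  exact: (measurable_radon (discretization_measurable d) mf fO).
- by rewrite mulr_ge0// operator_error_ge0.
- exact: norm_sq_operator_error.
- by rewrite expr1n.
Qed.

End OperatorBounds.

(** * From the offset modulus to the dispersion *)

Section Modulus.
Context {R : realType}.
Local Notation mu := (@lebesgue_measure R).
Variables (A : set R) (g : R * R -> R).
Hypothesis mg : measurable_fun setT g.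
Hypothesis gA : forall s phi, ~ A phi -> g (s, phi) = 0.

Lemma shift_sq_offset_modulus (h b : R) : 0 <= b ->
  (offset_modulus A g h <= b%:E)%E -> (shift_sq g h <= (b ^+ 2)%:E)%E.
Proof.
move=> b0; rewrite /offset_modulus.
set X := (\int[mu]_(phi in A) _)%E.
have -> : shift_sq g h = X.
  rewrite /X integral_mkcond /shift_sq tonelli_mu2_swap; last 2 first.
  - by meas.
  - by move=> z; rewrite lee_fin sqr_ge0.
  apply: eq_integral => phi _; rewrite patchE; case: ifPn => [_|/negP phiA].
    by apply: eq_integral => s _; rewrite real_normK ?num_real.
  rewrite integral0_eq// => s _ /=.
  by rewrite !gA ?subrr ?expr0n// => /mem_set.
have X0 : (0 <= X)%E.
  by apply: integral_ge0 => phi _; apply: integral_ge0 => s _; rewrite lee_fin sqr_ge0.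
rewrite poweR12_sqrt//; move: X0; case: X => [x|_|//] /=.
  rewrite !lee_fin => x0 xb; rewrite -[x]sqr_sqrtr//.
  by rewrite ler_pXn2r// nnegrE sqrtr_ge0.
by rewrite leNgt ltry.
Qed.

Lemma dispersion_rate (eps : R) : 0 < eps ->
  ebigO 0^' (offset_modulus A g) (fun h => `|h| `^ eps) ->
  exists2 C : R, 0 <= C & exists2 r : R, 0 < r &
    forall del c, 0 < del < r ->
      (dispersion del c g <= ((C * del `^ eps) ^+ 2)%:E)%E.
Proof.
move=> eps0 [ofin /eqO_exP[k k0 ok]].
have : \forall h \near (0 : R)^', (offset_modulus A g h <= (k * `|h| `^ eps)%:E)%E.
  apply: filterS2 ofin ok => h hfin hk; rewrite -(fineK hfin) lee_fin.
  apply: le_trans (ler_norm _) _; apply: (le_trans hk).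
  by rewrite (ger0_norm (powR_ge0 _ _)).
rewrite near_withinE => /nbhs_ballP[r /= r0 H].
(* The 2 absorbs the square root of the factor 3 in [dispersion_le]; [3 / 2] is the range of the
   shifts in units of [del]. *)
exists (2 * k * (3 / 2) `^ eps); first by rewrite !mulr_ge0 ?powR_ge0// ltW.
(* With [del < r / 2], shifts up to [3 / 2 * del] remain below [r]. *)
exists (r / 2); first by rewrite divr_gt0.
move=> del c /andP[del0 delr].
pose b : R := k * (3 / 2 * del) `^ eps.
have b0 : 0 <= b by rewrite mulr_ge0 ?powR_ge0// ltW.
apply: (le_trans (@dispersion_le _ _ c del0 g (b ^+ 2) mg (sqr_ge0 b) _)) => [h hd|].
  (* The hypothesis concerns a punctured neighbourhood of 0, so the zero shift is treated apart. *)
  have [->|h0] := eqVneq h 0.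
    rewrite /shift_sq integral0_eq ?lee_fin ?sqr_ge0// => z _.
    by rewrite addr0 -surjective_pairing subrr expr0n.
  apply: shift_sq_offset_modulus => //.
  apply: (le_trans (H h _ h0)).
    by rewrite -ball_normE /= sub0r normrN; lra.
  rewrite lee_fin ler_wpM2l ?(ltW k0)//.
  by apply: ge0_ler_powR => //; rewrite ?nnegrE// ?(ltW eps0)//; lra.
rewrite lee_fin /b powRM//; last exact: ltW.
set p := _ `^ eps; set q := del `^ eps.
have -> : (2 * k * p * q) ^+ 2 = 4 * (k * (p * q)) ^+ 2 by ring.
by rewrite ler_wpM2r ?sqr_ge0//; lra.
Qed.

End Modulus.

(** * Limits and rates along a filter *)

Section Asymptotics.
Context {R : realType} {I : Type} (F : filter_on I).
Implicit Types (u : I -> \bar R) (v : I -> R).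

Lemma ebigO_le u v (C : R) : 0 <= C ->
  (\forall i \near F, (0 <= u i <= (C * v i)%:E)%E) -> ebigO F u v.
Proof.
move=> C0 uC; split.
  apply: filterS uC => i /andP[u0 uC]; rewrite ge0_fin_numE//.
  exact: le_lt_trans uC (ltry _).
(* The constant must be positive, whereas [C] may be 0. *)
apply/eqO_exP; exists (C + 1); first by rewrite ltr_wpDl.
apply: filterS uC => i /= /andP[]; case: (u i) => [x|//|//].
rewrite !lee_fin /= => x0 xC; rewrite ger0_norm//; apply: (le_trans xC).
apply: (@le_trans _ _ (C * `|v i|)); first by rewrite ler_wpM2l// ler_norm.
by rewrite ler_wpM2r// lerDl.
Qed.

Variables (A : set R) (d : I -> discretization A).
Hypothesis ds_cvg : ds (d i) @[i --> F] --> (0 : R).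

Lemma ds_near (r : R) : 0 < r -> \forall i \near F, 0 < ds (d i) < r.
Proof.
move=> r0; have /cvgr0Pnorm_lt/(_ r r0) := ds_cvg; apply: filterS => i.
by rewrite ger0_norm ?ltW ?ds_gt0// => ->.
Qed.

Lemma kernel_error_rate (eps : R) : 0 < eps ->
  (fun i => dphi (d i)) =O_F (fun i => ds (d i) `^ (1 + eps)) ->
  (fun i => dx (d i)) =O_F (fun i => ds (d i) `^ (1 + eps)) ->
  exists2 C : R, 0 <= C & \forall i \near F, kernel_error (d i) <= C * ds (d i) `^ eps.
Proof.
move=> eps0 /eqO_exP[k1 k10 H1] /eqO_exP[k2 k20 H2].
(* Division by [ds] leaves [mesh_ratio <= (k1 + k2) * ds ^ eps]; in the second factor of
   [kernel_error] the power is bounded by 1, as [ds < 1] eventually. *)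
exists (8 * (k1 + k2) * (3 / 2 + (k1 + k2))).
  by rewrite !mulr_ge0// ?addr_ge0// ltW.
apply: filterS3 H1 H2 (ds_near ltr01) => i h1 h2 /andP[d0 d1].
have p0 : 0 <= ds (d i) `^ eps by exact: powR_ge0.
have p1 : ds (d i) `^ eps <= 1.
  have -> : 1 = 1 `^ eps :> R by rewrite powR1.
  by apply: ge0_ler_powR; rewrite ?nnegrE// ltW.
have bnd (x k : R) : 0 <= x -> `|x| <= k * `|ds (d i) `^ (1 + eps)| ->
    x / ds (d i) <= k * ds (d i) `^ eps.
  move=> x0; rewrite ger0_norm// ger0_norm ?powR_ge0// powRD; last first.
    by rewrite (gt_eqF d0) implybT.
  by rewrite (powRr1 (ltW d0)) => xk; rewrite ler_pdivrMr// -mulrA [_ `^ eps * _]mulrC.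
have r1 := bnd _ _ (dphi_ge0 _) h1.
have r2 := bnd _ _ (ltW (dx_gt0 _)) h2.
have r0 := mesh_ratio_ge0 (d i).
rewrite /kernel_error; move: r0; rewrite /mesh_ratio.
set r := _ + _ => r0.
have rk : r <= (k1 + k2) * ds (d i) `^ eps by rewrite /r; lra.
have rk1 : r <= k1 + k2.
  by apply: (le_trans rk); rewrite ler_piMr// addr_ge0// ltW.
have -> : 8 * (k1 + k2) * (3 / 2 + (k1 + k2)) * ds (d i) `^ eps =
  8 * ((k1 + k2) * ds (d i) `^ eps) * (3 / 2 + (k1 + k2)) by ring.
apply: ler_pM => //; last by rewrite lerD2l.
- by rewrite mulr_ge0.
- by rewrite addr_ge0.
- by rewrite ler_wpM2l.
Qed.

Lemma kernel_error_cvg :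
  dphi (d i) / ds (d i) @[i --> F] --> (0 : R) ->
  dx (d i) / ds (d i) @[i --> F] --> (0 : R) ->
  kernel_error (d i) @[i --> F] --> (0 : R).
Proof.
move=> h1 h2.
have r0 : mesh_ratio (d i) @[i --> F] --> (0 : R).
  by rewrite -[0 : R]addr0; exact: cvgD h2 h1.
rewrite (_ : (0 : R) = 8 * 0 * (3 / 2 + 0)); last by rewrite mulr0 mul0r.
by apply: cvgM; [apply: cvgM => //; exact: cvg_cst|apply: cvgD => //; exact: cvg_cst].
Qed.

Lemma operator_error_cvg :
  dphi (d i) / ds (d i) @[i --> F] --> (0 : R) ->
  dx (d i) / ds (d i) @[i --> F] --> (0 : R) ->
  (operator_error (d i))%:E @[i --> F] --> 0%E.
Proof.
move=> h1 h2; have k0 := kernel_error_cvg h1 h2.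
apply: cvg_EFin; first exact: filterE.
rewrite [X in _ --> X](_ : _ = 2 * (0 + 34 * Num.sqrt 0) :> R); last first.
  by rewrite sqrtr0 mulr0 addr0 mulr0.
apply: cvgM; first exact: cvg_cst.
apply: cvgD => //; apply: cvgM; first exact: cvg_cst.
by apply: continuous_cvg => //; exact: sqrt_continuous.
Qed.

Lemma operator_error_rate (eps : R) : 0 < eps <= 2^-1 ->
  (fun i => dphi (d i)) =O_F (fun i => ds (d i) `^ (1 + eps)) ->
  (fun i => dx (d i)) =O_F (fun i => ds (d i) `^ (1 + eps)) ->
  exists2 C : R, 0 <= C & \forall i \near F, operator_error (d i) <= C * ds (d i) `^ eps.
Proof.
move=> /andP[eps0 eps1] h1 h2.
have [K K0 HK] := kernel_error_rate eps0 h1 h2.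
exists (2 * (K + 34)); first by rewrite mulr_ge0// addr_ge0.
apply: filterS2 HK (ds_near ltr01) => i Ki /andP[d0 d1].
(* For [ds <= 1] the power decreases with the exponent, and [eps] is at most one half. *)
have : Num.sqrt (ds (d i)) <= ds (d i) `^ eps.
  rewrite -(powR12_sqrt (ltW d0)); apply: ger_powR => //.
  by rewrite d0 ltW.
by rewrite /operator_error; lra.
Qed.

End Asymptotics.

Theorem theorem2p15 (R : realType) (A : set R)
    (A_interval : open_interval_mod2pi A)
    (A_nonempty : A !=set0)
    (A_proper : A <> `[- pi, pi[%classic) :
  (forall (I : Type) (F : filter_on I)
          (d : I -> discretization A),
     ds (d i) @[i --> F] --> (0 : R) ->
     dphi (d i) / ds (d i) @[i --> F] --> (0 : R) ->
     dx (d i) / ds (d i) @[i --> F] --> (0 : R) ->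
     [/\ opnorm Omega (fun f => discrete_radon (d i) f \- radon A f)
           @[i --> F] --> 0%E,
         opnorm (OmegaA A) (fun g => adjoint Omega (discrete_radon (d i)) g
                                     \- adjoint Omega (radon A) g)
           @[i --> F] --> 0%E
       & forall eps : R, 0 < eps <= 2^-1 ->
           (fun i => dphi (d i)) =O_F (fun i => ds (d i) `^ (1 + eps)) ->
           (fun i => dx (d i)) =O_F (fun i => ds (d i) `^ (1 + eps)) ->
           ebigO F
             (fun i => opnorm Omega
                         (fun f => discrete_radon (d i) f \- radon A f))
             (fun i => ds (d i) `^ eps) /\
           ebigO F
             (fun i => opnorm (OmegaA A)
                         (fun g => adjoint Omega (discrete_radon (d i)) g
                                   \- adjoint Omega (radon A) g))
             (fun i => ds (d i) `^ eps)])
  /\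
  (forall (f : R * R -> R) (eps : R), L2 Omega f -> 0 < eps ->
     ebigO 0^' (offset_modulus A (radon A f)) (fun h => `|h| `^ eps) ->
     forall (I : Type) (F : filter_on I)
            (d : I -> discretization A),
       ds (d i) @[i --> F] --> (0 : R) ->
       (fun i => dphi (d i)) =O_F (fun i => ds (d i) `^ (1 + eps)) ->
       (fun i => dx (d i)) =O_F (fun i => ds (d i) `^ (1 + eps)) ->
       ebigO F (fun i => normL2 (discrete_radon (d i) f \- radon A f))
             (fun i => ds (d i) `^ eps))
  /\
  (forall (g : R * R -> R) (eps : R), L2 (OmegaA A) g -> 0 < eps ->
     ebigO 0^' (offset_modulus A g) (fun h => `|h| `^ eps) ->
     forall (I : Type) (F : filter_on I)
            (d : I -> discretization A),
       ds (d i) @[i --> F] --> (0 : R) ->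
       (fun i => dphi (d i)) =O_F (fun i => ds (d i) `^ (1 + eps)) ->
       (fun i => dx (d i)) =O_F (fun i => ds (d i) `^ (1 + eps)) ->
       ebigO F (fun i => normL2 (adjoint Omega (discrete_radon (d i)) g
                                 \- adjoint Omega (radon A) g))
             (fun i => ds (d i) `^ eps)).
Proof.
have mA : measurable (A : set (measurableTypeR R)).
  have [a [b ->]] := A_interval; apply: measurable_mod2pi; exact: measurable_itv.
split; last split.
- move=> I F d ds0 hphi hx; have err0 := operator_error_cvg ds0 hphi hx.
  split.
  + apply: squeeze_cvge (@cvg_cst _ _ _ _ _) err0; apply: filterE => i.
    by rewrite opnorm_ge0 opnorm_discrete_sub_radon.
  + apply: squeeze_cvge (@cvg_cst _ _ _ _ _) err0; apply: filterE => i.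
    by rewrite opnorm_ge0 opnorm_adjoint_sub.
  + move=> eps eps12 rphi rx.
    have [C C0 HC] := operator_error_rate ds0 eps12 rphi rx.
    split; apply: (ebigO_le C0); apply: filterS HC => i Ci.
      rewrite opnorm_ge0; apply: (le_trans (opnorm_discrete_sub_radon _ A_proper)).
      by rewrite lee_fin.
    rewrite opnorm_ge0; apply: (le_trans (opnorm_adjoint_sub _ A_proper)).
    by rewrite lee_fin.
- move=> f eps fL eps0 Hf I F d ds0 rphi rx.
  have /L2P[mf ffin fO] := fL.
  have [C C0 HC] := kernel_error_rate ds0 eps0 rphi rx.
  have mu_ := measurable_radon mA mf fO.
  have uA s phi : ~ A phi -> radon A f (s, phi) = 0.
    by move=> phiA; rewrite /radon /patch memNset// => -[].
  have [C' C'0 [r r0 Hr]] := dispersion_rate mu_ uA eps0 Hf.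
  (* The function is fixed, so its norm may enter the constant. *)
  set N := Num.sqrt (fine (norm_sq f)).
  have N0 : 0 <= N by exact: sqrtr_ge0.
  have fN : (norm_sq f <= (N ^+ 2)%:E)%E by rewrite -norm_sq_sqrt.
  apply: (ebigO_le (C := 2 * (C * N + C'))).
    by rewrite mulr_ge0// addr_ge0// mulr_ge0.
  apply: filterS2 HC (ds_near ds0 r0) => i Ci dr.
  rewrite normL2_ge0/=; have p0 : 0 <= ds (d i) `^ eps by exact: powR_ge0.
  have k0 := kernel_error_ge0 (d i).
  apply: (@le_trans _ _ (2 * (kernel_error (d i) * N + C' * ds (d i) `^ eps))%:E).
    apply/normL2_le; last first.
      apply: (norm_sq_discrete_sub_radon A_proper fL) => //; first by rewrite mulr_ge0.
      exact: Hr.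
    by rewrite mulr_ge0// addr_ge0// mulr_ge0.
  by rewrite lee_fin; have := ler_wpM2r N0 Ci; lra.
- move=> g eps gL eps0 Hg I F d ds0 rphi rx.
  have /L2P[mg gfin gA] := gL.
  have [C C0 HC] := kernel_error_rate ds0 eps0 rphi rx.
  have gA' s phi : ~ A phi -> g (s, phi) = 0 by move=> phiA; apply: gA => -[].
  have [C' C'0 [r r0 Hr]] := dispersion_rate mg gA' eps0 Hg.
  set G := Num.sqrt (fine (norm_sq g)).
  have G0 : 0 <= G by exact: sqrtr_ge0.
  have gG : (norm_sq g <= (G ^+ 2)%:E)%E by rewrite -norm_sq_sqrt.
  apply: (ebigO_le (C := C * G + 4 * C')).
    by rewrite addr_ge0// mulr_ge0.
  apply: filterS2 HC (ds_near ds0 r0) => i Ci dr.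
  rewrite normL2_ge0/=; have p0 : 0 <= ds (d i) `^ eps by exact: powR_ge0.
  have k0 := kernel_error_ge0 (d i).
  have B0 : 0 <= kernel_error (d i) * G + 4 * (C' * ds (d i) `^ eps).
    by apply: addr_ge0; apply: mulr_ge0 => //; exact: mulr_ge0.
  apply: (@le_trans _ _ (kernel_error (d i) * G + 4 * (C' * ds (d i) `^ eps))%:E).
    (* By duality the test function [f] is arbitrary and only its norm enters; the rate comes from
       the dispersion of [g]. *)
    apply/normL2_le => //; apply: (norm_sq_adjoint_sub gL) => // f N fL N0 fN.
    apply: (inner_discrete_sub_radon A_proper fL gL) => //; first by rewrite mulr_ge0.
    exact: Hr.
  by rewrite lee_fin; have := ler_wpM2r G0 Ci; lra.
Qed.
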